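(* Let $p\ge 3$ and $n\ge 1$ be integers, and set $\alpha=\frac{p}{2}$, $\gamma=\frac{n}{2}$. Consider the Hamiltonian system $$\dot{\varphi}=\frac{\partial H}{\partial r}(r,\varphi,t),\qquad \dot{r}=-\frac{\partial H}{\partial \varphi}(r,\varphi,t)$$ with Hamiltonian $$H(r,\varphi,t)=r^{\alpha}\psi_{0}(\varphi)+r^{\alpha+\gamma}\psi_{1}(\varphi)+O\big(r^{\alpha+\gamma+\frac{1}{2}}\big)\quad (r\to 0^+),$$ where $\psi_0,\psi_1$ are real analytic periodic functions of $\varphi$. Suppose there exist $\varphi_{0}$ and an odd integer $m>1$ such that $$\psi_{0}(\varphi_{0})=\psi_0'(\varphi_0)=\cdots=\psi_{0}^{(m-1)}(\varphi_{0})=0,\qquad \psi_{0}^{(m)}(\varphi_{0})\neq 0,$$ and $$\psi_{0}^{(m)}(\varphi_{0})\,\psi'_{1}(\varphi_{0})>0.$$ Then the equilibrium $r=0$ of the system is unstable in the sense of Lyapunov.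
   Context: Here $(r,\varphi)$ are action-angle variables ($r\ge 0$ the action, $\varphi$ the angle); the Hamiltonian $H$ is an analytic function of $\sqrt{r},\varphi,t$, periodic in $\varphi$ and periodic in $t$, and $O(r^{\alpha+\gamma+1/2})$ denotes a remainder of that order as $r\to0^+$. Stability of $r=0$ in the sense of Lyapunov means: for every $\varepsilon>0$ there is $\delta>0$ such that if $r(0)<\delta$ then the solution is defined for all $t\ge 0$ and $r(t)<\varepsilon$; instability is the negation of this. *)

(* Defs.v *)
From Stdlib Require Import Reals Lra.
From Coquelicot Require Import Coquelicot.
Open Scope R_scope.

Definition analytic1 (f : R -> R) : Prop :=
  forall x0 : R, exists (a : nat -> R) (d : R), 0 < d /\
    forall x, Rabs (x - x0) < d -> is_pseries a (x - x0) (f x).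

Definition pser3_deg (cf : nat -> nat -> nat -> R) (u v w : R) (N : nat) : R :=
  sum_f_R0 (fun i => sum_f_R0 (fun j =>
     cf i j (N - i - j)%nat * u ^ i * v ^ j * w ^ (N - i - j)) (N - i)) N.

Definition analytic3 (U : R -> R -> R -> Prop) (G : R -> R -> R -> R) : Prop :=
  forall a b c, U a b c -> exists (cf : nat -> nat -> nat -> R) (d : R), 0 < d /\
    forall x y z, Rabs (x - a) < d -> Rabs (y - b) < d -> Rabs (z - c) < d ->
      ex_series (fun N => pser3_deg (fun i j k => Rabs (cf i j k))
                            (Rabs (x - a)) (Rabs (y - b)) (Rabs (z - c)) N) /\
      is_series (pser3_deg cf (x - a) (y - b) (z - c)) (G x y z).

Definition Ham (G : R -> R -> R -> R) (r phi t : R) : R := G (sqrt r) phi t.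

(** (r, phi) solves  phi' = dH/dr,  r' = - dH/dphi  on [0, T) (T may be +oo),
    in the region r > 0 where the action-angle chart is regular. *)
Definition is_solution (G : R -> R -> R -> R) (T : Rbar) (r phi : R -> R) : Prop :=
  forall t, 0 <= t -> Rbar_lt t T ->
    0 < r t /\
    is_derive phi t (Derive (fun x => Ham G x (phi t) t) (r t)) /\
    is_derive r t (- Derive (fun y => Ham G (r t) y t) (phi t)).

Definition lyapunov_stable (G : R -> R -> R -> R) : Prop :=
  forall eps, 0 < eps -> exists delta, 0 < delta /\
    forall r0 phi0, 0 < r0 -> r0 < delta ->
      (exists r phi, r 0 = r0 /\ phi 0 = phi0 /\ is_solution G p_infty r phi) /\
      (forall (T : Rbar) r phi, r 0 = r0 -> phi 0 = phi0 -> is_solution G T r phi ->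
         forall t, 0 <= t -> Rbar_lt t T -> r t < eps).

(* Main.v *)
Require Import Defs.
From Stdlib Require Import Reals Arith ZArith Lra Lia Classical ClassicalEpsilon.
From Coquelicot Require Import Coquelicot.
Open Scope R_scope.

(** The expansion bounds H itself, whereas the argument needs signs of its derivatives. As H is
    analytic in rho = sqrt r across rho = 0, the bound determines the Taylor coefficients at rho = 0
    up to order p + n, and these may be differentiated in phi. Put s = phi - phi0. Since m is odd, A
    psi0' behaves like A^2 s^(m-1) with an even exponent: it is nonnegative, but zero at s = 0,
    where the term with psi1' takes over, A psi1' being positive. This is the origin of the common
    lower bound of order rho^(p+n) for A dH/dphi. In the angular equation the term with psi0
    dominates only away from s = 0; a funnel needs it only on the sides |s| = eta.

    In the second case no escaping orbit is exhibited. The disc is replaced by a Lipschitz test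
    function f, and its image under the flow by the composition of f with n backward steps of the
    scheme. This composition is again a Lipschitz function, so Riemann integrals suffice and no
    image set has to be measured. True orbits serve only to locate its support. *)

(**
Write [A] for the [m]-th derivative of [psi0] at [phi0].  Near [phi = phi0] and
for small [r], the sign of [r'] is that of [-A], and the angle is attracted by
[phi0] in the direction of time in which [r] increases: the set
[|phi - phi0| <= eta] is a funnel along which orbits climb from arbitrarily
small [r] to a fixed height, in forward time if [A < 0] and in backward time if
[A > 0].  In the first case instability is immediate.

In the second case, stability would make a small disc [B] inside the funnel
wander: its points come from a height that forward orbits starting in [B] never
reach, hence the forward images of [B] under a power of the period map are
pairwise disjoint; they also stay in a region of finite area.  This contradicts
conservation of area.  No flow has to be constructed, because stability
provides the orbits starting in [B].  Conservation of area is used for a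
backward splitting scheme, each step of which is a composition of two shears
preserving area up to [O(h^2)]; it is compared with the true orbits by a
Gronwall estimate.
*)

(** * Termwise differentiation of triple power series *)

(** Terms are grouped by total degree i + j + k = N, as in [pser3_deg]; since j <= N - i, the
    subtraction N - i - j is never truncated. *)
Definition tri (f : nat -> nat -> nat -> R) (N : nat) : R :=
  sum_f_R0 (fun i => sum_f_R0 (fun j => f i j (N - i - j)%nat) (N - i)) N.

Lemma tri_ext f g N :
  (forall i j k, (i + j + k = N)%nat -> f i j k = g i j k) -> tri f N = tri g N.
Proof.
  intros H. unfold tri. apply sum_eq; intros i Hi. apply sum_eq; intros j Hj.
  apply H; lia.
Qed.

Lemma tri_le f g N :
  (forall i j k, (i + j + k = N)%nat -> f i j k <= g i j k) -> tri f N <= tri g N.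
Proof.
  intros H. unfold tri. apply sum_Rle; intros i Hi. apply sum_Rle; intros j Hj.
  apply H; lia.
Qed.

Lemma tri_0 N : tri (fun _ _ _ => 0) N = 0.
Proof.
  unfold tri. apply sum_eq_R0; intros. apply sum_eq_R0; intros; reflexivity.
Qed.

Lemma tri_pos f N : (forall i j k, 0 <= f i j k) -> 0 <= tri f N.
Proof. intros H. rewrite <- (tri_0 N). apply tri_le; intros; apply H. Qed.

Lemma tri_abs f N : Rabs (tri f N) <= tri (fun i j k => Rabs (f i j k)) N.
Proof.
  unfold tri. eapply Rle_trans. { apply Rsum_abs. }
  apply sum_Rle; intros i Hi. apply Rsum_abs.
Qed.

Lemma tri_scal c f N : tri (fun i j k => c * f i j k) N = c * tri f N.
Proof.
  unfold tri. rewrite scal_sum. apply sum_eq; intros i Hi.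
  rewrite Rmult_comm, scal_sum. apply sum_eq; intros; ring.
Qed.

Lemma tri_plus f g N : tri (fun i j k => f i j k + g i j k) N = tri f N + tri g N.
Proof.
  unfold tri. rewrite <- plus_sum. apply sum_eq; intros i Hi. now rewrite plus_sum.
Qed.

Lemma sum_shift (f : nat -> R) N : sum_f_R0 f (S N) = f 0%nat + sum_f_R0 (fun i => f (S i)) N.
Proof. rewrite decomp_sum by lia. reflexivity. Qed.

Lemma tri_shift1 f N : (forall j k, f 0%nat j k = 0) ->
  tri f (S N) = tri (fun i j k => f (S i) j k) N.
Proof.
  intros H. unfold tri. rewrite sum_shift, sum_eq_R0, Rplus_0_l by (intros; apply H).
  reflexivity.
Qed.

Lemma tri_shift2 f N : (forall i k, f i 0%nat k = 0) ->
  tri f (S N) = tri (fun i j k => f i (S j) k) N.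
Proof.
  intros H. unfold tri. rewrite tech5, Nat.sub_diag. cbn [sum_f_R0].
  rewrite H, Rplus_0_r. apply sum_eq; intros i Hi.
  replace (S N - i)%nat with (S (N - i)) by lia.
  rewrite sum_shift, H, Rplus_0_l. reflexivity.
Qed.

Lemma tri_shift3 f N : (forall i j, f i j 0%nat = 0) ->
  tri f (S N) = tri (fun i j k => f i j (S k)) N.
Proof.
  intros H. unfold tri. rewrite tech5, Nat.sub_diag. cbn [sum_f_R0].
  rewrite H, Rplus_0_r. apply sum_eq; intros i Hi.
  replace (S N - i)%nat with (S (N - i)) by lia.
  rewrite tech5, Nat.sub_diag, H, Rplus_0_r. apply sum_eq; intros j Hj.
  f_equal; lia.
Qed.

Lemma INR_le_pow2 n : INR n <= 2 ^ n.
Proof.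
  induction n; [simpl; lra|]. rewrite S_INR; simpl pow.
  pose proof (pow_R1_Rle 2 n ltac:(lra)). lra.
Qed.

Lemma INR_sqr_le_pow2 n : INR n * INR n <= 4 * 2 ^ n.
Proof.
  assert (H : INR n * INR n + 2 * INR n + 3 <= 4 * 2 ^ n).
  { induction n; [simpl; lra|]. rewrite S_INR; simpl pow. nra. }
  pose proof (pos_INR n); lra.
Qed.

(** The remainders satisfy e_(n+1) = (u + h) e_n + h^2 n u^(n-1), whence the induction. The factor
    b^2 on the left stands for the exponent n - 2 on the right and also covers b = 0. *)
Lemma pow_taylor2_bound (b u h : R) (n : nat) :
  Rabs u <= b -> Rabs (u + h) <= b ->
  Rabs ((u + h) ^ n - u ^ n - h * (INR n * u ^ (pred n))) * b ^ 2
    <= h ^ 2 * (INR n * INR n) * b ^ n.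
Proof.
  intros Hu Huh. assert (Hb : 0 <= b) by (pose proof (Rabs_pos u); lra).
  induction n as [|n IH].
  { simpl. replace (1 - 1 - h * (0 * 1)) with 0 by ring. rewrite Rabs_R0. lra. }
  set (e := (u + h) ^ n - u ^ n - h * (INR n * u ^ (pred n))) in *.
  assert (Hn : INR n * Rabs (u ^ pred n) * b ^ 2 <= INR n * b ^ S n).
  { destruct n as [|n]; [simpl; lra|]. simpl pred.
    replace (b ^ S (S n)) with (b ^ n * b ^ 2) by (simpl; ring).
    rewrite <- RPow_abs. pose proof (pow_incr (Rabs u) b n (conj (Rabs_pos _) Hu)).
    pose proof (pos_INR (S n)). pose proof (pow2_ge_0 b).
    rewrite <- Rmult_assoc. apply Rmult_le_compat_r; auto.
    apply Rmult_le_compat_l; auto. }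
  replace ((u + h) ^ S n - u ^ S n - h * (INR (S n) * u ^ pred (S n)))
    with ((u + h) * e + h ^ 2 * (INR n * u ^ pred n)).
  2:{ unfold e. rewrite S_INR. simpl pred. destruct n as [|n]; simpl; try ring. }
  eapply Rle_trans.
  { apply Rmult_le_compat_r; [apply pow2_ge_0|]. apply Rabs_triang. }
  rewrite !Rabs_mult, (Rabs_right (INR n)) by (apply Rle_ge, pos_INR).
  rewrite (Rabs_right (h ^ 2)) by (apply Rle_ge, pow2_ge_0).
  pose proof (pow2_ge_0 h). pose proof (pow_le b n Hb).
  assert (Rabs (u + h) * (Rabs e * b ^ 2) <= b * (h ^ 2 * (INR n * INR n) * b ^ n)).
  { apply Rmult_le_compat; auto; try apply Rabs_pos.
    apply Rmult_le_pos; [apply Rabs_pos|apply pow2_ge_0]. }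
  assert (h ^ 2 * (INR n * Rabs (u ^ pred n) * b ^ 2) <= h ^ 2 * (INR n * b ^ S n))
    by (apply Rmult_le_compat_l; auto).
  assert (0 <= h ^ 2 * b ^ S n * (INR n + 1)).
  { pose proof (pos_INR n). apply Rmult_le_pos; [apply Rmult_le_pos; [auto|now apply pow_le]|lra]. }
  rewrite S_INR. replace (b ^ S n) with (b * b ^ n) in * by reflexivity.
  rewrite Rmult_plus_distr_r, !Rmult_assoc in *. lra.
Qed.

Lemma is_derive_quadratic (f : R -> R) (x l d K : R) : 0 < d ->
  (forall h, Rabs h < d -> Rabs (f (x + h) - f x - h * l) <= K * h ^ 2) ->
  is_derive f x l.
Proof.
  intros Hd H. apply is_derive_Reals. intros eps Heps.
  assert (HK : 0 < Rabs K + 1) by (pose proof (Rabs_pos K); lra).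
  assert (Hdl : 0 < Rmin d (eps / (Rabs K + 1))).
  { apply Rmin_pos; auto. now apply Rdiv_lt_0_compat. }
  exists (mkposreal _ Hdl). simpl. intros h Hh0 Hh.
  pose proof (Rlt_le_trans _ _ _ Hh (Rmin_l _ _)) as H1.
  pose proof (Rlt_le_trans _ _ _ Hh (Rmin_r _ _)) as H2.
  specialize (H h H1).
  replace ((f (x + h) - f x) / h - l) with ((f (x + h) - f x - h * l) / h) by (field; auto).
  unfold Rdiv. rewrite Rabs_mult, Rabs_inv.
  pose proof (Rabs_pos_lt h Hh0) as Hp.
  apply Rmult_lt_reg_r with (Rabs h); auto.
  rewrite Rmult_assoc, Rinv_l, Rmult_1_r by lra.
  eapply Rle_lt_trans; [exact H|].
  replace (h ^ 2) with (Rabs h * Rabs h) by (rewrite <- Rabs_mult, Rabs_right; [ring|nra]).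
  rewrite <- Rmult_assoc. apply Rmult_lt_compat_r; auto.
  apply Rle_lt_trans with ((Rabs K + 1) * Rabs h).
  { apply Rmult_le_compat_r; [lra|]. pose proof (Rle_abs K); lra. }
  apply Rmult_lt_reg_l with (/ (Rabs K + 1)); [now apply Rinv_0_lt_compat|].
  rewrite <- Rmult_assoc, Rinv_l, Rmult_1_l by lra. unfold Rdiv in H2. lra.
Qed.

(** Halving the radius pays for the factor n, because n <= 2^n. *)
Lemma half_pow_INR s n : 0 < s -> INR n * (s / 2) ^ pred n <= 2 / s * s ^ n.
Proof.
  intros Hs. destruct n as [|n].
  { simpl. rewrite Rmult_0_l, Rmult_1_r. apply Rlt_le, Rdiv_lt_0_compat; lra. }
  simpl pred. unfold Rdiv at 1. rewrite Rpow_mult_distr.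
  replace (2 / s * s ^ S n) with (2 ^ S n * (s ^ n * / 2 ^ n)).
  2:{ simpl. field. split; [lra|apply pow_nonzero; lra]. }
  rewrite pow_inv. apply Rmult_le_compat_r; [|apply INR_le_pow2].
  apply Rmult_le_pos; [apply pow_le; lra|]. apply Rlt_le, Rinv_0_lt_compat, pow_lt; lra.
Qed.

Section Termwise.
Variables (C : nat -> nat -> nat -> R) (e : nat -> nat -> nat -> nat) (s : R).
Hypothesis Hs : 0 < s.
Hypothesis HC : ex_series (tri (fun i j k => Rabs (C i j k) * s ^ e i j k)).

Lemma ex_series_tri_derive u : Rabs u <= s / 2 ->
  ex_series (tri (fun i j k => C i j k * (INR (e i j k) * u ^ pred (e i j k)))).
Proof.
  intros Hu. apply (@ex_series_le R_AbsRing R_CompleteNormedModule) with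
    (fun N => 2 / s * tri (fun i j k => Rabs (C i j k) * s ^ e i j k) N).
  2:{ now apply (@ex_series_scal R_AbsRing R_NormedModule). }
  intros N. unfold norm; simpl; unfold abs; simpl. rewrite <- tri_scal.
  eapply Rle_trans; [apply tri_abs|]. apply tri_le; intros i j k _.
  rewrite !Rabs_mult, (Rabs_right (INR _)) by (apply Rle_ge, pos_INR).
  rewrite <- RPow_abs.
  replace (2 / s * (Rabs (C i j k) * s ^ e i j k))
    with (Rabs (C i j k) * (2 / s * s ^ e i j k)) by ring.
  apply Rmult_le_compat_l; [apply Rabs_pos|].
  eapply Rle_trans; [|apply half_pow_INR; auto].
  apply Rmult_le_compat_l; [apply pos_INR|].
  apply pow_incr; split; auto; apply Rabs_pos.
Qed.

(** Only one variable u moves: the powers of the other two are absorbed in [C], and [e] selects the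
    exponent of u, so one proof serves all three partial derivatives. The increment minus its linear
    part is the series of second-order remainders of the monomials, dominated by a multiple of h^2
    times the majorant. *)
Lemma is_derive_tri (F : R -> R) :
  (forall u, Rabs u <= s -> is_series (tri (fun i j k => C i j k * u ^ e i j k)) (F u)) ->
  forall u, Rabs u < s / 2 ->
  is_derive F u (Series (tri (fun i j k => C i j k * (INR (e i j k) * u ^ pred (e i j k))))).
Proof.
  intros HF u Hu.
  set (W := tri (fun i j k => Rabs (C i j k) * s ^ e i j k)) in *.
  apply is_derive_quadratic with (d := s / 2 - Rabs u) (K := 16 / s ^ 2 * Series W).
  { lra. }
  intros h Hh.
  assert (Huh : Rabs (u + h) <= s / 2).
  { eapply Rle_trans; [apply Rabs_triang|]. lra. }
  pose proof (HF (u + h) ltac:(lra)) as S1. pose proof (HF u ltac:(lra)) as S2.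
  pose proof (Series_correct _ (ex_series_tri_derive u ltac:(lra))) as S3.
  set (L := Series _) in S3 |- *.
  set (E := tri (fun i j k => C i j k * ((u + h) ^ e i j k - u ^ e i j k
               - h * (INR (e i j k) * u ^ pred (e i j k))))).
  assert (SE : is_series E (F (u + h) - F u - h * L)).
  { pose proof (is_series_minus _ _ _ _ (is_series_minus _ _ _ _ S1 S2)
                  (is_series_scal_l h _ _ S3)) as SA.
    revert SA. apply is_series_ext. intros N. unfold E.
    unfold plus, opp, mult; simpl.
    rewrite <- tri_scal.
    match goal with |- tri ?a N + - tri ?b N + - tri ?c N = _ =>
      replace (tri a N + - tri b N + - tri c N)
        with (tri a N + ((-1) * tri b N + (-1) * tri c N)) by ring end.
    rewrite <- !tri_scal, <- !tri_plus. apply tri_ext; intros; ring. }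
  assert (Hb : forall N, norm (E N) <= 16 / s ^ 2 * h ^ 2 * W N).
  { intros N. change (norm (E N)) with (Rabs (E N)). unfold W, E.
    rewrite <- tri_scal. eapply Rle_trans; [apply tri_abs|].
    apply tri_le; intros i j k _. rewrite Rabs_mult.
    pose proof (pow_taylor2_bound (s / 2) u h (e i j k) ltac:(lra) Huh) as HT.
    set (q := Rabs (_ - _ - _)) in HT |- *.
    assert (Hq : q <= 16 / s ^ 2 * h ^ 2 * s ^ e i j k).
    { apply Rmult_le_reg_r with ((s / 2) ^ 2). { apply pow_lt; lra. }
      eapply Rle_trans; [exact HT|].
      replace (16 / s ^ 2 * h ^ 2 * s ^ e i j k * (s / 2) ^ 2)
        with (h ^ 2 * (4 * 2 ^ e i j k) * (s / 2) ^ e i j k).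
      2:{ unfold Rdiv at 1. rewrite Rpow_mult_distr, pow_inv. field.
          split; [lra|apply pow_nonzero; lra]. }
      apply Rmult_le_compat_r; [apply pow_le; lra|].
      apply Rmult_le_compat_l; [apply pow2_ge_0|apply INR_sqr_le_pow2]. }
    replace (16 / s ^ 2 * h ^ 2 * (Rabs (C i j k) * s ^ e i j k))
      with (Rabs (C i j k) * (16 / s ^ 2 * h ^ 2 * s ^ e i j k)) by ring.
    apply Rmult_le_compat_l; [apply Rabs_pos|exact Hq]. }
  assert (HW : ex_series (fun N => 16 / s ^ 2 * h ^ 2 * W N))
    by (apply (@ex_series_scal R_AbsRing R_NormedModule); exact HC).
  rewrite <- (is_series_unique _ _ SE).
  eapply Rle_trans.
  { apply Series_Rabs. apply (@ex_series_le R_AbsRing R_CompleteNormedModule) with (2 := HW).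
    intros n. change (Rabs (Rabs (E n)) <= 16 / s ^ 2 * h ^ 2 * W n). rewrite Rabs_Rabsolu. apply Hb. }
  eapply Rle_trans.
  { apply Series_le with (2 := HW). intros n. split; [apply Rabs_pos|apply Hb]. }
  rewrite Series_scal_l. right; ring.
Qed.

End Termwise.

(** Absolute convergence is asked only at the corner (s, s, s), which dominates the whole closed
    box. This form reproduces itself under partial derivatives, with s replaced by s / 4. *)
Definition psum (cf : nat -> nat -> nat -> R) (s : R) (F : R -> R -> R -> R) (a b c : R) : Prop :=
  0 < s /\ ex_series (tri (fun i j k => Rabs (cf i j k) * s ^ (i + j + k))) /\
  forall x y z, Rabs (x - a) <= s -> Rabs (y - b) <= s -> Rabs (z - c) <= s ->
    is_series (tri (fun i j k => cf i j k * (x - a) ^ i * (y - b) ^ j * (z - c) ^ k)) (F x y z).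

Definition Dx (F : R -> R -> R -> R) (x y z : R) : R := Derive (fun u => F u y z) x.
Definition Dy (F : R -> R -> R -> R) (x y z : R) : R := Derive (fun u => F x u z) y.
Definition Dz (F : R -> R -> R -> R) (x y z : R) : R := Derive (fun u => F x y u) z.

Definition dx (cf : nat -> nat -> nat -> R) i j k := INR (S i) * cf (S i) j k.
Definition dy (cf : nat -> nat -> nat -> R) i j k := INR (S j) * cf i (S j) k.
Definition dz (cf : nat -> nat -> nat -> R) i j k := INR (S k) * cf i j (S k).

Lemma pow_le_abs u s n : Rabs u <= s -> Rabs (u ^ n) <= s ^ n.
Proof. intros H. rewrite <- RPow_abs. apply pow_incr; split; auto; apply Rabs_pos. Qed.

Lemma ex_series_tri_le f g : (forall i j k, 0 <= f i j k <= g i j k) ->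
  ex_series (tri g) -> ex_series (tri f).
Proof.
  intros H. apply (@ex_series_le R_AbsRing R_CompleteNormedModule). intros N.
  change (Rabs (tri f N) <= tri g N). rewrite Rabs_right.
  - apply tri_le; intros; apply H.
  - apply Rle_ge, tri_pos; apply H.
Qed.

Lemma shifted_coef_bound s q A n N : 0 < s -> (n <= N)%nat -> (A = S n) ->
  INR A * Rabs q * (s / 4) ^ N <= 2 / s * (Rabs q * s ^ S N).
Proof.
  intros Hs Hn ->.
  replace (2 / s * (Rabs q * s ^ S N)) with (Rabs q * (2 * s ^ N)) by (simpl; field; lra).
  replace (INR (S n) * Rabs q * (s / 4) ^ N) with (Rabs q * (INR (S n) * (s / 4) ^ N)) by ring.
  apply Rmult_le_compat_l; [apply Rabs_pos|].
  assert (HI : INR (S n) <= 2 * 4 ^ N).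
  { eapply Rle_trans; [apply INR_le_pow2|]. simpl.
    apply Rmult_le_compat_l; [lra|]. eapply Rle_trans; [apply Rle_pow; [lra|exact Hn]|].
    apply pow_incr; lra. }
  unfold Rdiv. rewrite Rpow_mult_distr, pow_inv.
  apply Rmult_le_reg_r with (4 ^ N). { apply pow_lt; lra. }
  replace (INR (S n) * (s ^ N * / 4 ^ N) * 4 ^ N) with (INR (S n) * s ^ N)
    by (field; apply pow_nonzero; lra).
  pose proof (pow_le s N ltac:(lra)). nra.
Qed.


(** The termwise derivative has no term of total degree 0; dropping it lowers the degree by one and
    matches the shifted coefficients [dx], [dy], [dz]. *)
Lemma tri_derive_shifted C (e : nat -> nat -> nat -> nat) s (F : R -> R) a x :
  e 0%nat 0%nat 0%nat = 0%nat -> 0 < s ->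
  ex_series (tri (fun i j k => Rabs (C i j k) * s ^ e i j k)) ->
  (forall x, Rabs (x - a) <= s -> is_series (tri (fun i j k => C i j k * (x - a) ^ e i j k)) (F x)) ->
  Rabs (x - a) < s / 2 ->
  is_derive F x (Derive F x) /\
  is_series (fun N => tri (fun i j k => C i j k * (INR (e i j k) * (x - a) ^ pred (e i j k))) (S N))
    (Derive F x).
Proof.
  intros He Hs HC HFx Hx.
  assert (HFu : forall u, Rabs u <= s -> is_series (tri (fun i j k => C i j k * u ^ e i j k)) (F (u + a))).
  { intros u Hu. pose proof (HFx (u + a)) as H.
    replace (u + a - a) with u in H by ring. exact (H Hu). }
  pose proof (is_derive_tri C e s Hs HC (fun u => F (u + a)) HFu (x - a) Hx) as HD.
  pose proof (Series_correct _ (ex_series_tri_derive C e s Hs HC (x - a) ltac:(lra))) as HSC.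
  set (L := Series _) in *.
  assert (HD' : is_derive F x L).
  { apply is_derive_ext with (fun u => F ((u - a) + a)).
    { intros t. f_equal; ring. }
    replace L with (scal 1 L) by apply Rmult_1_l.
    apply (is_derive_comp (fun v => F (v + a)) (fun u => u - a)); [exact HD|].
    auto_derive; [auto|ring]. }
  rewrite (is_derive_unique _ _ _ HD'). split; [exact HD'|].
  apply is_series_incr_1.
  replace (tri _ 0%nat) with 0 by (unfold tri; simpl; rewrite He; simpl; ring).
  change (is_series (tri (fun i j k => C i j k * (INR (e i j k) * (x - a) ^ pred (e i j k)))) (L + 0)).
  now rewrite Rplus_0_r.
Qed.

Lemma shifted_coefs_summable (cf : nat -> nat -> nat -> R) s (sh : nat -> nat -> nat -> R) (e : nat -> nat -> nat -> nat) :
  0 < s ->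
  (forall i j k, (e i j k <= i + j + k)%nat) ->
  (forall N, tri (fun i j k => Rabs (sh i j k) * s ^ S (i + j + k)) N
      <= tri (fun i j k => Rabs (cf i j k) * s ^ (i + j + k)) (S N)) ->
  ex_series (tri (fun i j k => Rabs (cf i j k) * s ^ (i + j + k))) ->
  ex_series (tri (fun i j k => Rabs (INR (S (e i j k)) * sh i j k) * (s / 4) ^ (i + j + k))).
Proof.
  intros Hs He Hsh Hc.
  apply (@ex_series_le R_AbsRing R_CompleteNormedModule) with
    (fun N => 2 / s * tri (fun i j k => Rabs (cf i j k) * s ^ (i + j + k)) (S N)).
  2:{ apply (@ex_series_scal R_AbsRing R_NormedModule). now apply ex_series_incr_1 in Hc. }
  intros N.
  change (Rabs (tri (fun i j k => Rabs (INR (S (e i j k)) * sh i j k) * (s / 4) ^ (i + j + k)) N)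
     <= 2 / s * tri (fun i j k => Rabs (cf i j k) * s ^ (i + j + k)) (S N)).
  rewrite Rabs_right.
  2:{ apply Rle_ge, tri_pos; intros. apply Rmult_le_pos; [apply Rabs_pos|apply pow_le; lra]. }
  apply Rle_trans with (2 / s * tri (fun i j k => Rabs (sh i j k) * s ^ S (i + j + k)) N).
  2:{ apply Rmult_le_compat_l; [apply Rlt_le, Rdiv_lt_0_compat; lra|apply Hsh]. }
  rewrite <- tri_scal. apply tri_le; intros i j k _.
  rewrite Rabs_mult, (Rabs_right (INR _)) by (apply Rle_ge, pos_INR).
  apply shifted_coef_bound with (n := e i j k); auto.
Qed.

Lemma Rabs_monomial_bound q u v s j k m : Rabs u <= s -> Rabs v <= s ->
  Rabs (q * u ^ j * v ^ k) * s ^ m <= Rabs q * s ^ (j + k + m).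
Proof.
  intros Hu Hv. assert (Hs : 0 <= s) by (pose proof (Rabs_pos u); lra).
  rewrite !Rabs_mult, !pow_add, <- !Rmult_assoc.
  pose proof (pow_le_abs _ _ j Hu). pose proof (pow_le_abs _ _ k Hv).
  apply Rmult_le_compat_r; [now apply pow_le|].
  repeat apply Rmult_le_compat; auto using Rabs_pos, Rmult_le_pos; lra.
Qed.

Section PsumDerive.
Variables (cf : nat -> nat -> nat -> R) (s : R) (F : R -> R -> R -> R) (a b c : R).
Hypothesis HF : psum cf s F a b c.

Lemma psum_is_derive_x x y z :
  Rabs (x - a) < s / 2 -> Rabs (y - b) <= s -> Rabs (z - c) <= s ->
  is_derive (fun u => F u y z) x (Dx F x y z) /\
  is_series (tri (fun i j k => dx cf i j k * (x - a) ^ i * (y - b) ^ j * (z - c) ^ k)) (Dx F x y z).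
Proof.
  destruct HF as (Hs & Hc & HS). intros Hx Hy Hz.
  destruct (tri_derive_shifted (fun i j k => cf i j k * (y - b) ^ j * (z - c) ^ k)
    (fun i _ _ => i) s (fun u => F u y z) a x) as [H1 H2]; auto.
  { apply ex_series_tri_le with (2 := Hc). intros i j k. split.
    - apply Rmult_le_pos; [apply Rabs_pos|apply pow_le; lra].
    - replace (i + j + k)%nat with (j + k + i)%nat by lia. now apply Rabs_monomial_bound. }
  { intros u Hu. generalize (HS u y z Hu Hy Hz). apply is_series_ext.
    intros N. apply tri_ext; intros; ring. }
  split; [exact H1|]. revert H2. apply is_series_ext. intros N.
  rewrite tri_shift1 by (intros; simpl; ring).
  apply tri_ext; intros; unfold dx; simpl pred; ring.
Qed.

Lemma psum_is_derive_y x y z :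
  Rabs (x - a) <= s -> Rabs (y - b) < s / 2 -> Rabs (z - c) <= s ->
  is_derive (fun u => F x u z) y (Dy F x y z) /\
  is_series (tri (fun i j k => dy cf i j k * (x - a) ^ i * (y - b) ^ j * (z - c) ^ k)) (Dy F x y z).
Proof.
  destruct HF as (Hs & Hc & HS). intros Hx Hy Hz.
  destruct (tri_derive_shifted (fun i j k => cf i j k * (x - a) ^ i * (z - c) ^ k)
    (fun _ j _ => j) s (fun u => F x u z) b y) as [H1 H2]; auto.
  { apply ex_series_tri_le with (2 := Hc). intros i j k. split.
    - apply Rmult_le_pos; [apply Rabs_pos|apply pow_le; lra].
    - replace (i + j + k)%nat with (i + k + j)%nat by lia. now apply Rabs_monomial_bound. }
  { intros u Hu. generalize (HS x u z Hx Hu Hz). apply is_series_ext.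
    intros N. apply tri_ext; intros; ring. }
  split; [exact H1|]. revert H2. apply is_series_ext. intros N.
  rewrite tri_shift2 by (intros; simpl; ring).
  apply tri_ext; intros; unfold dy; simpl pred; ring.
Qed.

Lemma psum_is_derive_z x y z :
  Rabs (x - a) <= s -> Rabs (y - b) <= s -> Rabs (z - c) < s / 2 ->
  is_derive (fun u => F x y u) z (Dz F x y z) /\
  is_series (tri (fun i j k => dz cf i j k * (x - a) ^ i * (y - b) ^ j * (z - c) ^ k)) (Dz F x y z).
Proof.
  destruct HF as (Hs & Hc & HS). intros Hx Hy Hz.
  destruct (tri_derive_shifted (fun i j k => cf i j k * (x - a) ^ i * (y - b) ^ j)
    (fun _ _ k => k) s (fun u => F x y u) c z) as [H1 H2]; auto.
  { apply ex_series_tri_le with (2 := Hc). intros i j k. split.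
    - apply Rmult_le_pos; [apply Rabs_pos|apply pow_le; lra].
    - now apply Rabs_monomial_bound. }
  split; [exact H1|]. revert H2. apply is_series_ext. intros N.
  rewrite tri_shift3 by (intros; simpl; ring).
  apply tri_ext; intros; unfold dz; simpl pred; ring.
Qed.

(** The quarter radius keeps the closed box inside the open range |x - a| < s / 2 of
    [psum_is_derive_x], and pays for the factors i + 1 in the majorant. *)
Lemma psum_Dx : psum (dx cf) (s / 4) (Dx F) a b c.
Proof.
  destruct HF as (Hs & Hc & HS). repeat split; [lra| |].
  - apply (shifted_coefs_summable cf s (fun i j k => cf (S i) j k) (fun i _ _ => i)); auto.
    { intros; lia. }
    intros N. rewrite <- (tri_shift1 (fun i j k => match i with O => 0 | S _ =>
        Rabs (cf i j k) * s ^ (i + j + k) end)) by reflexivity.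
    apply tri_le; intros [|i] j k _; [|lra].
    apply Rmult_le_pos; [apply Rabs_pos|apply pow_le; lra].
  - intros x y z Hx Hy Hz. apply psum_is_derive_x; lra.
Qed.

Lemma psum_Dy : psum (dy cf) (s / 4) (Dy F) a b c.
Proof.
  destruct HF as (Hs & Hc & HS). repeat split; [lra| |].
  - apply (shifted_coefs_summable cf s (fun i j k => cf i (S j) k) (fun _ j _ => j)); auto.
    { intros; lia. }
    intros N.
    apply Rle_trans with (tri (fun i j k => match j with O => 0 | S _ =>
        Rabs (cf i j k) * s ^ (i + j + k) end) (S N)).
    { rewrite tri_shift2 by reflexivity. right. apply tri_ext; intros.
      do 2 f_equal; lia. }
    apply tri_le; intros i [|j] k _; [|lra].
    apply Rmult_le_pos; [apply Rabs_pos|apply pow_le; lra].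
  - intros x y z Hx Hy Hz. apply psum_is_derive_y; lra.
Qed.

Lemma psum_Dz : psum (dz cf) (s / 4) (Dz F) a b c.
Proof.
  destruct HF as (Hs & Hc & HS). repeat split; [lra| |].
  - apply (shifted_coefs_summable cf s (fun i j k => cf i j (S k)) (fun _ _ k => k)); auto.
    { intros; lia. }
    intros N.
    apply Rle_trans with (tri (fun i j k => match k with O => 0 | S _ =>
        Rabs (cf i j k) * s ^ (i + j + k) end) (S N)).
    { rewrite tri_shift3 by reflexivity. right. apply tri_ext; intros.
      do 2 f_equal; lia. }
    apply tri_le; intros i j [|k] _; [|lra].
    apply Rmult_le_pos; [apply Rabs_pos|apply pow_le; lra].
  - intros x y z Hx Hy Hz. apply psum_is_derive_z; lra.
Qed.

Lemma psum_center : F a b c = cf 0%nat 0%nat 0%nat.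
Proof.
  destruct HF as (Hs & Hc & HS).
  assert (H0 : forall q, Rabs (q - q) <= s) by (intros; rewrite Rminus_diag, Rabs_R0; lra).
  specialize (HS a b c (H0 a) (H0 b) (H0 c)).
  rewrite <- (is_series_unique _ _ HS). apply is_series_unique, is_series_decr_1.
  apply is_series_ext with (fun _ => 0).
  { intros N. rewrite <- (tri_0 (S N)). apply tri_ext; intros i j k E.
    rewrite !Rminus_diag. destruct i; [destruct j; [destruct k; [lia|]|]|]; simpl; ring. }
  replace (plus _ _) with 0.
  2:{ unfold plus, opp, tri; simpl; ring. }
  apply is_series_Reals. intros eps He. exists 0%nat. intros n _.
  rewrite sum_eq_R0 by reflexivity. unfold R_dist. rewrite Rminus_diag, Rabs_R0. lra.
Qed.

Lemma psum_bounded : exists M, forall x y z,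
  Rabs (x - a) <= s -> Rabs (y - b) <= s -> Rabs (z - c) <= s -> Rabs (F x y z) <= M.
Proof.
  destruct HF as (Hs & Hc & HS). eexists. intros x y z Hx Hy Hz.
  specialize (HS x y z Hx Hy Hz). rewrite <- (is_series_unique _ _ HS).
  assert (Hb : forall N, Rabs (tri (fun i j k => cf i j k * (x - a) ^ i * (y - b) ^ j * (z - c) ^ k) N)
     <= tri (fun i j k => Rabs (cf i j k) * s ^ (i + j + k)) N).
  { intros N. eapply Rle_trans; [apply tri_abs|]. apply tri_le; intros i j k _.
    replace (i + j + k)%nat with (i + j + k + 0)%nat by lia.
    rewrite Rabs_mult, pow_add. change (s ^ 0) with 1. rewrite Rmult_1_r, pow_add, <- Rmult_assoc.
    apply Rmult_le_compat; auto using Rabs_pos.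
    - replace (Rabs (cf i j k * _ * _)) with (Rabs (cf i j k * (x - a) ^ i * (y - b) ^ j) * s ^ 0)
        by (simpl; ring).
      eapply Rle_trans; [now apply Rabs_monomial_bound|]. rewrite Nat.add_0_r; lra.
    - now apply pow_le_abs. }
  eapply Rle_trans.
  { apply Series_Rabs. apply (@ex_series_le R_AbsRing R_CompleteNormedModule) with (2 := Hc).
    intros N. change (Rabs (Rabs (tri (fun i j k => cf i j k * (x - a) ^ i * (y - b) ^ j * (z - c) ^ k) N))
     <= tri (fun i j k => Rabs (cf i j k) * s ^ (i + j + k)) N). rewrite Rabs_Rabsolu. apply Hb. }
  apply Series_le with (2 := Hc). intros N. split; [apply Rabs_pos|apply Hb].
Qed.

End PsumDerive.

(** At the centre of an expansion both mixed derivatives are the coefficient of index (1, 1, 0).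
    Every point is the centre of some expansion, so this gives their equality everywhere. *)
Lemma psum_DxDy cf s F a b c : psum cf s F a b c -> Dx (Dy F) a b c = Dy (Dx F) a b c.
Proof.
  intros H.
  rewrite (psum_center _ _ _ _ _ _ (psum_Dx _ _ _ _ _ _ (psum_Dy _ _ _ _ _ _ H))).
  rewrite (psum_center _ _ _ _ _ _ (psum_Dy _ _ _ _ _ _ (psum_Dx _ _ _ _ _ _ H))).
  reflexivity.
Qed.

(** * Functions analytic on the cylinder *)

Lemma pser3_deg_tri cf u v w N :
  pser3_deg cf u v w N = tri (fun i j k => cf i j k * u ^ i * v ^ j * w ^ k) N.
Proof. reflexivity. Qed.

Lemma bounded_on_box (F : R -> R -> R -> R) (a1 b1 a2 b2 a3 b3 : R) :
  (forall a b c, a1 <= a <= b1 -> a2 <= b <= b2 -> a3 <= c <= b3 ->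
    exists M s, 0 < s /\ forall x y z, Rabs (x - a) <= s -> Rabs (y - b) <= s -> Rabs (z - c) <= s ->
      Rabs (F x y z) <= M) ->
  exists M, 0 <= M /\ forall x y z, a1 <= x <= b1 -> a2 <= y <= b2 -> a3 <= z <= b3 ->
    Rabs (F x y z) <= M.
Proof.
  intros H.
  assert (Hd : forall t : Compactness.Tn 3 R, exists d : posreal, 
     bounded_n 3 (a1, (a2, (a3, tt))) (b1, (b2, (b3, tt))) t ->
     exists M, forall x, close_n 3 d x t -> Rabs (F (fst x) (fst (snd x)) (fst (snd (snd x)))) <= M).
  { intros (a & b & c & []).
    destruct (classic (bounded_n 3 (a1, (a2, (a3, tt))) (b1, (b2, (b3, tt))) (a, (b, (c, tt))))) as [Hb|Hb].
    - destruct Hb as (Ha & Hb & Hc & _). destruct (H a b c Ha Hb Hc) as (M & s & Hs & HM).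
      exists (mkposreal s Hs). intros _. exists M. intros (x & y & z & []) (Hx & Hy & Hz & _).
      simpl in *. apply HM; lra.
    (* [compactness_list] expects a gauge on the whole space; points outside the box receive a dummy
       radius. *)
    - exists (mkposreal 1 Rlt_0_1). intros Hb'. contradiction. }
  set (delta := fun t => proj1_sig (constructive_indefinite_description _ (Hd t))).
  assert (Hdelta := fun t => proj2_sig (constructive_indefinite_description _ (Hd t))).
  change (forall t, bounded_n 3 (a1, (a2, (a3, tt))) (b1, (b2, (b3, tt))) t ->
     exists M, forall x, close_n 3 (delta t) x t ->
       Rabs (F (fst x) (fst (snd x)) (fst (snd (snd x)))) <= M) in Hdelta.
  clearbody delta.
  destruct (NNPP _ (compactness_list 3 (a1, (a2, (a3, tt))) (b1, (b2, (b3, tt))) delta)) as [l Hl].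
  assert (HM : exists M, 0 <= M /\ forall t, List.In t l -> 
     bounded_n 3 (a1, (a2, (a3, tt))) (b1, (b2, (b3, tt))) t -> forall x, close_n 3 (delta t) x t ->
     Rabs (F (fst x) (fst (snd x)) (fst (snd (snd x)))) <= M).
  { clear Hl. induction l as [|t l [M [HM0 IH]]].
    - exists 0. split; [lra|]. intros t [].
    - destruct (classic (bounded_n 3 (a1, (a2, (a3, tt))) (b1, (b2, (b3, tt))) t)) as [Hb|Hb].
      + destruct (Hdelta t Hb) as [M' HM']. exists (Rmax M M'). split; [eapply Rle_trans, Rmax_l; auto|].
        intros t' [<-|Ht'] Hb' x Hx.
        * eapply Rle_trans, Rmax_r. now apply HM'.
        * eapply Rle_trans, Rmax_l. now apply (IH t').
      + exists M. split; auto. intros t' [<-|Ht'] Hb' x Hx; [contradiction|]. now apply (IH t'). }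
  destruct HM as (M & HM0 & HM). exists M. split; auto. intros x y z Hx Hy Hz.
  destruct (Hl (x, (y, (z, tt)))) as (t & Hin & Hbt & Hcl).
  { repeat split; tauto. }
  exact (HM t Hin Hbt _ Hcl).
Qed.

Lemma periodic_nat (f : R -> R) P : (forall x, f (x + P) = f x) -> forall n x, f (x + INR n * P) = f x.
Proof.
  intros H n. induction n as [|n IH]; intros x; [f_equal; simpl; ring|].
  rewrite S_INR. replace (x + (INR n + 1) * P) with (x + INR n * P + P) by ring. now rewrite H.
Qed.

Lemma periodic_Z (f : R -> R) P : (forall x, f (x + P) = f x) -> forall n x, f (x + IZR n * P) = f x.
Proof.
  intros H n x. destruct (Z_le_gt_dec 0 n) as [Hn|Hn].
  - rewrite <- (Z2Nat.id n), <- INR_IZR_INZ by auto. now apply periodic_nat.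
  - rewrite <- (periodic_nat f P H (Z.to_nat (- n)) (x + IZR n * P)). f_equal.
    rewrite INR_IZR_INZ, Z2Nat.id, opp_IZR by lia. ring.
Qed.

Lemma periodic_reduce P x : 0 < P -> exists n x', 0 <= x' <= P /\ x = x' + IZR n * P.
Proof.
  intros HP. exists (Int_part (x / P)), (x - IZR (Int_part (x / P)) * P).
  destruct (base_Int_part (x / P)) as [H1 H2]. split; [|ring].
  assert (E : x = x / P * P) by (field; lra).
  split; nra.
Qed.

Section Analytic.
Variables rho0 tau : R.
Hypothesis Htau : 0 < tau.

(** The first variable is rho = sqrt r. It ranges over both signs, so that rho = 0 is an interior
    point at which Taylor expansion is possible. *)
Definition cyl_analytic (F : R -> R -> R -> R) : Prop :=
  (forall a b c, -rho0 < a < rho0 -> exists cf s, psum cf s F a b c) /\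
  (forall x y z, F x (y + 2 * PI) z = F x y z) /\
  (forall x y z, F x y (z + tau) = F x y z).

Lemma cyl_analytic_of_analytic3 G :
  analytic3 (fun rho _ _ => -rho0 < rho < rho0) G ->
  (forall x y z, G x (y + 2 * PI) z = G x y z) ->
  (forall x y z, G x y (z + tau) = G x y z) -> cyl_analytic G.
Proof.
  intros H Hp Ht. split; [|now split]. intros a b c Ha.
  destruct (H a b c Ha) as (cf & d & Hd & HG). exists cf, (d / 2). split; [lra|]. split.
  - destruct (HG (a + d / 2) (b + d / 2) (c + d / 2)) as [HS _];
      try (match goal with |- Rabs ?x < _ => replace x with (d / 2) by ring end;
           rewrite Rabs_right; lra).
    revert HS. apply ex_series_ext. intros N. rewrite pser3_deg_tri. apply tri_ext; intros.
    rewrite !pow_add. replace (a + d / 2 - a) with (d / 2) by ring.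
    replace (b + d / 2 - b) with (d / 2) by ring. replace (c + d / 2 - c) with (d / 2) by ring.
    rewrite (Rabs_right (d / 2)) by lra. ring.
  - intros x y z Hx Hy Hz. destruct (HG x y z) as [_ HS]; try lra. exact HS.
Qed.

Lemma cyl_analytic_Dx F : cyl_analytic F -> cyl_analytic (Dx F).
Proof.
  intros (H & Hp & Ht). split; [|split].
  - intros a b c Ha. destruct (H a b c Ha) as (cf & s & Hs). eauto using psum_Dx.
  - intros; apply Derive_ext; intros; apply Hp.
  - intros; apply Derive_ext; intros; apply Ht.
Qed.

Lemma Derive_shift (f : R -> R) P x : (forall x, f (x + P) = f x) -> Derive f (x + P) = Derive f x.
Proof.
  intros H. unfold Derive. f_equal. apply Lim_ext. intros h.
  replace (x + P + h) with (x + h + P) by ring. now rewrite !H.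
Qed.

Lemma cyl_analytic_Dy F : cyl_analytic F -> cyl_analytic (Dy F).
Proof.
  intros (H & Hp & Ht). split; [|split].
  - intros a b c Ha. destruct (H a b c Ha) as (cf & s & Hs). eauto using psum_Dy.
  - intros; unfold Dy. apply (Derive_shift (fun u => F x u z)). intros; apply Hp.
  - intros; apply Derive_ext; intros; apply Ht.
Qed.

Lemma cyl_analytic_Dz F : cyl_analytic F -> cyl_analytic (Dz F).
Proof.
  intros (H & Hp & Ht). split; [|split].
  - intros a b c Ha. destruct (H a b c Ha) as (cf & s & Hs). eauto using psum_Dz.
  - intros; apply Derive_ext; intros; apply Hp.
  - intros; unfold Dz. apply (Derive_shift (fun u => F x y u)). intros; apply Ht.
Qed.

Lemma Rabs_self_le x s : 0 < s -> Rabs (x - x) <= s.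
Proof. intros. rewrite Rminus_diag, Rabs_R0; lra. Qed.

Lemma Rabs_self_lt x s : 0 < s -> Rabs (x - x) < s.
Proof. intros. rewrite Rminus_diag, Rabs_R0; lra. Qed.

Lemma is_derive_Dx F x y z : cyl_analytic F -> -rho0 < x < rho0 ->
  is_derive (fun u => F u y z) x (Dx F x y z).
Proof.
  intros (H & _) Hx. destruct (H x y z Hx) as (cf & s & Hs). pose proof (proj1 Hs).
  apply (psum_is_derive_x _ _ _ _ _ _ Hs); auto using Rabs_self_le.
  apply Rabs_self_lt; lra.
Qed.

Lemma is_derive_Dy F x y z : cyl_analytic F -> -rho0 < x < rho0 ->
  is_derive (fun u => F x u z) y (Dy F x y z).
Proof.
  intros (H & _) Hx. destruct (H x y z Hx) as (cf & s & Hs). pose proof (proj1 Hs).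
  apply (psum_is_derive_y _ _ _ _ _ _ Hs); auto using Rabs_self_le.
  apply Rabs_self_lt; lra.
Qed.

Lemma is_derive_Dz F x y z : cyl_analytic F -> -rho0 < x < rho0 ->
  is_derive (fun u => F x y u) z (Dz F x y z).
Proof.
  intros (H & _) Hx. destruct (H x y z Hx) as (cf & s & Hs). pose proof (proj1 Hs).
  apply (psum_is_derive_z _ _ _ _ _ _ Hs); auto using Rabs_self_le.
  apply Rabs_self_lt; lra.
Qed.

Lemma Dx_Dy F x y z : cyl_analytic F -> -rho0 < x < rho0 -> Dx (Dy F) x y z = Dy (Dx F) x y z.
Proof.
  intros (H & _) Hx. destruct (H x y z Hx) as (cf & s & Hs). eapply psum_DxDy; eauto.
Qed.

Lemma cyl_analytic_bounded F rho1 : cyl_analytic F -> rho1 < rho0 ->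
  exists M, 0 <= M /\ forall x y z, Rabs x <= rho1 -> Rabs (F x y z) <= M.
Proof.
  intros (H & Hp & Ht) Hr.
  destruct (bounded_on_box F (-rho1) rho1 0 (2 * PI) 0 tau) as (M & HM0 & HM).
  { intros a b c Ha _ _. destruct (H a b c ltac:(lra)) as (cf & s & Hs).
    destruct (psum_bounded _ _ _ _ _ _ Hs) as [M HM]. exists M, s. split; [apply Hs|exact HM]. }
  exists M. split; auto. intros x y z Hx.
  destruct (periodic_reduce (2 * PI) y) as (n & y' & Hy' & ->); [pose proof PI_RGT_0; lra|].
  destruct (periodic_reduce tau z Htau) as (m & z' & Hz' & ->).
  rewrite (periodic_Z (fun y => F x y _) _ (fun y => Hp x y _)).
  rewrite (periodic_Z (fun z => F x y' z) _ (fun z => Ht x y' z)).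
  apply HM; auto. now apply Rabs_le_between.
Qed.

Lemma cyl_analytic_iter k F : cyl_analytic F -> cyl_analytic (Nat.iter k Dx F).
Proof. intros H. induction k; simpl; auto using cyl_analytic_Dx. Qed.

Lemma Derive_n_iter F k x y z :
  Derive_n (fun u => F u y z) k x = Nat.iter k Dx F x y z.
Proof.
  revert x; induction k as [|k IH]; intros x; [reflexivity|]. simpl.
  unfold Dx at 1. apply Derive_ext. exact IH.
Qed.

Lemma ex_derive_n_iter F k x y z : cyl_analytic F -> -rho0 < x < rho0 ->
  ex_derive_n (fun u => F u y z) k x.
Proof.
  intros HF Hx. destruct k as [|k]; simpl; auto.
  apply ex_derive_ext with (fun u => Nat.iter k Dx F u y z).
  { intros t. now rewrite Derive_n_iter. }
  eexists. apply is_derive_Dx; auto using cyl_analytic_iter.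
Qed.

Lemma iter_Dx_Dy F k x y z : cyl_analytic F -> -rho0 < x < rho0 ->
  Nat.iter k Dx (Dy F) x y z = Dy (Nat.iter k Dx F) x y z.
Proof.
  intros HF. revert x. induction k as [|k IH]; intros x Hx; [reflexivity|]. simpl.
  rewrite <- Dx_Dy by auto using cyl_analytic_iter.
  unfold Dx at 1 3. apply Derive_ext_loc.
  assert (Hd : 0 < Rmin (x + rho0) (rho0 - x)) by (apply Rmin_pos; lra).
  exists (mkposreal _ Hd). intros u Hu. apply IH.
  change (Rabs (u - x) < Rmin (x + rho0) (rho0 - x)) in Hu.
  pose proof (Rmin_l (x + rho0) (rho0 - x)). pose proof (Rmin_r (x + rho0) (rho0 - x)).
  apply Rabs_lt_between in Hu. lra.
Qed.

(** The constant is uniform in y and z because the derivative in the Lagrange remainder is bounded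
    on the whole cylinder, by periodicity and compactness. *)
Lemma taylor_at_zero F n rho1 : cyl_analytic F -> rho1 < rho0 ->
  exists K, 0 <= K /\ forall x y z, 0 < x <= rho1 ->
    Rabs (F x y z - sum_f_R0 (fun k => x ^ k * (Nat.iter k Dx F 0 y z / INR (fact k))) n)
      <= K * x ^ S n.
Proof.
  intros HF Hr.
  destruct (cyl_analytic_bounded (Nat.iter (S n) Dx F) rho1) as (M & HM0 & HM);
    auto using cyl_analytic_iter.
  pose proof (INR_fact_lt_0 (S n)) as Hf.
  exists (M / INR (fact (S n))). split.
  { unfold Rdiv. apply Rmult_le_pos; auto. apply Rlt_le, Rinv_0_lt_compat, Hf. }
  intros x y z Hx.
  destruct (Taylor_Lagrange (fun u => F u y z) n 0 x) as (xi & Hxi & E); [lra| |].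
  { intros; apply ex_derive_n_iter; auto; lra. }
  rewrite E, Rminus_0_r. rewrite Derive_n_iter.
  match goal with |- Rabs (?A + ?B - ?C) <= _ => replace A with C end.
  2:{ apply sum_eq; intros. rewrite Derive_n_iter. unfold Rdiv; ring. }
  match goal with |- Rabs (?A + ?B - ?A) <= _ => replace (A + B - A) with B by ring end.
  pose proof (pow_lt x (S n) ltac:(lra)) as Hp.
  rewrite Rabs_mult, Rabs_right.
  2:{ apply Rle_ge, Rlt_le, Rdiv_lt_0_compat; lra. }
  replace (M / INR (fact (S n)) * x ^ S n) with (x ^ S n / INR (fact (S n)) * M) by (unfold Rdiv; ring).
  apply Rmult_le_compat_l.
  { apply Rlt_le, Rdiv_lt_0_compat; lra. }
  apply HM. rewrite Rabs_right; lra.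
Qed.

End Analytic.

(** * Expansion of the Hamiltonian *)

Lemma zero_of_le_mult (c K d : R) : 0 < d -> (forall x, 0 < x < d -> Rabs c <= K * x) -> c = 0.
Proof.
  intros Hd H. destruct (Req_dec c 0) as [|Hc]; auto. exfalso.
  pose proof (Rabs_pos_lt _ Hc) as Hp.
  pose proof (Rabs_pos K) as HK.
  assert (Hq : 0 < Rabs c / (2 * (Rabs K + 1))) by (apply Rdiv_lt_0_compat; lra).
  assert (Hx : 0 < Rmin (d / 2) (Rabs c / (2 * (Rabs K + 1)))) by (apply Rmin_pos; lra).
  set (x := Rmin _ _) in Hx.
  pose proof (Rmin_l (d / 2) (Rabs c / (2 * (Rabs K + 1)))) as H1.
  pose proof (Rmin_r (d / 2) (Rabs c / (2 * (Rabs K + 1)))) as H2. fold x in H1, H2.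
  specialize (H x ltac:(lra)). pose proof (Rle_abs K).
  apply (Rmult_le_compat_l (Rabs K + 1)) in H2; [|lra].
  replace ((Rabs K + 1) * (Rabs c / (2 * (Rabs K + 1)))) with (Rabs c / 2) in H2 by (field; lra).
  nra.
Qed.

(** Letting x tend to 0 annihilates the constant coefficient; then divide by x and use induction. *)
Lemma polynomial_coefs_zero N : forall (c : nat -> R) K d, 0 < d ->
  (forall x, 0 < x < d -> Rabs (sum_f_R0 (fun k => x ^ k * c k) N) <= K * x ^ S N) ->
  forall k, (k <= N)%nat -> c k = 0.
Proof.
  induction N as [|N IH]; intros c K d Hd H.
  - intros k Hk. replace k with 0%nat by lia. apply zero_of_le_mult with K d; auto.
    intros x Hx. specialize (H x Hx). simpl in H. rewrite Rmult_1_l, Rmult_1_r in H. exact H.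
  - assert (H0 : c 0%nat = 0).
    { apply zero_of_le_mult with (Rabs K + sum_f_R0 (fun k => Rabs (c (S k))) N) (Rmin d 1).
      { apply Rmin_pos; lra. }
      intros x [Hx0 Hx]. pose proof (Rlt_le_trans _ _ _ Hx (Rmin_l _ _)) as Hxd.
      pose proof (Rlt_le_trans _ _ _ Hx (Rmin_r _ _)) as Hx1.
      specialize (H x (conj Hx0 Hxd)). rewrite sum_shift in H.
      set (T := sum_f_R0 _ N) in H.
      assert (HT : Rabs T <= x * sum_f_R0 (fun k => Rabs (c (S k))) N).
      { unfold T. eapply Rle_trans; [apply Rsum_abs|].
        rewrite scal_sum. apply sum_Rle; intros k Hk.
        rewrite Rabs_mult, (Rabs_right (x ^ S k)) by (apply Rle_ge, pow_le; lra).
        rewrite Rmult_comm. apply Rmult_le_compat_l; [apply Rabs_pos|]. simpl.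
        pose proof (pow_incr x 1 k ltac:(lra)). rewrite pow1 in H0. nra. }
      simpl (x ^ 0) in H. rewrite Rmult_1_l in H.
      assert (Hp : K * x ^ S (S N) <= Rabs K * x).
      { pose proof (Rle_abs K). pose proof (Rabs_pos K). simpl.
        pose proof (pow_incr x 1 N ltac:(lra)) as Hpw. rewrite pow1 in Hpw.
        pose proof (pow_le x N ltac:(lra)).
        assert (0 <= x * (x * x ^ N) <= x) by (split; [apply Rmult_le_pos; nra|nra]).
        nra. }
      replace (c 0%nat) with ((c 0%nat + T) - T) by ring.
      eapply Rle_trans; [apply Rabs_triang|]. rewrite Rabs_Ropp. lra. }
    intros [|k] Hk; auto.
    apply (IH (fun k => c (S k)) K d Hd); [|lia].
    intros x Hx. specialize (H x Hx). rewrite sum_shift, H0, Rmult_0_r, Rplus_0_l in H.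
    replace (sum_f_R0 _ N) with (x * sum_f_R0 (fun k => x ^ k * c (S k)) N) in H.
    2:{ rewrite scal_sum. apply sum_eq; intros; simpl; ring. }
    rewrite Rabs_mult, Rabs_right in H by lra.
    apply Rmult_le_reg_l with x; [lra|].
    replace (x * (K * x ^ S N)) with (K * x ^ S (S N)) by (simpl; ring). exact H.
Qed.

Lemma sum_single (f : nat -> R) q v N : (q <= N)%nat ->
  sum_f_R0 (fun k => f k * (if Nat.eqb k q then v else 0)) N = f q * v.
Proof.
  induction N as [|N IH]; intros Hq.
  - replace q with 0%nat by lia. reflexivity.
  - rewrite tech5. destruct (Nat.eq_dec q (S N)) as [->|Hn].
    + rewrite Nat.eqb_refl, sum_eq_R0; [ring|]. intros k Hk.
      replace (Nat.eqb k (S N)) with false by (symmetry; apply Nat.eqb_neq; lia). ring.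
    + rewrite IH by lia. replace (Nat.eqb (S N) q) with false by (symmetry; apply Nat.eqb_neq; lia).
      ring.
Qed.

Lemma Rpower_half_INR r k : 0 < r -> Rpower r (INR k / 2) = sqrt r ^ k.
Proof.
  intros Hr. rewrite <- Rpower_pow by now apply sqrt_lt_R0.
  rewrite <- Rpower_sqrt, Rpower_mult by auto. f_equal. field.
Qed.

Section Expansion.
Variables (p n : nat) (G : R -> R -> R -> R) (rho0 tau : R).
Hypotheses (Hp : (1 <= p)%nat) (Hn : (1 <= n)%nat) (Hrho0 : 0 < rho0) (Htau : 0 < tau).
Hypothesis HG : cyl_analytic rho0 tau G.
Variables psi0 psi1 : R -> R.
Hypothesis Hexp : exists C r1, 0 < r1 /\ forall r phi t, 0 < r -> r < r1 ->
     Rabs (Ham G r phi t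
           - Rpower r (INR p / 2) * psi0 phi
           - Rpower r (INR p / 2 + INR n / 2) * psi1 phi)
       <= C * Rpower r (INR p / 2 + INR n / 2 + 1 / 2).

(** Coefficients of the prescribed expansion as a polynomial in rho = sqrt r, where p = 2 alpha and
    p + n = 2 (alpha + gamma). *)
Definition two_terms (v0 v1 : R) (k : nat) : R :=
  (if Nat.eqb k p then v0 else 0) + (if Nat.eqb k (p + n) then v1 else 0).

Lemma sum_two_terms x v0 v1 :
  sum_f_R0 (fun k => x ^ k * two_terms v0 v1 k) (p + n) = x ^ p * v0 + x ^ (p + n) * v1.
Proof.
  rewrite <- (sum_single (fun k => x ^ k) p v0 (p + n)) by lia.
  rewrite <- (sum_single (fun k => x ^ k) (p + n) v1 (p + n)) by lia.
  rewrite <- plus_sum. apply sum_eq; intros; unfold two_terms; ring.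
Qed.

(** With r = x^2, the Taylor polynomial of [G] and the prescribed polynomial both approximate [G] to
    order x^(p+n+1), so they coincide. A bound on H thus becomes a family of identities that can be
    differentiated in the angle; in particular these coefficients do not depend on time. *)
Lemma taylor_coefs k y z : (k <= p + n)%nat ->
  Nat.iter k Dx G 0 y z = INR (fact k) * two_terms (psi0 y) (psi1 y) k.
Proof.
  destruct Hexp as (C & r1 & Hr1 & HC).
  destruct (taylor_at_zero rho0 tau Htau G (p + n) (rho0 / 2) HG ltac:(lra)) as (K & HK & HT).
  intros Hk. assert (Hd : 0 < Rmin (rho0 / 2) (sqrt r1)).
  { apply Rmin_pos; [lra|now apply sqrt_lt_R0]. }
  pose proof (polynomial_coefs_zero (p + n)
     (fun k => Nat.iter k Dx G 0 y z / INR (fact k) - two_terms (psi0 y) (psi1 y) k)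
     (C + K) _ Hd) as HP.
  cbv beta in HP. pose proof (INR_fact_lt_0 k).
  enough (E : Nat.iter k Dx G 0 y z / INR (fact k) - two_terms (psi0 y) (psi1 y) k = 0).
  { apply Rminus_diag_uniq in E. rewrite <- E. field. lra. }
  apply HP; auto. clear k Hk H HP. intros x [Hx0 Hx].
  pose proof (Rlt_le_trans _ _ _ Hx (Rmin_l _ _)) as Hx1.
  pose proof (Rlt_le_trans _ _ _ Hx (Rmin_r _ _)) as Hx2.
  specialize (HT x y z ltac:(lra)).
  assert (Hxx : x ^ 2 < r1).
  { pose proof (pow2_sqrt r1 ltac:(lra)). pose proof (sqrt_pos r1). nra. }
  specialize (HC (x ^ 2) y z ltac:(nra) Hxx).
  unfold Ham in HC. rewrite <- Rdiv_plus_distr, <- plus_INR in HC.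
  replace (INR (p + n) / 2 + 1 / 2) with (INR (S (p + n)) / 2) in HC by (rewrite S_INR; field).
  rewrite !Rpower_half_INR, sqrt_pow2 in HC by nra.
  replace (sum_f_R0 _ (p + n)) with
    (sum_f_R0 (fun k => x ^ k * (Nat.iter k Dx G 0 y z / INR (fact k))) (p + n)
     - (x ^ p * psi0 y + x ^ (p + n) * psi1 y)).
  2:{ rewrite <- sum_two_terms, <- minus_sum. apply sum_eq; intros; ring. }
  set (T := sum_f_R0 _ _) in *.
  replace (T - _) with ((G x y z - x ^ p * psi0 y - x ^ (p + n) * psi1 y) - (G x y z - T)) by ring.
  eapply Rle_trans; [apply Rabs_triang|]. rewrite Rabs_Ropp. lra.
Qed.

Lemma psi0_taylor y z : psi0 y = Nat.iter p Dx G 0 y z / INR (fact p).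
Proof.
  pose proof (INR_fact_lt_0 p). rewrite taylor_coefs by lia. unfold two_terms.
  rewrite Nat.eqb_refl. replace (Nat.eqb p (p + n)) with false by (symmetry; apply Nat.eqb_neq; lia).
  field; lra.
Qed.

Lemma psi1_taylor y z : psi1 y = Nat.iter (p + n) Dx G 0 y z / INR (fact (p + n)).
Proof.
  pose proof (INR_fact_lt_0 (p + n)). rewrite taylor_coefs by lia. unfold two_terms.
  rewrite Nat.eqb_refl. replace (Nat.eqb (p + n) p) with false by (symmetry; apply Nat.eqb_neq; lia).
  field; lra.
Qed.

Lemma ex_derive_psi0 y : ex_derive psi0 y.
Proof.
  apply ex_derive_ext with (fun y => / INR (fact p) * Nat.iter p Dx G 0 y 0).
  { intros t. rewrite (psi0_taylor t 0). apply Rmult_comm. }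
  apply ex_derive_scal.
  eexists. eapply is_derive_Dy with (tau := tau); [|split; [|exact Hrho0]; lra].
  now apply cyl_analytic_iter.
Qed.

Lemma ex_derive_psi1 y : ex_derive psi1 y.
Proof.
  apply ex_derive_ext with (fun y => / INR (fact (p + n)) * Nat.iter (p + n) Dx G 0 y 0).
  { intros t. rewrite (psi1_taylor t 0). apply Rmult_comm. }
  apply ex_derive_scal.
  eexists. eapply is_derive_Dy with (tau := tau); [|split; [|exact Hrho0]; lra].
  now apply cyl_analytic_iter.
Qed.

Lemma taylor_coefs_Dy k y z : (k <= p + n)%nat ->
  Nat.iter k Dx (Dy G) 0 y z = INR (fact k) * two_terms (Derive psi0 y) (Derive psi1 y) k.
Proof.
  intros Hk. rewrite (iter_Dx_Dy rho0 tau) by (auto; lra). unfold Dy.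
  rewrite (Derive_ext _ (fun u => INR (fact k) * two_terms (psi0 u) (psi1 u) k))
    by (intros; now apply taylor_coefs).
  rewrite Derive_scal. f_equal. unfold two_terms.
  pose proof (ex_derive_psi0 y). pose proof (ex_derive_psi1 y).
  destruct (Nat.eqb k p), (Nat.eqb k (p + n));
    rewrite Derive_plus by (auto; apply ex_derive_const); rewrite ?Derive_const; reflexivity.
Qed.

Lemma Dy_expansion rho1 : rho1 < rho0 -> exists K, 0 <= K /\ forall x y z, 0 < x <= rho1 ->
  Rabs (Dy G x y z - x ^ p * Derive psi0 y - x ^ (p + n) * Derive psi1 y) <= K * x ^ S (p + n).
Proof.
  intros H1. destruct (taylor_at_zero rho0 tau Htau (Dy G) (p + n) rho1) as (K & HK & HT); auto.
  { now apply cyl_analytic_Dy. }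
  exists K; split; auto. intros x y z Hx. specialize (HT x y z Hx).
  replace (sum_f_R0 _ _) with (x ^ p * Derive psi0 y + x ^ (p + n) * Derive psi1 y) in HT.
  { revert HT. apply Rle_trans. right. f_equal; ring. }
  rewrite <- sum_two_terms. apply sum_eq; intros k Hk. rewrite taylor_coefs_Dy by auto.
  pose proof (INR_fact_lt_0 k). field; lra.
Qed.

(** In the derivative with respect to rho the term with psi1 has order p + n - 1 >= p, so it goes
    into the remainder. *)
Lemma Dx_expansion rho1 : rho1 < rho0 -> exists K, 0 <= K /\ forall x y z, 0 < x <= rho1 ->
  Rabs (Dx G x y z - INR p * x ^ (p - 1) * psi0 y) <= K * x ^ p.
Proof.
  intros H1. destruct (taylor_at_zero rho0 tau Htau (Dx G) (p - 1) rho1) as (K & HK & HT); auto.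
  { now apply cyl_analytic_Dx. }
  exists K; split; auto. intros x y z Hx. specialize (HT x y z Hx).
  replace (S (p - 1)) with p in HT by lia.
  replace (sum_f_R0 _ _) with (INR p * x ^ (p - 1) * psi0 y) in HT; [exact HT|].
  transitivity (x ^ (p - 1) * (INR p * psi0 y)); [ring|].
  rewrite <- (sum_single (fun k => x ^ k) (p - 1) _ (p - 1)) by lia.
  apply sum_eq; intros k Hk. f_equal.
  replace (Nat.iter k Dx (Dx G) 0 y z) with (Nat.iter (S k) Dx G 0 y z) by now rewrite Nat.iter_succ_r.
  rewrite taylor_coefs by lia. unfold two_terms.
  replace (Nat.eqb (S k) (p + n)) with false by (symmetry; apply Nat.eqb_neq; lia).
  pose proof (INR_fact_lt_0 k).
  destruct (Nat.eqb_spec k (p - 1)) as [->|Hne].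
  - replace (S (p - 1)) with p by lia. rewrite Nat.eqb_refl.
    replace (fact p) with (p * fact (p - 1))%nat.
    2:{ destruct p; [lia|]. simpl Nat.sub. rewrite Nat.sub_0_r. reflexivity. }
    rewrite mult_INR. field; lra.
  - replace (Nat.eqb (S k) p) with false by (symmetry; apply Nat.eqb_neq; lia). field; lra.
Qed.

End Expansion.

(** * Local behaviour of the angular coefficients *)

Lemma filter_imp2 {T : Type} {F : (T -> Prop) -> Prop} {FF : Filter F} (P Q S : T -> Prop) :
  (forall x, P x -> Q x -> S x) -> F P -> F Q -> F S.
Proof.
  intros H HP HQ. apply filter_imp with (2 := filter_and _ _ HP HQ). intros x []; auto.
Qed.

Lemma ex_pseries_bounded a r : ex_pseries a r -> exists M, forall k, Rabs (a k * r ^ k) <= M.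
Proof.
  intros H. apply ex_series_lim_0 in H.
  assert (Hb : ex_finite_lim_seq (fun k => a k * r ^ k)).
  { exists 0. revert H. apply is_lim_seq_ext. intros k.
    unfold scal; simpl; unfold mult; simpl. rewrite pow_n_pow. ring. }
  destruct Hb as [l Hl]. apply is_lim_seq_Reals in Hl.
  destruct (maj_by_pos (fun k => a k * r ^ k) (exist _ l Hl)) as (M & _ & HM).
  exists M. exact HM.
Qed.

Lemma CV_radius_PS_decr_n_pos a r m : 0 < r -> ex_pseries a r ->
  Rbar_lt 0 (CV_radius (PS_decr_n a m)).
Proof.
  intros Hr H. destruct (ex_pseries_bounded a r H) as [M HM].
  apply Rbar_lt_le_trans with r; [exact Hr|].
  apply (CV_radius_bounded (PS_decr_n a m)). exists (M / r ^ m). intros k.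
  unfold PS_decr_n. pose proof (pow_lt r m Hr).
  apply Rmult_le_reg_r with (r ^ m); auto.
  replace (M / r ^ m * r ^ m) with M by (field; lra).
  eapply Rle_trans; [|apply (HM (m + k)%nat)]. right.
  rewrite <- (Rabs_right (r ^ m)) at 1 by lra. rewrite <- Rabs_mult, pow_add. f_equal.
  ring.
Qed.

Lemma analytic1_PSeries psi phi0 : analytic1 psi -> exists a,
  Rbar_lt 0 (CV_radius a) /\ (forall m, Rbar_lt 0 (CV_radius (PS_decr_n a m))) /\
  locally 0 (fun s => psi (phi0 + s) = PSeries a s).
Proof.
  intros H. destruct (H phi0) as (a & d & Hd & Ha). exists a.
  assert (He : ex_pseries a (d / 2)).
  { exists (psi (phi0 + d / 2)). pose proof (Ha (phi0 + d / 2)) as Hs.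
    replace (phi0 + d / 2 - phi0) with (d / 2) in Hs by ring. apply Hs.
    rewrite Rabs_right; lra. }
  assert (Hm : forall m, Rbar_lt 0 (CV_radius (PS_decr_n a m))).
  { intros m. apply CV_radius_PS_decr_n_pos with (d / 2); auto; lra. }
  split; [exact (Hm 0%nat)|split; [exact Hm|]].
  exists (mkposreal d Hd). intros s Hs. change (Rabs (s - 0) < d) in Hs. rewrite Rminus_0_r in Hs.
  symmetry. apply is_pseries_unique. pose proof (Ha (phi0 + s)) as Hp.
  assert (E : forall u : R, phi0 + u - phi0 = u) by (intros; ring).
  rewrite E in Hp. now apply Hp.
Qed.

Lemma Derive_comp_shift f x0 s : Derive f (x0 + s) = Derive (fun s => f (x0 + s)) s.
Proof.
  unfold Derive. f_equal. apply Lim_ext. intros h. now rewrite Rplus_assoc.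
Qed.

Lemma locally_CV_radius a : Rbar_lt 0 (CV_radius a) -> locally 0 (fun s => Rbar_lt (Rabs s) (CV_radius a)).
Proof.
  intros H.
  assert (Hr : exists r : posreal, Rbar_le r (CV_radius a)).
  { destruct (CV_radius a) as [r| |]; simpl in H; try easy.
    - exists (mkposreal r H). simpl; lra.
    - now exists (mkposreal 1 Rlt_0_1). }
  destruct Hr as [r Hr]. exists r. intros s Hs. apply Rbar_lt_le_trans with (2 := Hr).
  change (Rabs (s - 0) < r) in Hs. now rewrite Rminus_0_r in Hs.
Qed.

Lemma locally_Derive_PSeries psi phi0 a : Rbar_lt 0 (CV_radius a) ->
  locally 0 (fun s => psi (phi0 + s) = PSeries a s) ->
  locally 0 (fun s => Derive psi (phi0 + s) = PSeries (PS_derive a) s).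
Proof.
  intros Ha H. generalize (locally_locally _ _ H) (locally_CV_radius a Ha).
  apply filter_imp2. intros s Hs Hc. rewrite Derive_comp_shift.
  transitivity (Derive (PSeries a) s); [now apply Derive_ext_loc|]. now apply Derive_PSeries.
Qed.

Lemma continuity_pt_pos f x : continuity_pt f x -> 0 < f x -> locally x (fun y => 0 < f y).
Proof.
  intros Hc Hp. apply continuity_pt_filterlim in Hc. apply Hc.
  exists (mkposreal _ Hp). intros y Hy. change (Rabs (y - f x) < f x) in Hy.
  apply Rabs_lt_between in Hy. lra.
Qed.

Lemma analytic1_Derive_pos psi phi0 c : analytic1 psi -> 0 < c * Derive psi phi0 ->
  locally 0 (fun s => c * Derive psi phi0 / 2 < c * Derive psi (phi0 + s)).
Proof.
  intros H Hp. destruct (analytic1_PSeries psi phi0 H) as (a & Ha & _ & Hl).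
  pose proof (locally_Derive_PSeries _ _ _ Ha Hl) as HD.
  assert (E0 : Derive psi phi0 = PSeries (PS_derive a) 0).
  { rewrite <- (Rplus_0_r phi0) at 1. apply (locally_singleton _ _ HD). }
  assert (Hc : continuity_pt (fun s => c * PSeries (PS_derive a) s - c * Derive psi phi0 / 2) 0).
  { apply continuity_pt_minus; [|now apply continuity_pt_const].
    apply continuity_pt_mult; [now apply continuity_pt_const|].
    apply PSeries_continuity. rewrite CV_radius_derive, Rabs_R0. exact Ha. }
  apply continuity_pt_pos in Hc; [|rewrite <- E0; lra].
  revert HD Hc. apply filter_imp2. intros s -> Hs. lra.
Qed.

(** Write psi = s^m b with c b(0) > 0 and m = 2 l + 1. Then psi' = s^(2l) (m b + s b') and s psi =
    s^(2l+2) b: oddness of m makes both exponents even, so near s = 0 the signs are those of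
    b(0). *)
Lemma analytic1_odd_zero psi phi0 m : analytic1 psi -> Nat.Odd m ->
  (forall k, (k < m)%nat -> Derive_n psi k phi0 = 0) -> Derive_n psi m phi0 <> 0 ->
  locally 0 (fun s => 0 <= Derive_n psi m phi0 * Derive psi (phi0 + s) /\
    (s <> 0 -> 0 < Derive_n psi m phi0 * (s * psi (phi0 + s)))).
Proof.
  intros H [l Hodd] Hz Hnz. set (c := Derive_n psi m phi0) in *.
  destruct (analytic1_PSeries psi phi0 H) as (a & Ha & Hdec & Hl).
  assert (Hcoef : forall k, Derive_n psi k phi0 = a k * INR (fact k)).
  { intros k. rewrite <- Derive_n_coef by auto. rewrite <- (Rplus_0_l phi0).
    rewrite <- Derive_n_comp_trans. apply Derive_n_ext_loc. revert Hl. apply filter_imp.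
    intros s <-. f_equal; ring. }
  assert (Hak : forall k, (k < m)%nat -> a k = 0).
  { intros k Hk. pose proof (INR_fact_lt_0 k). specialize (Hz k Hk). rewrite Hcoef in Hz.
    apply Rmult_integral in Hz. lra. }
  set (b := PS_decr_n a m). specialize (Hdec m). fold b in Hdec.
  assert (Hfac : locally 0 (fun s => psi (phi0 + s) = s ^ m * PSeries b s)).
  { revert Hl. apply filter_imp. intros s ->. now apply PSeries_decr_n_aux. }
  assert (Hb0 : PSeries b 0 = a m).
  { rewrite PSeries_0. unfold b, PS_decr_n. f_equal; lia. }
  assert (Hcb : 0 < c * a m).
  { unfold c. rewrite Hcoef. pose proof (INR_fact_lt_0 m).
    assert (a m <> 0) by (intros E; apply Hnz; unfold c; rewrite Hcoef, E; ring).
    replace (a m * INR (fact m) * a m) with (INR (fact m) * (a m * a m)) by ring.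
    apply Rmult_lt_0_compat; auto. now apply Rsqr_pos_lt. }
  assert (Hcont : continuity_pt (PSeries b) 0).
  { apply PSeries_continuity. now rewrite Rabs_R0. }
  assert (Hcontd : continuity_pt (PSeries (PS_derive b)) 0).
  { apply PSeries_continuity. now rewrite Rabs_R0, CV_radius_derive. }
  assert (H1 : locally 0 (fun s => 0 < c * PSeries b s)).
  { apply (continuity_pt_pos (fun s => c * PSeries b s)); [|now rewrite Hb0].
    apply continuity_pt_mult; auto. now apply continuity_pt_const. }
  assert (H2 : locally 0 (fun s => 0 < c * (INR m * PSeries b s + s * PSeries (PS_derive b) s))).
  { apply (continuity_pt_pos (fun s => c * (INR m * PSeries b s + s * PSeries (PS_derive b) s))).
    - apply continuity_pt_mult; [now apply continuity_pt_const|].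
      apply continuity_pt_plus; apply continuity_pt_mult; auto;
        try (now apply continuity_pt_const). apply continuity_pt_id.
    - rewrite Hb0, Rmult_0_l, Rplus_0_r. rewrite (Rmult_comm (INR m)), <- Rmult_assoc.
      apply Rmult_lt_0_compat; auto. apply lt_0_INR; lia. }
  assert (HD : locally 0 (fun s => Derive psi (phi0 + s)
      = s ^ (2 * l) * (INR m * PSeries b s + s * PSeries (PS_derive b) s))).
  { generalize (locally_locally _ _ Hfac) (locally_CV_radius b Hdec).
    apply filter_imp2. intros s Hs Hc. rewrite Derive_comp_shift.
    transitivity (Derive (fun u => u ^ m * PSeries b u) s); [now apply Derive_ext_loc|].
    apply is_derive_unique. evar_last.
    - apply (is_derive_mult (fun s => s ^ m) (PSeries b)).
      + apply is_derive_pow, is_derive_id.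
      + now apply is_derive_PSeries.
      + intros; apply Rmult_comm.
    - unfold plus, mult, one; simpl. rewrite Hodd. replace (pred (2 * l + 1)) with (2 * l)%nat by lia.
      replace (2 * l + 1)%nat with (S (2 * l)) by lia. simpl pow. ring. }
  generalize (filter_and _ _ Hfac H1) (filter_and _ _ HD H2). apply filter_imp2.
  intros s [E1 P1] [E2 P2]. split.
  - rewrite E2. replace (c * (s ^ (2 * l) * _)) with
      (s ^ (2 * l) * (c * (INR m * PSeries b s + s * PSeries (PS_derive b) s))) by ring.
    apply Rmult_le_pos; [|lra]. rewrite pow_mult. apply pow_le, pow2_ge_0.
  - intros Hs. rewrite E1. rewrite Hodd.
    replace (c * (s * (s ^ (2 * l + 1) * PSeries b s))) with ((s ^ 2) ^ (S l) * (c * PSeries b s)).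
    2:{ rewrite <- pow_mult. replace (2 * S l)%nat with (S (2 * l + 1)) by lia. simpl pow; ring. }
    apply Rmult_lt_0_compat; auto. apply pow_lt. now apply pow2_gt_0.
Qed.

(** * Funnels *)

(** Let [ts] be the supremum of the times up to which g stays negative. If g(ts) < 0, one can go
    further; if g(ts) > 0, continuity fails; if g(ts) = 0, the negative derivative makes g positive
    just before [ts]. *)
Lemma barrier (g dg : R -> R) T :
  (forall t, 0 <= t <= T -> is_derive g t (dg t)) ->
  g 0 < 0 -> (forall t, 0 <= t <= T -> g t = 0 -> dg t < 0) ->
  forall t, 0 <= t <= T -> g t < 0.
Proof.
  intros Hd H0 Hb t1 Ht1. destruct (Rlt_le_dec (g t1) 0) as [|Hge]; auto. exfalso.
  set (E := fun t => 0 <= t <= t1 /\ forall u, 0 <= u <= t -> g u < 0).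
  destruct (completeness E) as [ts [Hub Hlub]].
  { exists t1. intros t [Ht _]. lra. }
  { exists 0. split; [lra|]. intros u Hu. now replace u with 0 by lra. }
  assert (E0 : E 0) by (split; [lra|]; intros u Hu; now replace u with 0 by lra).
  assert (Hts : 0 <= ts <= t1).
  { split; [now apply Hub|]. apply Hlub. intros t [Ht _]; lra. }
  assert (Hbelow : forall u, 0 <= u < ts -> g u < 0).
  { intros u Hu. destruct (Rlt_le_dec (g u) 0) as [|Hgu]; auto. exfalso.
    apply (Rlt_not_le _ _ (proj2 Hu)). apply Hlub. intros t [Ht1' Ht2].
    destruct (Rle_lt_dec t u) as [|Hut]; auto. specialize (Ht2 u ltac:(lra)). lra. }
  pose proof (Hd ts ltac:(lra)) as Dts. apply is_derive_Reals in Dts.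
  assert (Hcont : forall eps, 0 < eps -> exists d, 0 < d /\ forall u, Rabs (u - ts) < d -> Rabs (g u - g ts) < eps).
  { intros eps He. assert (Hc : continuity_pt g ts) by (apply derivable_continuous_pt; now exists (dg ts)).
    destruct (Hc eps He) as (d & Hd0 & Hd1). exists d. split; auto. intros u Hu.
    destruct (Req_dec u ts) as [->|Hne]; [rewrite Rminus_diag, Rabs_R0; auto|].
    apply Hd1. split; [|exact Hu]. split; [exact I|congruence]. }
  destruct (Rtotal_order (g ts) 0) as [Hneg|[Hz|Hpos]].
  - destruct (Hcont (- g ts) ltac:(lra)) as (d & Hd0 & Hd1).
    assert (Hts1 : ts < t1).
    { destruct Hts as [_ [|]]; auto. subst ts. lra. }
    assert (HE : E (Rmin (ts + d / 2) t1)).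
    { split. { split; [apply Rmin_glb; lra|apply Rmin_r]. }
      intros u Hu. pose proof (Rmin_l (ts + d / 2) t1).
      destruct (Rlt_le_dec u ts); [apply Hbelow; lra|].
      assert (Hu' : Rabs (g u - g ts) < - g ts) by (apply Hd1; rewrite Rabs_right; lra).
      apply Rabs_lt_between in Hu'. lra. }
    apply Hub in HE. assert (ts < Rmin (ts + d / 2) t1) by (apply Rmin_glb_lt; lra). lra.
  - assert (0 < ts).
    { destruct Hts as [[|<-] _]; auto. lra. }
    specialize (Hb ts ltac:(lra) Hz).
    destruct (Dts (- dg ts) ltac:(lra)) as [d Hd1].
    set (h := - Rmin (d / 2) (ts / 2)).
    assert (Hh : 0 < - h /\ - h <= d / 2 /\ - h <= ts / 2).
    { unfold h. rewrite Ropp_involutive. pose proof (cond_pos d).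
      repeat split; [apply Rmin_pos; lra|apply Rmin_l|apply Rmin_r]. }
    pose proof (cond_pos d).
    specialize (Hd1 h ltac:(lra) ltac:(rewrite Rabs_left; lra)).
    rewrite Hz, Rminus_0_r in Hd1. apply Rabs_lt_between in Hd1.
    assert (Hgn : g (ts + h) < 0) by (apply Hbelow; lra).
    assert (Hq : 0 < g (ts + h) / h).
    { replace (g (ts + h) / h) with ((- g (ts + h)) * / (- h)) by (field; lra).
      apply Rmult_lt_0_compat; [lra|apply Rinv_0_lt_compat; lra]. }
    lra.
  - destruct (Hcont (g ts) ltac:(lra)) as (d & Hd0 & Hd1).
    destruct Hts as [[Hts0|<-] _]; [|lra].
    set (u := Rmax 0 (ts - d / 2)).
    assert (Hu : 0 <= u < ts /\ ts - u <= d / 2).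
    { unfold u. split; [split; [apply Rmax_l|apply Rmax_lub_lt; lra]|].
      pose proof (Rmax_r 0 (ts - d / 2)); lra. }
    specialize (Hd1 u ltac:(rewrite Rabs_left; lra)). apply Rabs_lt_between in Hd1.
    pose proof (Hbelow u ltac:(lra)). lra.
Qed.

Lemma increment_ge (f df : R -> R) a b c : a <= b ->
  (forall t, a <= t <= b -> is_derive f t (df t)) ->
  (forall t, a <= t <= b -> c <= df t) -> c * (b - a) <= f b - f a.
Proof.
  intros Hab Hd Hc. destruct (MVT_gen f a b df) as (xi & Hxi & ->).
  - intros x. rewrite Rmin_left, Rmax_right by lra. intros; apply Hd; lra.
  - intros x. rewrite Rmin_left, Rmax_right by lra. intros Hx. apply derivable_continuous_pt.
    exists (df x). apply is_derive_Reals, Hd; lra.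
  - rewrite Rmin_left, Rmax_right in Hxi by lra. apply Rmult_le_compat_r; [lra|]. now apply Hc.
Qed.

(** The barrier is applied to s^2 - eta^2, whose derivative is 2 s v. The rate c is only demanded
    where r >= r0, so r >= r0 is first derived from u >= 0, and then the rate is integrated. *)
Lemma funnel (r s u v : R -> R) T eta r0 c :
  0 <= T -> r0 <= r 0 -> Rabs (s 0) < eta ->
  (forall t, 0 <= t <= T -> is_derive r t (u t) /\ is_derive s t (v t)) ->
  (forall t, 0 <= t <= T -> Rabs (s t) = eta -> s t * v t < 0) ->
  (forall t, 0 <= t <= T -> Rabs (s t) <= eta -> 0 <= u t /\ (r0 <= r t -> c <= u t)) ->
  r0 + c * T <= r T.
Proof.
  intros HT Hr0 Hs0 Hd Hside Hin.
  assert (Heta : 0 < eta) by (pose proof (Rabs_pos (s 0)); lra).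
  assert (Hs : forall t, 0 <= t <= T -> Rabs (s t) <= eta).
  { intros t Ht. assert (Hg : s t * s t - eta * eta < 0).
    { apply (barrier (fun t => s t * s t - eta * eta) (fun t => 2 * (s t * v t)) T); auto.
      - intros x Hx. destruct (Hd x Hx) as [_ D]. auto_derive; [repeat split; now exists (v x)|].
        change (fun x0 : R => s x0) with s. rewrite (is_derive_unique _ _ _ D); ring.
      - apply Rabs_lt_between in Hs0. nra.
      - intros x Hx E. assert (Hxe : Rabs (s x) = eta).
        { rewrite <- (Rabs_right eta) by lra. apply Rsqr_eq_abs_0. unfold Rsqr; lra. }
        specialize (Hside x Hx Hxe). lra. }
    apply Rabs_le_between. nra. }
  assert (Hmono : forall t, 0 <= t <= T -> r0 <= r t).
  { intros t Ht. pose proof (increment_ge r u 0 t 0) as H.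
    assert (0 * (t - 0) <= r t - r 0); [|lra].
    apply H; [lra| |]; intros x Hx; [apply Hd; lra|].
    apply Hin; [lra|]. apply Hs; lra. }
  assert (c * (T - 0) <= r T - r 0); [|lra].
  apply (increment_ge r u); auto.
  - intros t Ht. now apply Hd.
  - intros t Ht. apply Hin; auto.
Qed.

(** * Area *)

(** Globally Lipschitz functions are stable under the shears of the scheme, and regular enough for
    Riemann integrals and an elementary proof of Fubini's theorem. *)
Definition Lip2 (g : R -> R -> R) : Prop := exists K, 0 <= K /\
  forall x y x' y', Rabs (g x y - g x' y') <= K * (Rabs (x - x') + Rabs (y - y')).
Definition Bdd2 (g : R -> R -> R) : Prop := exists M, 0 <= M /\ forall x y, Rabs (g x y) <= M.
Definition Lip1 (f : R -> R) : Prop := exists K, 0 <= K /\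
  forall x x', Rabs (f x - f x') <= K * Rabs (x - x').

Lemma Lip2_fst : Lip2 (fun x _ => x).
Proof. exists 1. split; [lra|]. intros. pose proof (Rabs_pos (y - y')). lra. Qed.

Lemma Lip2_snd : Lip2 (fun _ y => y).
Proof. exists 1. split; [lra|]. intros. pose proof (Rabs_pos (x - x')). lra. Qed.

Lemma Lip2_const c : Lip2 (fun _ _ => c).
Proof.
  exists 0. split; [lra|]. intros. rewrite Rminus_diag, Rabs_R0. lra.
Qed.

Lemma Lip2_plus f g : Lip2 f -> Lip2 g -> Lip2 (fun x y => f x y + g x y).
Proof.
  intros (K & HK & Hf) (L & HL & Hg). exists (K + L). split; [lra|]. intros.
  replace (_ - _) with ((f x y - f x' y') + (g x y - g x' y')) by ring.
  eapply Rle_trans; [apply Rabs_triang|]. specialize (Hf x y x' y'). specialize (Hg x y x' y'). lra.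
Qed.

Lemma Lip2_mult f g : Lip2 f -> Bdd2 f -> Lip2 g -> Bdd2 g -> Lip2 (fun x y => f x y * g x y).
Proof.
  intros (K & HK & Hf) (M & HM & Bf) (L & HL & Hg) (N & HN & Bg). exists (K * N + M * L).
  split; [nra|]. intros.
  replace (_ - _) with ((f x y - f x' y') * g x y + f x' y' * (g x y - g x' y')) by ring.
  eapply Rle_trans; [apply Rabs_triang|]. rewrite !Rabs_mult.
  rewrite Rmult_plus_distr_r. apply Rplus_le_compat.
  - replace (K * N * _) with (K * (Rabs (x - x') + Rabs (y - y')) * N) by ring.
    apply Rmult_le_compat; auto using Rabs_pos.
  - rewrite Rmult_assoc. apply Rmult_le_compat; auto using Rabs_pos.
Qed.

Lemma Lip2_scal c f : Lip2 f -> Lip2 (fun x y => c * f x y).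
Proof.
  intros (K & HK & Hf). exists (Rabs c * K). split; [apply Rmult_le_pos; auto using Rabs_pos|].
  intros. rewrite <- Rmult_minus_distr_l, Rabs_mult, Rmult_assoc.
  apply Rmult_le_compat_l; auto using Rabs_pos.
Qed.

Lemma Lip2_comp g f1 f2 : Lip2 g -> Lip2 f1 -> Lip2 f2 -> Lip2 (fun x y => g (f1 x y) (f2 x y)).
Proof.
  intros (K & HK & Hg) (A & HA & H1) (B & HB & H2). exists (K * (A + B)).
  split; [nra|]. intros. eapply Rle_trans; [apply Hg|]. rewrite Rmult_assoc.
  apply Rmult_le_compat_l; auto. specialize (H1 x y x' y'). specialize (H2 x y x' y'). lra.
Qed.

Lemma Bdd2_const c : Bdd2 (fun _ _ => c).
Proof. exists (Rabs c). split; [apply Rabs_pos|intros; lra]. Qed.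

Lemma Bdd2_plus f g : Bdd2 f -> Bdd2 g -> Bdd2 (fun x y => f x y + g x y).
Proof.
  intros (M & HM & Hf) (N & HN & Hg). exists (M + N). split; [lra|]. intros.
  eapply Rle_trans; [apply Rabs_triang|]. specialize (Hf x y); specialize (Hg x y); lra.
Qed.

Lemma Bdd2_mult f g : Bdd2 f -> Bdd2 g -> Bdd2 (fun x y => f x y * g x y).
Proof.
  intros (M & HM & Hf) (N & HN & Hg). exists (M * N). split; [nra|]. intros.
  rewrite Rabs_mult. apply Rmult_le_compat; auto using Rabs_pos.
Qed.

Lemma Bdd2_comp g f1 f2 : Bdd2 g -> Bdd2 (fun x y => g (f1 x y) (f2 x y)).
Proof. intros (M & HM & H). exists M; auto. Qed.

Lemma Lip2_Lip1_l g y : Lip2 g -> Lip1 (fun x => g x y).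
Proof.
  intros (K & HK & H). exists K; split; auto. intros. specialize (H x y x' y).
  rewrite Rminus_diag, Rabs_R0, Rplus_0_r in H. exact H.
Qed.

Lemma Lip2_Lip1_r g x : Lip2 g -> Lip1 (fun y => g x y).
Proof.
  intros (K & HK & H). exists K; split; auto. intros y y'. specialize (H x y x y').
  rewrite Rminus_diag, Rabs_R0, Rplus_0_l in H. exact H.
Qed.

Lemma Lip1_continuous f x : Lip1 f -> continuous f x.
Proof.
  intros (K & HK & H). apply continuity_pt_filterlim. intros eps Heps.
  exists (eps / (K + 1)). split; [apply Rdiv_lt_0_compat; lra|].
  intros y [_ Hy]. change (Rabs (f y - f x) < eps). change (Rabs (y - x) < eps / (K + 1)) in Hy.
  eapply Rle_lt_trans; [apply H|]. pose proof (Rabs_pos (y - x)).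
  apply Rle_lt_trans with ((K + 1) * Rabs (y - x)); [nra|].
  apply (Rmult_lt_compat_l (K + 1)) in Hy; [|lra].
  replace ((K + 1) * (eps / (K + 1))) with eps in Hy by (field; lra). exact Hy.
Qed.

(** * Integrals of Lipschitz functions of one and two variables *)

Lemma Lip1_ex_RInt f a b : Lip1 f -> ex_RInt f a b.
Proof. intros H. apply (@ex_RInt_continuous R_CompleteNormedModule). intros; now apply Lip1_continuous. Qed.

Lemma RInt_abs_le f a b M : ex_RInt f a b ->
  (forall x, Rmin a b <= x <= Rmax a b -> Rabs (f x) <= M) ->
  Rabs (RInt f a b) <= Rabs (b - a) * M.
Proof.
  intros H HM. apply (norm_RInt_le_const_abs f a b (RInt f a b) M); auto.
  now apply (@RInt_correct R_CompleteNormedModule).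
Qed.

Lemma RInt_minus_R f g a b : ex_RInt f a b -> ex_RInt g a b ->
  RInt (fun x => f x - g x) a b = RInt f a b - RInt g a b.
Proof. intros. now apply (@RInt_minus R_CompleteNormedModule). Qed.

Lemma RInt_ext_R (f g : R -> R) a b :
  (forall x, Rmin a b < x < Rmax a b -> f x = g x) -> RInt f a b = RInt g a b.
Proof. exact (RInt_ext (V := R_CompleteNormedModule) f g a b). Qed.

Lemma RInt_scal_R f a b c : ex_RInt f a b -> RInt (fun x => c * f x) a b = c * RInt f a b.
Proof. exact (RInt_scal (V := R_CompleteNormedModule) f a b c). Qed.

Lemma RInt_const_R a b c : RInt (fun _ => c) a b = (b - a) * c.
Proof. exact (RInt_const (V := R_CompleteNormedModule) a b c). Qed.

Lemma RInt_point_R a (f : R -> R) : RInt f a a = 0.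
Proof. exact (RInt_point (V := R_CompleteNormedModule) a f). Qed.

Lemma RInt_Chasles_R f a b c : Lip1 f -> RInt f a c = RInt f a b + RInt f b c.
Proof.
  intros. symmetry. apply (@RInt_Chasles R_CompleteNormedModule); now apply Lip1_ex_RInt.
Qed.

Lemma Lip1_minus f g : Lip1 f -> Lip1 g -> Lip1 (fun x => f x - g x).
Proof.
  intros (K & HK & Hf) (L & HL & Hg). exists (K + L). split; [lra|]. intros.
  replace (_ - _) with ((f x - f x') - (g x - g x')) by ring.
  eapply Rle_trans; [apply Rabs_triang|]. rewrite Rabs_Ropp.
  specialize (Hf x x'). specialize (Hg x x'). lra.
Qed.

Lemma Lip1_RInt_l g a b : Lip2 g -> Lip1 (fun y => RInt (fun x => g x y) a b).
Proof.
  intros Hg. pose proof Hg as (K & HK & H). exists (Rabs (b - a) * K).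
  split; [apply Rmult_le_pos; auto using Rabs_pos|].
  intros y y'. rewrite <- RInt_minus_R by now apply Lip1_ex_RInt, Lip2_Lip1_l.
  rewrite Rmult_assoc. apply RInt_abs_le.
  - apply (Lip1_ex_RInt (fun x => g x y - g x y')), Lip1_minus; now apply Lip2_Lip1_l.
  - intros x _. specialize (H x y x y'). rewrite Rminus_diag, Rabs_R0, Rplus_0_l in H. exact H.
Qed.

Lemma Lip2_swap g : Lip2 g -> Lip2 (fun y x => g x y).
Proof.
  intros (K & HK & H). exists K; split; auto. intros. specialize (H y x y' x'). lra.
Qed.

Lemma Lip1_RInt_r g a b : Lip2 g -> Lip1 (fun x => RInt (fun y => g x y) a b).
Proof. intros Hg. apply (Lip1_RInt_l (fun y x => g x y)), Lip2_swap, Hg. Qed.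

Lemma constant_of_quadratic f K a b : a <= b ->
  (forall x y, x <= y -> Rabs (f y - f x) <= K * (y - x) ^ 2) -> f b = f a.
Proof.
  intros Hab H.
  assert (Hd : forall t, is_derive f t 0).
  { intros t. apply is_derive_quadratic with 1 K; [lra|]. intros h _.
    replace (f (t + h) - f t - h * 0) with (f (t + h) - f t) by ring.
    destruct (Rle_lt_dec 0 h).
    - replace h with (t + h - t) at 2 by ring. apply H. lra.
    - rewrite <- Rabs_Ropp. replace (- (f (t + h) - f t)) with (f t - f (t + h)) by ring.
      replace (h ^ 2) with ((t - (t + h)) ^ 2) by ring. apply H. lra. }
  pose proof (increment_ge f (fun _ => 0) a b 0 Hab (fun t _ => Hd t) ltac:(intros; lra)).
  pose proof (increment_ge (fun x => - f x) (fun _ => - 0) a b 0 Hab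
    (fun t _ => is_derive_opp f t 0 (Hd t)) ltac:(intros; lra)). lra.
Qed.

(** As functions of the upper limit z in place of b, both iterated integrals have the increment q =
    (y - x) times the integral of g(x, s) over s, up to O((y - x)^2). Their difference [Phi]
    therefore has zero derivative, and it vanishes at z = a. *)
Lemma Fubini_Lip2 g a b c d : Lip2 g -> a <= b ->
  RInt (fun y => RInt (fun x => g x y) a b) c d = RInt (fun x => RInt (fun y => g x y) c d) a b.
Proof.
  intros Hg Hab. pose proof Hg as (K & HK & HL).
  set (Phi := fun z => RInt (fun y => RInt (fun x => g x y) a z) c d
                       - RInt (fun x => RInt (fun y => g x y) c d) a z).
  assert (E : Phi b = Phi a).
  { apply (constant_of_quadratic Phi (2 * K * Rabs (d - c))); auto. intros x y Hxy. unfold Phi.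
    assert (E1 : RInt (fun s => RInt (fun r => g r s) a y) c d - RInt (fun s => RInt (fun r => g r s) a x) c d
      = RInt (fun s => RInt (fun r => g r s) x y) c d).
    { rewrite <- RInt_minus_R by now apply Lip1_ex_RInt, Lip1_RInt_l.
      apply RInt_ext_R. intros s _. rewrite (RInt_Chasles_R _ a x y) by now apply Lip2_Lip1_l. ring. }
    assert (E2 : RInt (fun r => RInt (fun s => g r s) c d) a y - RInt (fun r => RInt (fun s => g r s) c d) a x
      = RInt (fun r => RInt (fun s => g r s) c d) x y).
    { rewrite (RInt_Chasles_R _ a x y) by now apply Lip1_RInt_r. ring. }
    set (q := (y - x) * RInt (fun s => g x s) c d).
    assert (B1 : Rabs (RInt (fun s => RInt (fun r => g r s) x y) c d - q) <= Rabs (d - c) * (K * (y - x) ^ 2)).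
    { unfold q. rewrite <- RInt_scal_R by now apply Lip1_ex_RInt, Lip2_Lip1_r.
      assert (Lq : Lip1 (fun s => (y - x) * g x s)).
      { apply (Lip2_Lip1_r (fun x' s => (y - x) * g x' s)), Lip2_scal, Hg. }
      rewrite <- RInt_minus_R; [|now apply Lip1_ex_RInt, Lip1_RInt_l|now apply Lip1_ex_RInt].
      apply RInt_abs_le.
      { apply (Lip1_ex_RInt (fun s => RInt (fun r => g r s) x y - (y - x) * g x s)), Lip1_minus; auto.
        now apply Lip1_RInt_l. }
      intros s _. rewrite <- (RInt_const_R x y (g x s)).
      rewrite <- RInt_minus_R; [|now apply Lip1_ex_RInt, Lip2_Lip1_l|apply ex_RInt_const].
      replace (K * (y - x) ^ 2) with (Rabs (y - x) * (K * (y - x))) by (rewrite Rabs_right by lra; ring).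
      apply RInt_abs_le.
      { apply (Lip1_ex_RInt (fun r => g r s - g x s)), Lip1_minus; [now apply Lip2_Lip1_l|].
        apply (Lip2_Lip1_l (fun _ _ => g x s) 0), Lip2_const. }
      intros r Hr. rewrite Rmin_left, Rmax_right in Hr by lra.
      eapply Rle_trans; [apply HL|]. apply Rmult_le_compat_l; auto.
      rewrite Rminus_diag, Rabs_R0, Rabs_right; lra. }
    assert (B2 : Rabs (RInt (fun r => RInt (fun s => g r s) c d) x y - q) <= Rabs (d - c) * (K * (y - x) ^ 2)).
    { unfold q. rewrite <- (RInt_const_R x y (RInt (fun s => g x s) c d)).
      rewrite <- RInt_minus_R; [|now apply Lip1_ex_RInt, Lip1_RInt_r|apply ex_RInt_const].
      replace (Rabs (d - c) * (K * (y - x) ^ 2)) with (Rabs (y - x) * (Rabs (d - c) * (K * (y - x))))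
        by (rewrite (Rabs_right (y - x)) by lra; ring).
      apply RInt_abs_le.
      { apply (Lip1_ex_RInt (fun r => RInt (fun s => g r s) c d - RInt (fun s => g x s) c d)), Lip1_minus;
          [now apply Lip1_RInt_r|].
        apply (Lip2_Lip1_l (fun _ _ => RInt (fun s => g x s) c d) 0), Lip2_const. }
      intros r Hr. rewrite Rmin_left, Rmax_right in Hr by lra.
      rewrite <- RInt_minus_R by now apply Lip1_ex_RInt, Lip2_Lip1_r.
      apply RInt_abs_le.
      { apply (Lip1_ex_RInt (fun s => g r s - g x s)), Lip1_minus; now apply Lip2_Lip1_r. }
      intros s _. eapply Rle_trans; [apply HL|]. apply Rmult_le_compat_l; auto.
      rewrite Rminus_diag, Rabs_R0, Rabs_right; lra. }
    match goal with |- Rabs (?A - ?B - (?C - ?D)) <= _ =>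
      replace (A - B - (C - D)) with ((A - C - q) - (B - D - q)) by ring end.
    rewrite E1, E2. eapply Rle_trans; [apply Rabs_triang|]. rewrite Rabs_Ropp. lra. }
  unfold Phi in E. rewrite (RInt_point_R a) in E.
  rewrite (RInt_ext_R (fun y => RInt (fun x => g x y) a a) (fun _ => 0) c d) in E
    by (intros; apply RInt_point_R).
  rewrite (RInt_const_R c d 0) in E. lra.
Qed.

Lemma RInt_periodic f P x : Lip1 f -> (forall y, f (y + P) = f y) ->
  RInt f x (x + P) = RInt f 0 P :> R.
Proof.
  intros Hf HP. rewrite (RInt_Chasles_R f x 0 (x + P)), (RInt_Chasles_R f 0 P (x + P)) by auto.
  assert (E : RInt f P (x + P) = RInt f 0 x).
  { pose proof (RInt_comp_lin (V := R_CompleteNormedModule) f 1 P 0 x (Lip1_ex_RInt _ _ _ Hf)) as E.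
    replace (1 * 0 + P) with P in E by ring. replace (1 * x + P) with (x + P) in E by ring.
    rewrite <- E. apply RInt_ext_R. intros y _. change (1 * f (1 * y + P) = f y).
    rewrite !Rmult_1_l. apply HP. }
  rewrite E. rewrite <- (opp_RInt_swap (V := R_CompleteNormedModule) f 0 x) by now apply Lip1_ex_RInt.
  change (opp (RInt f 0 x)) with (- RInt f 0 x). lra.
Qed.

Definition RInt2 (g : R -> R -> R) a b c d : R := RInt (fun y => RInt (fun x => g x y) a b) c d.

Lemma RInt2_plus f g a b c d : Lip2 f -> Lip2 g ->
  RInt2 (fun x y => f x y + g x y) a b c d = RInt2 f a b c d + RInt2 g a b c d.
Proof.
  intros Hf Hg. unfold RInt2.
  rewrite <- (RInt_plus (V := R_CompleteNormedModule)) by now apply Lip1_ex_RInt, Lip1_RInt_l.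
  apply RInt_ext_R. intros y _.
  apply (RInt_plus (V := R_CompleteNormedModule)); now apply Lip1_ex_RInt, Lip2_Lip1_l.
Qed.

Lemma RInt2_le f g a b c d : a <= b -> c <= d -> Lip2 f -> Lip2 g ->
  (forall x y, a < x < b -> f x y <= g x y) -> RInt2 f a b c d <= RInt2 g a b c d.
Proof.
  intros Hab Hcd Hf Hg H. apply RInt_le; auto; try now apply Lip1_ex_RInt, Lip1_RInt_l.
  intros y _. apply RInt_le; auto; now apply Lip1_ex_RInt, Lip2_Lip1_l.
Qed.

Lemma RInt2_const a b c d v : RInt2 (fun _ _ => v) a b c d = (d - c) * ((b - a) * v).
Proof.
  unfold RInt2. rewrite <- RInt_const_R. apply RInt_ext_R. intros y _. apply RInt_const_R.
Qed.

(* The step is a composition of the two shears (x, y) -> (x + h u, y) and (x, y) -> (x, y - h v);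
   since u_x = v_y its Jacobian (1 + h w)(1 - h w') is 1 + O(h^2). *)
Section AreaStep.
Variables (u v w g : R -> R -> R) (a b K h sg M P : R).
Hypotheses (Hab : a <= b) (HP : 0 < P) (HK : 0 <= K) (Hh : 0 <= h) (Hsg : h * K <= sg) (HM : 0 <= M).
Hypotheses (Lu : Lip2 u) (Lv : Lip2 v) (Lw : Lip2 w) (Lg : Lip2 g).
Hypothesis wlip : forall x x' y, Rabs (w x y - w x' y) <= K * Rabs (x - x').
Hypothesis ub : forall x y, Rabs (u x y) <= K.
Hypothesis wb : forall x y, Rabs (w x y) <= K.
Hypothesis gb : forall x y, Rabs (g x y) <= M.
Hypothesis ux : forall x y, a <= x <= b -> is_derive (fun x => u x y) x (w x y).
Hypothesis vy : forall x y, is_derive (fun y => v x y) y (w x y).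
Hypothesis vper : forall x y, v x (y + P) = v x y.
Hypothesis gper : forall x y, g x (y + P) = g x y.
Hypothesis gsupp : forall x y, g x y <> 0 -> a + sg <= x <= b - sg.

(** Each of the two functions is a pull-back by one shear multiplied by the Jacobian of that shear,
    so that both integrals are exactly that of g. The error appears only when [G3] is compared with
    g composed with the step. *)
Let G2 x y := g x (y - h * v x y) * (1 - h * w x y).
Let G3 x y := G2 (x + h * u x y) y * (1 + h * w x y).

Lemma area_step_Lip2 : Lip2 (fun x y => g (x + h * u x y) (y - h * v (x + h * u x y) y)).
Proof.
  assert (L1 : Lip2 (fun x y => x + h * u x y)) by (apply Lip2_plus; [apply Lip2_fst|now apply Lip2_scal]).
  apply Lip2_comp; auto.
  apply (Lip2_plus (fun _ y => y) (fun x y => - (h * v (x + h * u x y) y))); [apply Lip2_snd|].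
  assert (L2 : Lip2 (fun x y => (- h) * v (x + h * u x y) y)).
  { apply Lip2_scal, Lip2_comp; auto. apply Lip2_snd. }
  destruct L2 as (A & HA & L2). exists A; split; auto. intros.
  eapply Rle_trans; [|apply L2]. right; f_equal; ring.
Qed.

Lemma Bdd_w : Bdd2 w.
Proof. now exists K. Qed.

Lemma Bdd_g : Bdd2 g.
Proof. now exists M. Qed.

Lemma Lip2_1_pm_hw k : Lip2 (fun x y => 1 + k * w x y).
Proof. apply Lip2_plus; [apply Lip2_const|now apply Lip2_scal]. Qed.

Lemma Bdd2_1_pm_hw k : Bdd2 (fun x y => 1 + k * w x y).
Proof. apply Bdd2_plus; [apply Bdd2_const|apply Bdd2_mult; [apply Bdd2_const|apply Bdd_w]]. Qed.

Lemma Lip2_ext f1 f2 : (forall x y, f1 x y = f2 x y) -> Lip2 f1 -> Lip2 f2.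
Proof. intros E (A & HA & L). exists A; split; auto. intros. rewrite <- !E. apply L. Qed.

Lemma Bdd2_ext f1 f2 : (forall x y, f1 x y = f2 x y) -> Bdd2 f1 -> Bdd2 f2.
Proof. intros E (A & HA & L). exists A; split; auto. intros. rewrite <- !E. apply L. Qed.

Lemma Lip2_G2 : Lip2 G2.
Proof.
  unfold G2. apply Lip2_mult.
  - apply Lip2_comp; auto using Lip2_fst.
    apply Lip2_ext with (fun x y => y + (- h) * v x y); [intros; ring|].
    apply Lip2_plus; [apply Lip2_snd|now apply Lip2_scal].
  - apply (Bdd2_comp g), Bdd_g.
  - apply Lip2_ext with (fun x y => 1 + (- h) * w x y); [intros; ring|apply Lip2_1_pm_hw].
  - apply Bdd2_ext with (fun x y => 1 + (- h) * w x y); [intros; ring|apply Bdd2_1_pm_hw].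
Qed.

Lemma Bdd2_G2 : Bdd2 G2.
Proof.
  unfold G2. apply Bdd2_mult; [apply (Bdd2_comp g), Bdd_g|].
  apply Bdd2_ext with (fun x y => 1 + (- h) * w x y); [intros; ring|apply Bdd2_1_pm_hw].
Qed.

Lemma Lip2_G3 : Lip2 G3.
Proof.
  unfold G3. apply Lip2_mult.
  - apply Lip2_comp; auto using Lip2_snd, Lip2_G2.
    apply Lip2_plus; [apply Lip2_fst|now apply Lip2_scal].
  - apply (Bdd2_comp G2), Bdd2_G2.
  - apply Lip2_1_pm_hw.
  - apply Bdd2_1_pm_hw.
Qed.

Lemma G2_outside x y : x < a + sg \/ b - sg < x -> G2 x y = 0.
Proof.
  intros Hx. unfold G2. destruct (Req_dec (g x (y - h * v x y)) 0) as [->|Hn]; [ring|].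
  apply gsupp in Hn. lra.
Qed.

(** Substitution x + h u moves the endpoints by at most h K <= sg, and [G2] vanishes within sg of
    them. *)
Lemma RInt2_G3 : RInt2 G3 a b 0 P = RInt2 G2 a b 0 P.
Proof.
  unfold RInt2. apply RInt_ext_R. intros y _.
  pose proof (RInt_comp (V := R_CompleteNormedModule) (fun x => G2 x y) (fun x => x + h * u x y)
    (fun x => 1 + h * w x y) a b) as HC. cbv beta in HC.
  assert (E : RInt (fun x => G3 x y) a b = RInt (fun x => G2 x y) (a + h * u a y) (b + h * u b y)).
  { rewrite <- HC.
    - apply RInt_ext_R. intros x _. unfold G3. apply Rmult_comm.
    - intros x _. apply Lip1_continuous, Lip2_Lip1_l, Lip2_G2.
    - rewrite Rmin_left, Rmax_right by auto. intros x Hx. split.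
      + auto_derive; [repeat split; eexists; now apply ux|].
        pose proof (is_derive_unique _ _ _ (ux x y Hx)) as Eu.
        change (Derive (fun x0 : R => u x0 y) x = w x y) in Eu. rewrite Eu. ring.
      + apply Lip1_continuous, (Lip2_Lip1_l (fun x y => 1 + h * w x y)), Lip2_1_pm_hw. }
  rewrite E. clear HC E. assert (LG : Lip1 (fun x => G2 x y)) by apply Lip2_Lip1_l, Lip2_G2.
  assert (Bu : forall x, - sg <= h * u x y <= sg).
  { intros x. apply Rabs_le_between. rewrite Rabs_mult, Rabs_right by lra.
    eapply Rle_trans; [|apply Hsg]. apply Rmult_le_compat_l; auto. }
  rewrite (RInt_Chasles_R _ (a + h * u a y) a (b + h * u b y)), (RInt_Chasles_R _ a b (b + h * u b y)) by auto.
  rewrite (RInt_ext_R _ (fun _ => 0) (a + h * u a y) a), (RInt_ext_R _ (fun _ => 0) b (b + h * u b y)).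
  - rewrite !RInt_const_R. ring.
  - intros x [Hx _]. apply G2_outside. right. specialize (Bu b).
    assert (b - sg <= Rmin b (b + h * u b y)) by (apply Rmin_glb; lra). lra.
  - intros x [_ Hx]. apply G2_outside. left. specialize (Bu a).
    assert (Rmax (a + h * u a y) a <= a + sg) by (apply Rmax_lub; lra). lra.
Qed.

(** Integrating first in y makes the second shear a one-dimensional substitution. It moves both
    endpoints by the same amount, because v is periodic, so the integral still runs over one full
    period. *)
Lemma RInt2_G2 : RInt2 G2 a b 0 P = RInt2 g a b 0 P.
Proof.
  unfold RInt2. rewrite (Fubini_Lip2 G2 a b), (Fubini_Lip2 g a b) by auto using Lip2_G2. apply RInt_ext_R. intros x _.
  pose proof (RInt_comp (V := R_CompleteNormedModule) (fun y => g x y) (fun y => y - h * v x y)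
    (fun y => 1 - h * w x y) 0 P) as HC. cbv beta in HC.
  transitivity (RInt (fun y => g x y) (0 - h * v x 0) (P - h * v x P)).
  { rewrite <- HC.
    - apply RInt_ext_R. intros y _. unfold G2. apply Rmult_comm.
    - intros y _. apply Lip1_continuous, Lip2_Lip1_r, Lg.
    - intros y _. split.
      + auto_derive; [repeat split; eexists; now apply vy|].
        pose proof (is_derive_unique _ _ _ (vy x y)) as Ev.
        change (Derive (fun y0 : R => v x y0) y = w x y) in Ev. rewrite Ev. ring.
      + apply Lip1_continuous, (Lip2_Lip1_r (fun x y => 1 - h * w x y)).
        apply Lip2_ext with (fun x y => 1 + (- h) * w x y); [intros; ring|apply Lip2_1_pm_hw]. }
  replace (v x P) with (v x 0) by (rewrite <- (vper x 0); f_equal; ring).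
  replace (P - h * v x 0) with (0 - h * v x 0 + P) by ring.
  apply RInt_periodic; auto. now apply Lip2_Lip1_r.
Qed.

(** The Jacobian factors evaluate w at different points: their product is 1 + h (w(x) - w(x1)) - h^2
    w(x) w(x1). Since |x1 - x| <= h K and w is Lipschitz in x, each correction is at most K^2
    h^2. *)
Lemma area_step : RInt2 g a b 0 P - P * ((b - a) * (2 * K ^ 2 * M * h ^ 2))
  <= RInt2 (fun x y => g (x + h * u x y) (y - h * v (x + h * u x y) y)) a b 0 P.
Proof.
  rewrite <- RInt2_G2, <- RInt2_G3. replace P with (P - 0) at 2 by ring. rewrite <- RInt2_const.
  match goal with |- ?A - ?B <= ?C => enough (A <= B + C) by lra end.
  rewrite <- RInt2_plus by auto using Lip2_const, area_step_Lip2.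
  apply RInt2_le; auto using Lip2_plus, Lip2_const, area_step_Lip2, Lip2_G3; [lra|].
  intros x y _. unfold G3, G2. set (x1 := x + h * u x y).
  set (G := g x1 (y - h * v x1 y)).
  assert (E : Rabs (G * (1 - h * w x1 y) * (1 + h * w x y) - G) <= 2 * K ^ 2 * M * h ^ 2).
  { replace (G * (1 - h * w x1 y) * (1 + h * w x y) - G)
      with (G * (h * (w x y - w x1 y) + - (h ^ 2 * (w x1 y * w x y)))) by ring.
    rewrite Rabs_mult. replace (2 * K ^ 2 * M * h ^ 2) with (M * (2 * K ^ 2 * h ^ 2)) by ring.
    apply Rmult_le_compat; auto using Rabs_pos; [apply gb|].
    eapply Rle_trans; [apply Rabs_triang|]. rewrite Rabs_Ropp, !Rabs_mult.
    rewrite (Rabs_right h), (Rabs_right (h ^ 2)) by (try apply Rle_ge, pow2_ge_0; lra).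
    assert (W1 : Rabs (w x y - w x1 y) <= K * (h * K)).
    { eapply Rle_trans; [apply wlip|]. apply Rmult_le_compat_l; auto.
      unfold x1. replace (x - (x + h * u x y)) with (- (h * u x y)) by ring.
      rewrite Rabs_Ropp, Rabs_mult, Rabs_right by lra. apply Rmult_le_compat_l; auto. }
    assert (W2 : Rabs (w x1 y) * Rabs (w x y) <= K * K)
      by (apply Rmult_le_compat; auto using Rabs_pos).
    apply (Rmult_le_compat_l h) in W1; auto.
    apply (Rmult_le_compat_l (h ^ 2)) in W2; [|apply pow2_ge_0]. lra. }
  apply Rabs_le_between in E. lra.
Qed.

End AreaStep.

(** * Backward discretisation *)

Lemma mvt_segment (f df : R -> R) a b : a <= b -> (forall t, a <= t <= b -> is_derive f t (df t)) ->
  exists xi, a <= xi <= b /\ f b - f a = df xi * (b - a).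
Proof.
  intros Hab Hd. destruct (MVT_gen f a b df) as (xi & Hxi & E).
  - intros x. rewrite Rmin_left, Rmax_right by lra. intros; apply Hd; lra.
  - intros x. rewrite Rmin_left, Rmax_right by lra. intros Hx. apply derivable_continuous_pt.
    exists (df x). apply is_derive_Reals, Hd; lra.
  - rewrite Rmin_left, Rmax_right in Hxi by lra. now exists xi.
Qed.

Lemma mvt_abs_le (f df : R -> R) a b K : a <= b -> (forall t, a <= t <= b -> is_derive f t (df t)) ->
  (forall t, a <= t <= b -> Rabs (df t) <= K) -> Rabs (f b - f a) <= K * (b - a).
Proof.
  intros Hab Hd HK. destruct (mvt_segment f df a b Hab Hd) as (xi & Hxi & ->).
  rewrite Rabs_mult, (Rabs_right (b - a)) by lra. apply Rmult_le_compat_r; [lra|auto].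
Qed.

Definition Lip3 K (U : R -> R -> R -> R) : Prop := forall x y z x' y' z',
  Rabs (U x y z - U x' y' z') <= K * (Rabs (x - x') + Rabs (y - y') + Rabs (z - z')).

Section Shadowing.
Variables (U V : R -> R -> R -> R) (K h : R).
Hypotheses (HK : 0 <= K) (Hh : 0 <= h) (HhK : h * K <= 1 / 4).
Hypotheses (LU : Lip3 K U) (LV : Lip3 K V).
Hypothesis BU : forall x y z, Rabs (U x y z) <= K.
Hypothesis BV : forall x y z, Rabs (V x y z) <= K.

(* One backward time step of length [h] for x' = - U, y' = V. *)
Definition step (t : R) (z : R * R) : R * R :=
  let x1 := fst z + h * U (fst z) (snd z) t in (x1, snd z - h * V x1 (snd z) t).

(** [back n] starts at time n h and ends at time 0: the latest step is performed first. *)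
Fixpoint back (n : nat) (z : R * R) : R * R :=
  match n with O => z | S m => back m (step (INR (S m) * h) z) end.

Variables (xr xy : R -> R) (T : R).
Hypothesis orbit : forall t, 0 <= t <= T ->
  is_derive xr t (- U (xr t) (xy t) t) /\ is_derive xy t (V (xr t) (xy t) t).

Lemma back_consistency F t a b : Lip3 K F -> 0 <= a -> a <= b -> b <= T -> b - a <= h -> a <= t <= b ->
  Rabs (F (xr t) (xy t) t - F (xr b) (xy b) b) <= K * (2 * K + 1) * h.
Proof.
  intros LF Ha Hab Hb Hh' Ht.
  assert (X : Rabs (xr b - xr t) <= K * (b - t)).
  { apply (mvt_abs_le xr (fun t => - U (xr t) (xy t) t)); [lra| |].
    - intros; apply orbit; lra.
    - intros; rewrite Rabs_Ropp; auto. }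
  assert (Y : Rabs (xy b - xy t) <= K * (b - t)).
  { apply (mvt_abs_le xy (fun t => V (xr t) (xy t) t)); [lra| |auto].
    intros; apply orbit; lra. }
  rewrite Rabs_minus_sym in X, Y. assert (Z : Rabs (t - b) <= b - t) by (rewrite Rabs_left1; lra).
  eapply Rle_trans; [apply LF|]. rewrite Rmult_assoc. apply Rmult_le_compat_l; auto.
  assert (K * (b - t) <= K * h) by (apply Rmult_le_compat_l; lra). lra.
Qed.

Definition dist1 (z : R * R) (t : R) : R := Rabs (fst z - xr t) + Rabs (snd z - xy t).

(** The scheme runs backward but the error is propagated forward: the scheme and the orbit agree at
    time 0, and their distance at a later time is wanted. The terms in e are moved to the left,
    giving the factor 1 - 2 h K; for h K <= 1/4 its inverse is at most 1 + 4 h K. *)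
Lemma step_error t z : h <= t -> t <= T ->
  dist1 z t <= (1 + 4 * (h * K)) * (dist1 (step t z) (t - h) + (5 * K ^ 2 + 2 * K) * h ^ 2).
Proof.
  intros Ht HT. destruct z as [x y]. unfold dist1, step; simpl fst; simpl snd.
  set (x1 := x + h * U x y t). set (e := Rabs (x - xr t) + Rabs (y - xy t)).
  assert (He : 0 <= e) by (unfold e; pose proof (Rabs_pos (x - xr t)); pose proof (Rabs_pos (y - xy t)); lra).
  destruct (mvt_segment xr (fun t => - U (xr t) (xy t) t) (t - h) t) as (xi & Hxi & Ex); [lra|intros; apply orbit; lra|].
  destruct (mvt_segment xy (fun t => V (xr t) (xy t) t) (t - h) t) as (et & Het & Ey); [lra|intros; apply orbit; lra|].
  cbv beta in Ex, Ey.
  pose proof (back_consistency U xi (t - h) t LU ltac:(lra) ltac:(lra) HT ltac:(lra) Hxi) as C1.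
  pose proof (back_consistency V et (t - h) t LV ltac:(lra) ltac:(lra) HT ltac:(lra) Het) as C2.
  assert (D1 : Rabs (U x y t - U (xr t) (xy t) t) <= K * e).
  { eapply Rle_trans; [apply LU|]. rewrite Rminus_diag, Rabs_R0. unfold e. right; ring. }
  assert (D2 : Rabs (V x1 y t - V (xr t) (xy t) t) <= K * (e + h * K)).
  { eapply Rle_trans; [apply LV|]. rewrite Rminus_diag, Rabs_R0, Rplus_0_r.
    apply Rmult_le_compat_l; auto. unfold x1, e.
    replace (x + h * U x y t - xr t) with (x - xr t + h * U x y t) by ring.
    pose proof (Rabs_triang (x - xr t) (h * U x y t)) as Tr. rewrite (Rabs_mult h), (Rabs_right h) in Tr by lra.
    pose proof (Rmult_le_compat_l h _ _ Hh (BU x y t)). lra. }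
  assert (P1 : Rabs (x - xr t) <= Rabs (x1 - xr (t - h)) + h * (K * e) + h * (K * (2 * K + 1) * h)).
  { replace (x - xr t) with ((x1 - xr (t - h)) + (- (h * (U x y t - U (xr t) (xy t) t))
      + h * (U (xr xi) (xy xi) xi - U (xr t) (xy t) t))).
    2:{ unfold x1. apply Rminus_diag_uniq. transitivity ((xr t - xr (t - h)) + U (xr xi) (xy xi) xi * h);
        [ring|rewrite Ex; ring]. }
    eapply Rle_trans; [apply Rabs_triang|]. rewrite Rplus_assoc. apply Rplus_le_compat_l.
    eapply Rle_trans; [apply Rabs_triang|]. rewrite Rabs_Ropp, !Rabs_mult, (Rabs_right h) by lra.
    apply Rplus_le_compat; apply Rmult_le_compat_l; auto. }
  assert (P2 : Rabs (y - xy t) <= Rabs (y - h * V x1 y t - xy (t - h)) + h * (K * (e + h * K))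
       + h * (K * (2 * K + 1) * h)).
  { replace (y - xy t) with ((y - h * V x1 y t - xy (t - h)) + (h * (V x1 y t - V (xr t) (xy t) t)
      + - (h * (V (xr et) (xy et) et - V (xr t) (xy t) t)))).
    2:{ apply Rminus_diag_uniq. transitivity ((xy t - xy (t - h)) - V (xr et) (xy et) et * h);
        [ring|rewrite Ey; ring]. }
    eapply Rle_trans; [apply Rabs_triang|]. rewrite Rplus_assoc. apply Rplus_le_compat_l.
    eapply Rle_trans; [apply Rabs_triang|]. rewrite Rabs_Ropp, !Rabs_mult, (Rabs_right h) by lra.
    apply Rplus_le_compat; apply Rmult_le_compat_l; auto. }
  set (e1 := Rabs (x1 - xr (t - h)) + Rabs (y - h * V x1 y t - xy (t - h))).
  (* The constant is twice K (2 K + 1), from [back_consistency] in each coordinate, plus K^2 because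
     V is evaluated at x1 instead of x. *)
  assert (S : e * (1 - 2 * (h * K)) <= e1 + (5 * K ^ 2 + 2 * K) * h ^ 2).
  { unfold e1. assert (e <= Rabs (x1 - xr (t - h)) + h * (K * e) + h * (K * (2 * K + 1) * h)
       + (Rabs (y - h * V x1 y t - xy (t - h)) + h * (K * (e + h * K)) + h * (K * (2 * K + 1) * h))).
    { unfold e at 1. lra. }
    lra. }
  assert (0 <= h * K) by now apply Rmult_le_pos.
  apply (Rmult_le_compat_l (1 + 4 * (h * K))) in S; [|lra].
  eapply Rle_trans; [|exact S].
  replace ((1 + 4 * (h * K)) * (e * (1 - 2 * (h * K)))) with (e + e * (2 * (h * K) * (1 - 4 * (h * K)))) by ring.
  assert (0 <= e * (2 * (h * K) * (1 - 4 * (h * K)))) by (repeat apply Rmult_le_pos; lra). lra.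
Qed.

(** Discrete Gronwall estimate: whenever the scheme started from z ends at the initial point of an
    orbit, z is close to that orbit at time n h. This replaces the inverse of a flow. *)
Lemma back_shadow n : forall z, INR n * h <= T -> back n z = (xr 0, xy 0) ->
  dist1 z (INR n * h) <= INR n * ((5 * K ^ 2 + 2 * K) * h ^ 2) * (1 + 4 * (h * K)) ^ n.
Proof.
  assert (H0 : 0 <= h * K) by now apply Rmult_le_pos.
  assert (HC : 0 <= (5 * K ^ 2 + 2 * K) * h ^ 2) by (pose proof (pow2_ge_0 K); pose proof (pow2_ge_0 h); nra).
  induction n as [|n IH]; intros z HT Hz.
  - simpl back in Hz. subst z. unfold dist1; simpl. rewrite !Rmult_0_l, !Rminus_diag, Rabs_R0. lra.
  - cbn [back] in Hz. rewrite S_INR in HT. pose proof (pos_INR n).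
    assert (0 <= INR n * h) by now apply Rmult_le_pos.
    specialize (IH (step (INR (S n) * h) z) ltac:(lra) Hz).
    pose proof (step_error (INR (S n) * h) z) as E. rewrite S_INR in E at 1 2.
    specialize (E ltac:(lra) ltac:(lra)).
    replace (INR (S n) * h - h) with (INR n * h) in E by (rewrite S_INR; ring).
    eapply Rle_trans; [exact E|]. set (C := (5 * K ^ 2 + 2 * K) * h ^ 2) in *.
    set (q := 1 + 4 * (h * K)) in *.
    replace (INR (S n) * C * q ^ S n) with (q * (INR n * C * q ^ n + C * q ^ n)) by (rewrite S_INR; simpl; ring).
    apply Rmult_le_compat_l; [unfold q; lra|].
    assert (1 <= q ^ n) by (apply pow_R1_Rle; unfold q; lra). nra.
Qed.

Lemma back_shadow_uniform n z : INR n * h <= T -> back n z = (xr 0, xy 0) ->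
  dist1 z (INR n * h) <= (5 * K ^ 2 + 2 * K) * T * exp (4 * K * T) * h.
Proof.
  intros HT Hz. eapply Rle_trans; [now apply back_shadow|].
  assert (H0 : 0 <= h * K) by now apply Rmult_le_pos.
  assert (HC : 0 <= 5 * K ^ 2 + 2 * K) by (pose proof (pow2_ge_0 K); nra).
  pose proof (pos_INR n).
  assert (Hq : (1 + 4 * (h * K)) ^ n <= exp (4 * K * T)).
  { apply Rle_trans with (exp (4 * (h * K)) ^ n).
    - apply pow_incr. split; [lra|]. pose proof (exp_ineq1_le (4 * (h * K))). lra.
    - assert (En : forall m x, exp x ^ m = exp (INR m * x)).
      { induction m as [|m IHm]; intros x; [simpl; now rewrite Rmult_0_l, exp_0|].
        rewrite S_INR, Rmult_plus_distr_r, Rmult_1_l, Rplus_comm, exp_plus, <- IHm. reflexivity. }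
      rewrite En. assert (Hle : INR n * (4 * (h * K)) <= 4 * K * T).
      { replace (INR n * (4 * (h * K))) with (4 * K * (INR n * h)) by ring.
        apply Rmult_le_compat_l; lra. }
      destruct Hle as [Hlt|Heq]; [left; now apply exp_increasing|right; now rewrite Heq]. }
  replace ((5 * K ^ 2 + 2 * K) * T * exp (4 * K * T) * h) with ((T * ((5 * K ^ 2 + 2 * K) * h)) * exp (4 * K * T)) by ring.
  assert (0 <= INR n * h) by now apply Rmult_le_pos.
  apply Rmult_le_compat; auto.
  - apply Rmult_le_pos; auto. apply Rmult_le_pos; auto. apply pow2_ge_0.
  - apply pow_le; lra.
  - replace (INR n * ((5 * K ^ 2 + 2 * K) * h ^ 2)) with ((INR n * h) * ((5 * K ^ 2 + 2 * K) * h)) by ring.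
    apply Rmult_le_compat_r; auto. now apply Rmult_le_pos.
Qed.

End Shadowing.

(** * Recurrence *)

Lemma Lip3_Lip2 K U t : 0 <= K -> Lip3 K U -> Lip2 (fun x y => U x y t).
Proof.
  intros HK L. exists K. split; auto. intros. eapply Rle_trans; [apply L|].
  rewrite Rminus_diag, Rabs_R0, Rplus_0_r. lra.
Qed.

Lemma sum_exclusive_le (c : nat -> R) M N : (forall j, 0 <= c j <= M) ->
  (forall i j, (i < j <= N)%nat -> c i <> 0 -> c j <> 0 -> False) -> sum_f_R0 c N <= M.
Proof.
  intros Hc. induction N as [|N IH]; intros Hx; [apply Hc|]. rewrite tech5.
  destruct (Req_dec (c (S N)) 0) as [E|E].
  - rewrite E, Rplus_0_r. apply IH. intros i j Hij. apply Hx. lia.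
  - rewrite sum_eq_R0; [rewrite Rplus_0_l; apply Hc|]. intros i Hi.
    destruct (Req_dec (c i) 0) as [|Ei]; auto. exfalso. apply (Hx i (S N)); auto. lia.
Qed.

Lemma Lip2_sum (F : nat -> R -> R -> R) N : (forall j, (j <= N)%nat -> Lip2 (F j)) ->
  Lip2 (fun x y => sum_f_R0 (fun j => F j x y) N).
Proof.
  induction N as [|N IH]; intros H; [apply (H 0%nat); lia|].
  apply (Lip2_plus (fun x y => sum_f_R0 (fun j => F j x y) N)); auto.
Qed.

Lemma RInt2_sum (F : nat -> R -> R -> R) N a b c d : (forall j, (j <= N)%nat -> Lip2 (F j)) ->
  RInt2 (fun x y => sum_f_R0 (fun j => F j x y) N) a b c d = sum_f_R0 (fun j => RInt2 (F j) a b c d) N.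
Proof.
  induction N as [|N IH]; intros H; [reflexivity|].
  rewrite tech5, <- IH by auto.
  apply (RInt2_plus (fun x y => sum_f_R0 (fun j => F j x y) N)); auto. apply Lip2_sum; auto.
Qed.

Lemma exists_fine_mesh tau A d : 0 < tau -> 0 <= A -> 0 < d -> exists N, (1 <= N)%nat /\ tau / INR N * A <= d.
Proof.
  intros Htau HA Hd. destruct (archimed_cor1 (d / (tau * (A + 1)))) as (N & HN & HN0).
  { apply Rdiv_lt_0_compat; auto. apply Rmult_lt_0_compat; lra. }
  exists N. split; [lia|]. assert (0 < INR N) by (apply lt_0_INR; lia).
  assert (Hp : 0 < / INR N) by now apply Rinv_0_lt_compat.
  apply (Rmult_lt_compat_r (tau * (A + 1))) in HN; [|apply Rmult_lt_0_compat; lra].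
  replace (d / (tau * (A + 1)) * (tau * (A + 1))) with d in HN by (field; lra).
  unfold Rdiv. assert (0 < / INR N * tau) by now apply Rmult_lt_0_compat. nra.
Qed.

Section Recurrence.
Variables (U V W : R -> R -> R -> R) (K a b P tau : R).
Hypotheses (HK : 0 <= K) (Hab : a <= b) (HP : 0 < P) (Htau : 0 < tau).
Hypotheses (LU : Lip3 K U) (LV : Lip3 K V) (LW : Lip3 K W).
Hypothesis BU : forall x y z, Rabs (U x y z) <= K.
Hypothesis BV : forall x y z, Rabs (V x y z) <= K.
Hypothesis BW : forall x y z, Rabs (W x y z) <= K.
Hypothesis Ux : forall x y z, a <= x <= b -> is_derive (fun x => U x y z) x (W x y z).
Hypothesis Vy : forall x y z, is_derive (fun y => V x y z) y (W x y z).
Hypothesis Uper : forall x y z, U x (y + P) z = U x y z.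
Hypothesis Vper : forall x y z, V x (y + P) z = V x y z.
Hypothesis Utau : forall x y z, U x y (z + tau) = U x y z.
Hypothesis Vtau : forall x y z, V x y (z + tau) = V x y z.
Variables (f : R -> R -> R) (M : R).
Hypotheses (HM : 0 <= M) (Lf : Lip2 f).
Hypothesis Bf : forall x y, 0 <= f x y <= M.
Hypothesis fper : forall x y, f x (y + P) = f x y.
Variables (sg T : R) (J k : nat).
Hypotheses (Hsg : 0 < sg) (Hk : (1 <= k)%nat) (HT : T = INR J * (INR k * tau)).
Hypothesis If : 0 < RInt2 f a b 0 P.
(** J + 1 functions bounded by [M] with disjoint supports, each keeping half of the integral of [f],
    would not fit into the annulus. *)
Hypothesis HJ : P * ((b - a) * M) < INR (S J) * (RInt2 f a b 0 P / 2).

(** One margin [sg] is lost to the shadowing error; the other leaves the room near the endpoints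
    that [area_step] requires. *)
Definition is_orbit (xr xy : R -> R) : Prop := forall t, 0 <= t <= T ->
  a + 2 * sg <= xr t <= b - 2 * sg /\
  is_derive xr t (- U (xr t) (xy t) t) /\ is_derive xy t (V (xr t) (xy t) t).

Hypothesis orbits : forall x y, f x y <> 0 -> exists xr xy, xr 0 = x /\ xy 0 = y /\ is_orbit xr xy.
(** Avoiding the support of [f] by the distance [sg], not merely missing it, allows the scheme to
    stand in for the orbits. *)
Hypothesis wandering : forall xr xy l x y, is_orbit xr xy -> f (xr 0) (xy 0) <> 0 ->
  (1 <= l <= J)%nat -> f x y <> 0 -> sg < dist1 xr xy (x, y) (INR l * (INR k * tau)).

Section Mesh.
Variable N : nat.
Hypothesis HN : (1 <= N)%nat.
(** The step divides the period, so the scheme repeats itself after N steps. [M3] keeps the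
    shadowing error below [sg]; [M4] keeps the loss of integral, of order h^2 at each of at most T /
    h steps, below one half. *)
Let h := tau / INR N.
Hypotheses (M1 : h * K <= 1 / 4) (M2 : h * K <= sg)
  (M3 : (5 * K ^ 2 + 2 * K) * T * exp (4 * K * T) * h <= sg)
  (M4 : T * (P * ((b - a) * (2 * K ^ 2 * M))) * h <= RInt2 f a b 0 P / 2).

(** The function [f] transported forward for the time n h: the support of [g n] follows the
    positions at that time of the orbits starting in the support of [f]. *)
Let g n x y := f (fst (back U V h n (x, y))) (snd (back U V h n (x, y))).

Lemma h_pos : 0 < h.
Proof. apply Rdiv_lt_0_compat; auto. apply lt_0_INR; lia. Qed.

Lemma back_translate n : forall z, back U V h n (fst z, snd z + P)
  = (fst (back U V h n z), snd (back U V h n z) + P).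
Proof.
  induction n as [|n IH]; intros z; [reflexivity|]. cbn [back]. rewrite <- IH. f_equal.
  unfold step. cbn [fst snd]. rewrite Uper, Vper. f_equal. ring.
Qed.

Lemma g_per n x y : g n x (y + P) = g n x y.
Proof.
  unfold g. pose proof (back_translate n (x, y)) as E. cbn [fst snd] in E. rewrite E. apply fper.
Qed.

Lemma Lip2_gn n : Lip2 (g n).
Proof.
  pose proof h_pos. induction n as [|n IH]; [exact Lf|].
  apply (area_step_Lip2 (fun x y => U x y (INR (S n) * h)) (fun x y => V x y (INR (S n) * h)) (g n) h);
    eauto using Lip3_Lip2.
Qed.

(** If [g n] is nonzero at a point, [back n] leads that point into the support of [f], where an
    orbit starts by hypothesis; [back_shadow_uniform] applies to it. *)
Lemma g_shadow n x y : INR n * h <= T -> g n x y <> 0 ->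
  exists xr xy, is_orbit xr xy /\ f (xr 0) (xy 0) <> 0 /\ dist1 xr xy (x, y) (INR n * h) <= sg.
Proof.
  intros Hn Hg. pose proof h_pos. pose proof (pos_INR n). unfold g in Hg.
  destruct (orbits _ _ Hg) as (xr & xy & E1 & E2 & Ho). exists xr, xy.
  split; [exact Ho|]. split; [now rewrite E1, E2|].
  eapply Rle_trans; [|exact M3].
  apply (back_shadow_uniform U V K h HK); auto; try lra.
  - intros t Ht. apply Ho, Ht.
  - rewrite E1, E2. apply surjective_pairing.
Qed.

Lemma g_supp n x y : INR n * h <= T -> g n x y <> 0 -> a + sg <= x <= b - sg.
Proof.
  intros Hn Hg. destruct (g_shadow n x y Hn Hg) as (xr & xy & Ho & _ & Hd).
  pose proof h_pos. pose proof (pos_INR n).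
  destruct (Ho (INR n * h)) as [Hx _]; [split; [apply Rmult_le_pos; lra|auto]|].
  unfold dist1 in Hd. cbn [fst snd] in Hd. pose proof (Rabs_pos (y - xy (INR n * h))).
  assert (Hd' : Rabs (x - xr (INR n * h)) <= sg) by lra. apply Rabs_le_between in Hd'. lra.
Qed.

Lemma RInt2_gn n : INR n * h <= T ->
  RInt2 f a b 0 P - INR n * (P * ((b - a) * (2 * K ^ 2 * M * h ^ 2))) <= RInt2 (g n) a b 0 P.
Proof.
  pose proof h_pos. induction n as [|n IH]; intros Hn.
  - simpl INR. change (g 0%nat) with f. lra.
  - rewrite S_INR in Hn. specialize (IH ltac:(lra)).
    pose proof (area_step (fun x y => U x y (INR (S n) * h)) (fun x y => V x y (INR (S n) * h))
      (fun x y => W x y (INR (S n) * h)) (g n) a b K h sg M P) as A.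
    cbv beta in A.
    assert (A' : RInt2 (g n) a b 0 P - P * ((b - a) * (2 * K ^ 2 * M * h ^ 2)) <= RInt2 (g (S n)) a b 0 P).
    { apply A; eauto using Lip3_Lip2, Lip2_gn, g_per; try lra.
      - intros x x' y. eapply Rle_trans; [apply LW|]. rewrite !Rminus_diag, Rabs_R0. right; ring.
      - intros x y. rewrite Rabs_right; [apply Bf|apply Rle_ge, Bf].
      - intros x y Hg. apply (g_supp n x y); auto. lra. }
    rewrite S_INR. lra.
Qed.

(** The first n steps on the left take place l k periods later than those of [back n]; by
    periodicity they are the same maps. *)
Lemma back_add l n : forall z, back U V h (l * (k * N) + n) z
  = back U V h (l * (k * N)) (back U V h n z).
Proof.
  induction n as [|n IH]; intros z; [now rewrite Nat.add_0_r|].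
  rewrite Nat.add_succ_r. cbn [back]. rewrite IH. do 2 f_equal.
  assert (E : INR (S (l * (k * N) + n)) * h = INR (S n) * h + INR (l * k) * tau).
  { rewrite <- Nat.add_succ_r, plus_INR, Rmult_plus_distr_r, Rplus_comm. f_equal.
    rewrite Nat.mul_assoc, mult_INR. unfold h. field. apply not_0_INR; lia. }
  rewrite E. unfold step.
  rewrite (periodic_nat (fun t => U _ _ t) tau (fun t => Utau _ _ t)).
  rewrite (periodic_nat (fun t => V _ _ t) tau (fun t => Vtau _ _ t)). reflexivity.
Qed.

Lemma time_block l : INR (l * (k * N)) * h = INR l * (INR k * tau).
Proof. rewrite !mult_INR. unfold h. field. apply not_0_INR; lia. Qed.

Lemma time_block_le l : (l <= J)%nat -> INR (l * (k * N)) * h <= T.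
Proof.
  intros Hl. rewrite time_block, HT. apply Rmult_le_compat_r; [|now apply le_INR].
  apply Rmult_le_pos; [apply pos_INR|lra].
Qed.

(** Otherwise z, reached after i k N backward steps, lies in the support of [f], and (j - i) k N
    further steps lead into the support again. An orbit starting there would pass within [sg] of z
    after j - i blocks of k periods, contrary to [wandering]. *)
Lemma g_exclusive x y i j : (i < j <= J)%nat ->
  g (i * (k * N)) x y <> 0 -> g (j * (k * N)) x y <> 0 -> False.
Proof.
  intros Hij Hi Hj. unfold g in Hi.
  set (z := back U V h (i * (k * N)) (x, y)) in *.
  assert (Hj' : g ((j - i) * (k * N)) (fst z) (snd z) <> 0).
  { unfold g in Hj |- *. rewrite <- surjective_pairing. unfold z. rewrite <- back_add.
    replace ((j - i) * (k * N) + i * (k * N))%nat with (j * (k * N))%nat by nia. exact Hj. }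
  destruct (g_shadow _ _ _ (time_block_le (j - i) ltac:(lia)) Hj') as (xr & xy & Ho & Hf & Hd).
  rewrite time_block in Hd.
  pose proof (wandering xr xy (j - i)%nat (fst z) (snd z) Ho Hf ltac:(lia) Hi). lra.
Qed.

(** Pointwise at most one of the J + 1 functions is nonzero, so their sum is at most [M]; its
    integral is compared with the sum of the individual ones. *)
Lemma mesh_contradiction : False.
Proof.
  pose proof h_pos as Hh.
  assert (Hs : RInt2 (fun x y => sum_f_R0 (fun j => g (j * (k * N)) x y) J) a b 0 P <= P * ((b - a) * M)).
  { replace P with (P - 0) at 2 by ring. rewrite <- RInt2_const.
    apply RInt2_le; [auto|lra|apply Lip2_sum; intros; apply Lip2_gn|apply Lip2_const|].
    intros x y _. apply sum_exclusive_le; [intros; apply Bf|]. intros i j. apply g_exclusive. }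
  rewrite RInt2_sum in Hs by (intros; apply Lip2_gn).
  assert (Hl : INR (S J) * (RInt2 f a b 0 P / 2) <= sum_f_R0 (fun j => RInt2 (g (j * (k * N))) a b 0 P) J).
  { rewrite Rmult_comm, <- sum_cte. apply sum_Rle. intros j Hj.
    pose proof (time_block_le j Hj) as Ht. eapply Rle_trans; [|now apply RInt2_gn].
    set (n := (j * (k * N))%nat) in *. set (A := P * ((b - a) * (2 * K ^ 2 * M))) in *.
    assert (HA : 0 <= A).
    { unfold A. pose proof (pow2_ge_0 K). apply Rmult_le_pos; [lra|].
      apply Rmult_le_pos; [lra|]. apply Rmult_le_pos; lra. }
    replace (INR n * (P * ((b - a) * (2 * K ^ 2 * M * h ^ 2)))) with (INR n * h * (A * h)) by (unfold A; ring).
    assert (INR n * h * (A * h) <= T * (A * h)) by (apply Rmult_le_compat_r; [apply Rmult_le_pos; lra|auto]).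
    lra. }
  eapply Rlt_irrefl, Rlt_le_trans; [exact HJ|]. eapply Rle_trans; [exact Hl|exact Hs].
Qed.

End Mesh.

Lemma wandering_contradiction : False.
Proof.
  assert (HT0 : 0 <= T) by (rewrite HT; repeat apply Rmult_le_pos; try apply pos_INR; lra).
  set (C1 := (5 * K ^ 2 + 2 * K) * T * exp (4 * K * T)).
  set (C2 := T * (P * ((b - a) * (2 * K ^ 2 * M)))).
  pose proof (pow2_ge_0 K).
  assert (H1 : 0 <= C1).
  { unfold C1. apply Rmult_le_pos; [apply Rmult_le_pos; lra|apply Rlt_le, exp_pos]. }
  assert (H2 : 0 <= C2).
  { unfold C2. apply Rmult_le_pos; [lra|]. apply Rmult_le_pos; [lra|]. apply Rmult_le_pos; [lra|].
    apply Rmult_le_pos; lra. }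
  set (d := Rmin (1 / 4) (Rmin sg (RInt2 f a b 0 P / 2))).
  assert (Hd : 0 < d) by (repeat apply Rmin_pos; lra).
  assert (d1 : d <= 1 / 4) by apply Rmin_l.
  assert (d2 : d <= sg) by (eapply Rle_trans; [apply Rmin_r|apply Rmin_l]).
  assert (d3 : d <= RInt2 f a b 0 P / 2) by (eapply Rle_trans; [apply Rmin_r|apply Rmin_r]).
  destruct (exists_fine_mesh tau (K + C1 + C2) d Htau ltac:(lra) Hd) as (N & HN & Hm).
  assert (Hh : 0 < tau / INR N) by (apply Rdiv_lt_0_compat; auto; apply lt_0_INR; lia).
  set (h := tau / INR N) in *.
  assert (0 <= h * K) by (apply Rmult_le_pos; lra).
  assert (0 <= h * C1) by (apply Rmult_le_pos; lra).
  assert (0 <= h * C2) by (apply Rmult_le_pos; lra).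
  rewrite !Rmult_plus_distr_l in Hm.
  apply (mesh_contradiction N HN); fold h; fold C1; fold C2; lra.
Qed.

End Recurrence.

(** * Truncated vector field *)

Lemma mvt_lipschitz (f df : R -> R) x y K :
  (forall t, Rmin x y <= t <= Rmax x y -> is_derive f t (df t) /\ Rabs (df t) <= K) ->
  Rabs (f x - f y) <= K * Rabs (x - y).
Proof.
  intros H. destruct (Rle_lt_dec x y) as [Hxy|Hxy].
  - rewrite Rmin_left, Rmax_right in H by lra.
    rewrite Rabs_minus_sym, (Rabs_minus_sym x y), (Rabs_right (y - x)) by lra.
    apply (mvt_abs_le f df); auto; intros; now apply H.
  - rewrite Rmin_right, Rmax_left in H by lra. rewrite (Rabs_right (x - y)) by lra.
    apply (mvt_abs_le f df); [lra| |]; intros; now apply H.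
Qed.

Lemma cyl_analytic_lipschitz rho0 tau F rho1 : 0 < tau -> cyl_analytic rho0 tau F -> 0 <= rho1 < rho0 ->
  exists L, 0 <= L /\ forall x y z x' y' z', Rabs x <= rho1 -> Rabs x' <= rho1 ->
    Rabs (F x y z - F x' y' z') <= L * (Rabs (x - x') + Rabs (y - y') + Rabs (z - z')).
Proof.
  intros Htau HF Hr.
  destruct (cyl_analytic_bounded rho0 tau Htau (Dx F) rho1) as (A & HA & BA); [now apply cyl_analytic_Dx|lra|].
  destruct (cyl_analytic_bounded rho0 tau Htau (Dy F) rho1) as (B & HB & BB); [now apply cyl_analytic_Dy|lra|].
  destruct (cyl_analytic_bounded rho0 tau Htau (Dz F) rho1) as (C & HC & BC); [now apply cyl_analytic_Dz|lra|].
  exists (A + B + C). split; [lra|]. intros x y z x' y' z' Hx Hx'.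
  assert (Hi : forall t, Rabs t <= rho1 -> -rho0 < t < rho0).
  { intros t Ht. apply Rabs_le_between in Ht. lra. }
  assert (P1 : Rabs (F x y z - F x' y z) <= A * Rabs (x - x')).
  { apply (mvt_lipschitz (fun u => F u y z) (fun u => Dx F u y z)). intros t Ht.
    assert (Ht' : Rabs t <= rho1).
    { apply Rabs_le_between in Hx. apply Rabs_le_between in Hx'. apply Rabs_le_between.
      assert (-rho1 <= Rmin x x') by (apply Rmin_glb; lra).
      assert (Rmax x x' <= rho1) by (apply Rmax_lub; lra). lra. }
    split; [apply (is_derive_Dx rho0 tau); auto|auto]. }
  assert (P2 : Rabs (F x' y z - F x' y' z) <= B * Rabs (y - y')).
  { apply (mvt_lipschitz (fun u => F x' u z) (fun u => Dy F x' u z)). intros t Ht.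
    split; [apply (is_derive_Dy rho0 tau); auto|auto]. }
  assert (P3 : Rabs (F x' y' z - F x' y' z') <= C * Rabs (z - z')).
  { apply (mvt_lipschitz (fun u => F x' y' u) (fun u => Dz F x' y' u)). intros t Ht.
    split; [apply (is_derive_Dz rho0 tau); auto|auto]. }
  replace (F x y z - F x' y' z') with
    ((F x y z - F x' y z) + ((F x' y z - F x' y' z) + (F x' y' z - F x' y' z'))) by ring.
  eapply Rle_trans; [apply Rabs_triang|].
  pose proof (Rabs_triang (F x' y z - F x' y' z) (F x' y' z - F x' y' z')).
  pose proof (Rabs_pos (x - x')). pose proof (Rabs_pos (y - y')). pose proof (Rabs_pos (z - z')).
  nra.
Qed.

(** The scheme needs fields that are bounded and Lipschitz on the whole plane. Clamping the action
    provides this without changing the field where the orbits live. *)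
Definition clamp a b r : R := Rmax a (Rmin b r).

Lemma clamp_between a b r : a <= b -> a <= clamp a b r <= b.
Proof.
  intros H. unfold clamp. split; [apply Rmax_l|]. apply Rmax_lub; [auto|apply Rmin_l].
Qed.

Lemma clamp_id a b r : a <= r <= b -> clamp a b r = r.
Proof. intros H. unfold clamp. rewrite Rmin_right, Rmax_right; lra. Qed.

Lemma clamp_lipschitz a b r r' : Rabs (clamp a b r - clamp a b r') <= Rabs (r - r').
Proof.
  unfold clamp, Rmax, Rmin. repeat destruct Rle_dec; unfold Rabs; repeat destruct Rcase_abs; lra.
Qed.

Lemma sqrt_lipschitz a x y : 0 < a -> a <= x -> a <= y ->
  Rabs (sqrt x - sqrt y) <= / sqrt a * Rabs (x - y).
Proof.
  intros Ha Hx Hy. pose proof (sqrt_lt_R0 a Ha).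
  assert (sqrt a <= sqrt x) by now apply sqrt_le_1_alt.
  assert (sqrt a <= sqrt y) by now apply sqrt_le_1_alt.
  apply Rmult_le_reg_l with (sqrt a); auto. rewrite <- Rmult_assoc, Rinv_r, Rmult_1_l by lra.
  replace (x - y) with ((sqrt x + sqrt y) * (sqrt x - sqrt y)).
  2:{ rewrite <- (sqrt_sqrt x) at 3 by lra. rewrite <- (sqrt_sqrt y) at 3 by lra. ring. }
  rewrite Rabs_mult, (Rabs_right (sqrt x + sqrt y)) by lra.
  apply Rmult_le_compat_r; [apply Rabs_pos|lra].
Qed.

Lemma Lip3_mono K L U : K <= L -> Lip3 K U -> Lip3 L U.
Proof.
  intros H HU x y z x' y' z'. eapply Rle_trans; [apply HU|]. apply Rmult_le_compat_r; auto.
  pose proof (Rabs_pos (x - x')). pose proof (Rabs_pos (y - y')). pose proof (Rabs_pos (z - z')). lra.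
Qed.

Section ClampedFields.
Variables (rho0 tau a b : R).
Hypotheses (Htau : 0 < tau) (Ha : 0 < a) (Hab : a <= b) (Hb : sqrt b < rho0).

(** The lower clamp avoids the singularity of the square root at 0, the upper one stays inside the
    domain of analyticity. *)
Definition rad r : R := sqrt (clamp a b r).

Lemma rad_between r : sqrt a <= rad r <= sqrt b.
Proof. pose proof (clamp_between a b r Hab). split; apply sqrt_le_1_alt; lra. Qed.

Lemma rad_pos r : 0 < rad r.
Proof. pose proof (rad_between r). pose proof (sqrt_lt_R0 a Ha). lra. Qed.

Lemma rad_lipschitz r r' : Rabs (rad r - rad r') <= / sqrt a * Rabs (r - r').
Proof.
  pose proof (clamp_between a b r Hab). pose proof (clamp_between a b r' Hab).
  eapply Rle_trans; [apply (sqrt_lipschitz a); lra|].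
  apply Rmult_le_compat_l; [|apply clamp_lipschitz].
  apply Rlt_le, Rinv_0_lt_compat, sqrt_lt_R0, Ha.
Qed.

Lemma radial_field_regular F : cyl_analytic rho0 tau F -> exists K, 0 <= K /\
  Lip3 K (fun r y z => F (rad r) y z) /\ (forall r y z, Rabs (F (rad r) y z) <= K).
Proof.
  intros HF. assert (Hr : forall r, Rabs (rad r) <= sqrt b).
  { intros r. pose proof (rad_between r). pose proof (rad_pos r). rewrite Rabs_right; lra. }
  assert (Hsb : 0 <= sqrt b < rho0) by (split; [apply sqrt_pos|auto]).
  destruct (cyl_analytic_bounded rho0 tau Htau F (sqrt b) HF Hb) as (M & HM & BM).
  destruct (cyl_analytic_lipschitz rho0 tau F (sqrt b) Htau HF Hsb) as (L & HL & BL).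
  assert (Hia : 0 < / sqrt a) by (apply Rinv_0_lt_compat, sqrt_lt_R0, Ha).
  exists (M + L * (/ sqrt a + 1)). assert (0 <= L * (/ sqrt a + 1)) by (apply Rmult_le_pos; lra).
  split; [lra|]. split.
  - apply Lip3_mono with (L * (/ sqrt a + 1)); [lra|]. intros x y z x' y' z'.
    eapply Rle_trans; [apply BL; auto|]. rewrite Rmult_assoc. apply Rmult_le_compat_l; auto.
    pose proof (rad_lipschitz x x'). pose proof (Rabs_pos (x - x')).
    pose proof (Rabs_pos (y - y')). pose proof (Rabs_pos (z - z')). nra.
  - intros. specialize (BM (rad r) y z (Hr r)). lra.
Qed.

(** By the chain rule d/dr is d/drho divided by 2 rho. The divisor is at least 2 sqrt a, so the
    quotient is a product of bounded Lipschitz functions. *)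
Lemma radial_quotient_regular F : cyl_analytic rho0 tau F -> exists K, 0 <= K /\
  Lip3 K (fun r y z => F (rad r) y z / (2 * rad r)) /\ (forall r y z, Rabs (F (rad r) y z / (2 * rad r)) <= K).
Proof.
  intros HF. destruct (radial_field_regular F HF) as (K & HK & LK & BK).
  pose proof (sqrt_lt_R0 a Ha) as Hsa. assert (Hia : 0 < / sqrt a) by (apply Rinv_0_lt_compat; auto).
  assert (Bi : forall r, 0 <= / (2 * rad r) <= / sqrt a).
  { intros r. pose proof (rad_between r). pose proof (rad_pos r). split.
    - apply Rlt_le, Rinv_0_lt_compat; lra.
    - apply Rinv_le_contravar; lra. }
  assert (Li : forall r r', Rabs (/ (2 * rad r) - / (2 * rad r')) <= / sqrt a * / sqrt a * (/ sqrt a * Rabs (r - r'))).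
  { intros r r'. pose proof (rad_pos r). pose proof (rad_pos r').
    replace (/ (2 * rad r) - / (2 * rad r')) with (/ (2 * rad r) * / (2 * rad r') * (2 * (rad r' - rad r)))
      by (field; lra).
    rewrite !Rabs_mult, (Rabs_right (/ (2 * rad r))), (Rabs_right (/ (2 * rad r'))), (Rabs_right 2)
      by (try apply Rle_ge, Bi; lra).
    pose proof (rad_lipschitz r r') as RL. rewrite Rabs_minus_sym in RL.
    assert (/ (2 * rad r) * / (2 * rad r') * 2 <= / sqrt a * / sqrt a).
    { replace (/ (2 * rad r) * / (2 * rad r') * 2) with (/ (2 * rad r) * / rad r') by (field; lra).
      apply Rmult_le_compat; try apply Bi; [apply Rlt_le, Rinv_0_lt_compat; lra|].
      apply Rinv_le_contravar; [lra|apply rad_between]. }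
    rewrite <- Rmult_assoc. apply Rmult_le_compat; auto using Rabs_pos.
    apply Rmult_le_pos; [apply Rmult_le_pos; apply Bi|lra]. }
  set (i3 := / sqrt a * / sqrt a * / sqrt a).
  assert (Hi3 : 0 <= i3) by (unfold i3; apply Rmult_le_pos; [apply Rmult_le_pos|]; lra).
  exists (K * / sqrt a + K * i3).
  assert (0 <= K * / sqrt a) by (apply Rmult_le_pos; lra).
  assert (0 <= K * i3) by (apply Rmult_le_pos; lra).
  split; [lra|]. split.
  - intros x y z x' y' z'. unfold Rdiv.
    replace (F (rad x) y z * / (2 * rad x) - F (rad x') y' z' * / (2 * rad x')) with
     ((F (rad x) y z - F (rad x') y' z') * / (2 * rad x) + F (rad x') y' z' * (/ (2 * rad x) - / (2 * rad x'))) by ring.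
    eapply Rle_trans; [apply Rabs_triang|]. rewrite !Rabs_mult, (Rabs_right (/ (2 * rad x))) by apply Rle_ge, Bi.
    specialize (LK x y z x' y' z'). cbv beta in LK. specialize (Li x x').
    pose proof (Rabs_pos (x - x')). pose proof (Rabs_pos (y - y')). pose proof (Rabs_pos (z - z')).
    set (S := Rabs (x - x') + Rabs (y - y') + Rabs (z - z')) in *.
    assert (A1 : Rabs (F (rad x) y z - F (rad x') y' z') * / (2 * rad x) <= K * S * / sqrt a).
    { apply Rmult_le_compat; auto using Rabs_pos; apply Bi. }
    assert (A2 : Rabs (F (rad x') y' z') * Rabs (/ (2 * rad x) - / (2 * rad x')) <= K * (i3 * Rabs (x - x'))).
    { apply Rmult_le_compat; auto using Rabs_pos. unfold i3. rewrite !Rmult_assoc in *. exact Li. }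
    assert (A3 : K * (i3 * Rabs (x - x')) <= K * (i3 * S)).
    { apply Rmult_le_compat_l; auto. apply Rmult_le_compat_l; auto. unfold S; lra. }
    lra.
  - intros r y z. unfold Rdiv. rewrite Rabs_mult, (Rabs_right (/ (2 * rad r))) by apply Rle_ge, Bi.
    assert (Rabs (F (rad r) y z) * / (2 * rad r) <= K * / sqrt a).
    { apply Rmult_le_compat; auto using Rabs_pos; apply Bi. }
    lra.
Qed.

Lemma is_derive_radial F r y z : cyl_analytic rho0 tau F -> a < r < b ->
  is_derive (fun r => F (rad r) y z) r (Dx F (rad r) y z / (2 * rad r)).
Proof.
  intros HF Hr. apply is_derive_ext_loc with (fun r => F (sqrt r) y z).
  { assert (Hd : 0 < Rmin (r - a) (b - r)) by (apply Rmin_pos; lra).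
    exists (mkposreal _ Hd). intros u Hu. change (Rabs (u - r) < Rmin (r - a) (b - r)) in Hu.
    pose proof (Rmin_l (r - a) (b - r)). pose proof (Rmin_r (r - a) (b - r)).
    apply Rabs_lt_between in Hu. unfold rad. rewrite clamp_id by lra. reflexivity. }
  assert (E : rad r = sqrt r) by (unfold rad; rewrite clamp_id by lra; reflexivity). rewrite E.
  pose proof (sqrt_lt_R0 r ltac:(lra)).
  assert (sqrt r <= sqrt b) by (apply sqrt_le_1_alt; lra).
  evar_last.
  - apply (is_derive_comp (fun x => F x y z) sqrt).
    + apply (is_derive_Dx rho0 tau); auto. lra.
    + apply is_derive_sqrt; [apply is_derive_id|lra].
  - unfold scal; simpl; unfold mult, one; simpl. field. lra.
Qed.

(** The value agrees with that of [is_derive_radial] for [Dy G]: equality of mixed derivatives is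
    the zero divergence of the Hamiltonian field, required in the form of a common [W]. *)
Lemma is_derive_angular G r y z : cyl_analytic rho0 tau G ->
  is_derive (fun y => Dx G (rad r) y z / (2 * rad r)) y (Dx (Dy G) (rad r) y z / (2 * rad r)).
Proof.
  intros HG. pose proof (rad_between r). pose proof (rad_pos r).
  rewrite (Dx_Dy rho0 tau) by (auto; lra). unfold Rdiv.
  apply is_derive_ext with (fun y => / (2 * rad r) * Dx G (rad r) y z); [intros; apply Rmult_comm|].
  rewrite (Rmult_comm (Dy _ _ _ _)). apply is_derive_scal. apply (is_derive_Dy rho0 tau); [now apply cyl_analytic_Dx|lra].
Qed.

End ClampedFields.

(** * A Lipschitz test function, periodic in the angle *)

Lemma Rmax0_lipschitz x y : Rabs (Rmax 0 x - Rmax 0 y) <= Rabs (x - y).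
Proof. unfold Rmax. repeat destruct Rle_dec; unfold Rabs; repeat destruct Rcase_abs; lra. Qed.

Lemma cos_periodic x : cos (x + 2 * PI) = cos x.
Proof. rewrite cos_plus, cos_2PI, sin_2PI. ring. Qed.

(** Reduce s modulo 2 pi to [-pi, pi]; there the cosine is a decreasing function of the absolute
    value. *)
Lemma cos_gt_near s nu : 0 < nu < PI -> cos nu < cos s ->
  exists k : Z, Rabs (s - IZR k * (2 * PI)) < nu.
Proof.
  intros Hnu Hc. destruct (periodic_reduce (2 * PI) (s + PI)) as (k & x & Hx & E); [lra|].
  exists k. assert (Es : s - IZR k * (2 * PI) = x - PI) by lra. rewrite Es.
  assert (Ec : cos (Rabs (x - PI)) = cos s).
  { assert (Ea : cos (Rabs (x - PI)) = cos (x - PI)).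
    { unfold Rabs; destruct Rcase_abs; [apply cos_neg|reflexivity]. }
    rewrite Ea, <- Es.
    rewrite <- (periodic_Z cos (2 * PI) cos_periodic k (s - IZR k * (2 * PI))). f_equal; ring. }
  assert (Rabs (x - PI) <= PI) by (apply Rabs_le_between; lra).
  apply cos_decreasing_0; try lra. apply Rabs_pos.
Qed.

Section Bump.
Variables (rs bt phi0 nu : R).
Hypotheses (Hbt : 0 < bt) (Hnu : 0 < nu < PI).

Definition tent r := Rmax 0 (bt - Rabs (r - rs)).
(** Truncating a cosine gives a function that is periodic from the start, supported modulo 2 pi in
    an arc of half-width [nu] around [phi0]. *)
Definition arc y := Rmax 0 (cos (y - phi0) - cos nu).
Definition bump r y := tent r * arc y.

Lemma tent_between r : 0 <= tent r <= bt.
Proof.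
  unfold tent. pose proof (Rabs_pos (r - rs)). split; [apply Rmax_l|apply Rmax_lub; lra].
Qed.

Lemma arc_between y : 0 <= arc y <= 2.
Proof.
  unfold arc. pose proof (COS_bound (y - phi0)). pose proof (COS_bound nu).
  split; [apply Rmax_l|apply Rmax_lub; lra].
Qed.

Lemma bump_between r y : 0 <= bump r y <= bt * 2.
Proof.
  pose proof (tent_between r). pose proof (arc_between y). unfold bump. split.
  - apply Rmult_le_pos; lra.
  - apply Rmult_le_compat; lra.
Qed.

Lemma Lip2_tent : Lip2 (fun r _ => tent r).
Proof.
  exists 1. split; [lra|]. intros. unfold tent. eapply Rle_trans; [apply Rmax0_lipschitz|].
  replace (bt - Rabs (x - rs) - (bt - Rabs (x' - rs))) with (- (Rabs (x - rs) - Rabs (x' - rs))) by ring.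
  rewrite Rabs_Ropp. eapply Rle_trans; [apply Rabs_triang_inv2|].
  replace (x - rs - (x' - rs)) with (x - x') by ring. pose proof (Rabs_pos (y - y')). lra.
Qed.

Lemma cos_lipschitz x y : Rabs (cos x - cos y) <= Rabs (x - y).
Proof.
  rewrite <- (Rmult_1_l (Rabs (x - y))). apply (mvt_lipschitz cos (fun t => - sin t)).
  intros t _. split; [apply is_derive_Reals, derivable_pt_lim_cos|].
  apply Rabs_le_between. pose proof (SIN_bound t). lra.
Qed.

Lemma Lip2_arc : Lip2 (fun _ y => arc y).
Proof.
  exists 1. split; [lra|]. intros. unfold arc. eapply Rle_trans; [apply Rmax0_lipschitz|].
  replace (_ - _ - (_ - _)) with (cos (y - phi0) - cos (y' - phi0)) by ring.
  eapply Rle_trans; [apply cos_lipschitz|].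
  replace (y - phi0 - (y' - phi0)) with (y - y') by ring. pose proof (Rabs_pos (x - x')). lra.
Qed.

Lemma Lip2_bump : Lip2 bump.
Proof.
  apply (Lip2_mult (fun r _ => tent r) (fun _ y => arc y)); auto using Lip2_tent, Lip2_arc.
  - exists bt. split; [lra|]. intros. pose proof (tent_between x). rewrite Rabs_right; lra.
  - exists 2. split; [lra|]. intros x y. pose proof (arc_between y). rewrite Rabs_right; lra.
Qed.

Lemma arc_periodic y : arc (y + 2 * PI) = arc y.
Proof.
  unfold arc. replace (y + 2 * PI - phi0) with (y - phi0 + 2 * PI) by ring. now rewrite cos_periodic.
Qed.

Lemma bump_periodic r y : bump r (y + 2 * PI) = bump r y.
Proof. unfold bump. now rewrite arc_periodic. Qed.

Lemma bump_support r y : bump r y <> 0 -> Rabs (r - rs) < bt /\ cos nu < cos (y - phi0).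
Proof.
  intros H. split.
  - destruct (Rlt_le_dec (Rabs (r - rs)) bt) as [|E]; auto. exfalso. apply H. unfold bump, tent.
    rewrite Rmax_left by lra. ring.
  - destruct (Rlt_le_dec (cos nu) (cos (y - phi0))) as [|E]; auto. exfalso. apply H. unfold bump, arc.
    rewrite (Rmax_left 0 (_ - _)) by lra. ring.
Qed.

Lemma Lip1_tent : Lip1 tent.
Proof. exact (Lip2_Lip1_l _ 0 Lip2_tent). Qed.

Lemma Lip1_arc : Lip1 arc.
Proof. exact (Lip2_Lip1_r _ 0 Lip2_arc). Qed.

Lemma RInt_tent_pos : 0 < RInt tent (rs - bt) (rs + bt).
Proof.
  apply RInt_gt_0; [lra| |intros; apply Lip1_continuous, Lip1_tent].
  intros x Hx. unfold tent. apply Rlt_le_trans with (bt - Rabs (x - rs)); [|apply Rmax_r].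
  assert (Rabs (x - rs) < bt) by (apply Rabs_lt_between; lra). lra.
Qed.

Lemma RInt_tent a b : a <= rs - bt -> rs + bt <= b -> RInt tent a b = RInt tent (rs - bt) (rs + bt).
Proof.
  intros Ha Hb. rewrite (RInt_Chasles_R _ a (rs - bt) b), (RInt_Chasles_R _ (rs - bt) (rs + bt) b)
    by apply Lip1_tent.
  rewrite (RInt_ext_R tent (fun _ => 0) a), (RInt_ext_R tent (fun _ => 0) (rs + bt) b).
  - rewrite !RInt_const_R. ring_simplify. reflexivity.
  - intros x Hx. rewrite Rmin_left in Hx by lra. unfold tent. apply Rmax_left.
    pose proof (Rle_abs (x - rs)). lra.
  - intros x Hx. rewrite Rmax_right in Hx by lra. unfold tent. apply Rmax_left.
    pose proof (Rle_abs (- (x - rs))). rewrite Rabs_Ropp in *. lra.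
Qed.

Lemma RInt_arc_pos : 0 < RInt arc 0 (2 * PI).
Proof.
  rewrite <- (RInt_periodic arc (2 * PI) (phi0 - nu) Lip1_arc arc_periodic).
  rewrite (RInt_Chasles_R _ (phi0 - nu) (phi0 + nu)) by apply Lip1_arc.
  assert (0 < RInt arc (phi0 - nu) (phi0 + nu)).
  { apply RInt_gt_0; [lra| |intros; apply Lip1_continuous, Lip1_arc].
    intros x Hx. unfold arc. apply Rlt_le_trans with (cos (x - phi0) - cos nu); [|apply Rmax_r].
    assert (Ea : cos (Rabs (x - phi0)) = cos (x - phi0)).
    { unfold Rabs; destruct Rcase_abs; [apply cos_neg|reflexivity]. }
    assert (Rabs (x - phi0) < nu) by (apply Rabs_lt_between; lra).
    pose proof (Rabs_pos (x - phi0)).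
    assert (cos nu < cos (Rabs (x - phi0))) by (apply cos_decreasing_1; lra). lra. }
  assert (0 <= RInt arc (phi0 + nu) (phi0 - nu + 2 * PI)).
  { apply RInt_ge_0; [lra|apply Lip1_ex_RInt, Lip1_arc|]. intros; apply arc_between. }
  lra.
Qed.

Lemma RInt2_bump a b : a <= rs - bt -> rs + bt <= b ->
  RInt2 bump a b 0 (2 * PI) = RInt tent (rs - bt) (rs + bt) * RInt arc 0 (2 * PI).
Proof.
  intros Ha Hb. unfold RInt2. rewrite <- RInt_scal_R by apply Lip1_ex_RInt, Lip1_arc.
  apply RInt_ext_R. intros y _. rewrite <- (RInt_tent a b) by auto. rewrite Rmult_comm.
  rewrite <- RInt_scal_R by apply Lip1_ex_RInt, Lip1_tent.
  apply RInt_ext_R. intros x _. apply Rmult_comm.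
Qed.

End Bump.

(** * Signs of the vector field in the funnel *)

Section FunnelEstimates.
Variables (p n : nat) (G : R -> R -> R -> R) (rho0 tau : R).
Hypotheses (Hp : (3 <= p)%nat) (Hn : (1 <= n)%nat) (Hrho0 : 0 < rho0) (Htau : 0 < tau).
Hypothesis HG : cyl_analytic rho0 tau G.
Variables psi0 psi1 : R -> R.
Hypotheses (Hpsi0an : analytic1 psi0) (Hpsi1an : analytic1 psi1).
Hypothesis Hexp : exists C r1, 0 < r1 /\ forall r phi t, 0 < r -> r < r1 ->
     Rabs (Ham G r phi t
           - Rpower r (INR p / 2) * psi0 phi
           - Rpower r (INR p / 2 + INR n / 2) * psi1 phi)
       <= C * Rpower r (INR p / 2 + INR n / 2 + 1 / 2).
Variables (phi0 : R) (m : nat).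
Hypotheses (Hmodd : Nat.Odd m)
  (Hvan : forall k, (k < m)%nat -> Derive_n psi0 k phi0 = 0)
  (Hnz : Derive_n psi0 m phi0 <> 0)
  (Hsign : Derive_n psi0 m phi0 * Derive psi1 phi0 > 0).

Let Hp1 : (1 <= p)%nat.
Proof. lia. Qed.

(** The Taylor coefficients of order 0 and 1 vanish, as p >= 3. Since x^2 = r, this reads |r'| <= C
    r, which prevents orbits from approaching r = 0 faster than exponentially. *)
Lemma Dy_quadratic_bound rho1 : rho1 < rho0 -> exists C, 0 <= C /\
  forall x y z, 0 < x <= rho1 -> Rabs (Dy G x y z) <= C * x ^ 2.
Proof.
  intros H1. destruct (taylor_at_zero rho0 tau Htau (Dy G) 1 rho1) as (K & HK & HT); auto.
  { now apply cyl_analytic_Dy. }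
  exists K. split; auto. intros x y z Hx. specialize (HT x y z Hx).
  rewrite sum_eq_R0, Rminus_0_r in HT; [exact HT|].
  intros k Hk.
  rewrite (taylor_coefs_Dy p n G rho0 tau Hp1 Hn Hrho0 Htau HG psi0 psi1 Hexp) by lia.
  unfold two_terms.
  replace (Nat.eqb k p) with false by (symmetry; apply Nat.eqb_neq; lia).
  replace (Nat.eqb k (p + n)) with false by (symmetry; apply Nat.eqb_neq; lia).
  unfold Rdiv; ring.
Qed.

(* Both estimates are multiplied by A = psi0^(m)(phi0), so that the two signs of A
   (a funnel for increasing or for decreasing time) are treated at once. *)
Lemma funnel_estimates : exists eta x0 c, 0 < eta < PI /\ 0 < x0 < rho0 /\ 0 < c /\
  forall x s t, 0 < x <= x0 -> Rabs s <= eta ->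
    c * x ^ (p + n) <= Derive_n psi0 m phi0 * Dy G x (phi0 + s) t /\
    (Rabs s = eta -> 0 < Derive_n psi0 m phi0 * (s * Dx G x (phi0 + s) t)).
Proof.
  set (A := Derive_n psi0 m phi0) in *. set (B := A * Derive psi1 phi0) in *.
  destruct (analytic1_odd_zero psi0 phi0 m Hpsi0an Hmodd Hvan Hnz) as [d1 H0].
  destruct (analytic1_Derive_pos psi1 phi0 A Hpsi1an Hsign) as [d2 H1].
  fold A in H0. fold B in H1.
  assert (Hd : 0 < Rmin PI (Rmin d1 d2)).
  { pose proof PI_RGT_0. pose proof (cond_pos d1). pose proof (cond_pos d2).
    repeat apply Rmin_pos; lra. }
  set (eta := Rmin PI (Rmin d1 d2) / 2).
  assert (e0 : eta < PI) by (pose proof (Rmin_l PI (Rmin d1 d2)); unfold eta; lra).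
  assert (e1 : eta < d1).
  { pose proof (Rmin_r PI (Rmin d1 d2)). pose proof (Rmin_l d1 d2). unfold eta; lra. }
  assert (e2 : eta < d2).
  { pose proof (Rmin_r PI (Rmin d1 d2)). pose proof (Rmin_r d1 d2). unfold eta; lra. }
  assert (He : 0 < eta) by (unfold eta; lra). clearbody eta. clear Hd.
  assert (H0' : forall s, Rabs s <= eta -> 0 <= A * Derive psi0 (phi0 + s) /\
     (s <> 0 -> 0 < A * (s * psi0 (phi0 + s)))).
  { intros s Hs. apply H0. change (Rabs (s - 0) < d1). rewrite Rminus_0_r. lra. }
  assert (H1' : forall s, Rabs s <= eta -> B / 2 < A * Derive psi1 (phi0 + s)).
  { intros s Hs. apply H1. change (Rabs (s - 0) < d2). rewrite Rminus_0_r. lra. }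
  clear H0 H1.
  destruct (Dy_expansion p n G rho0 tau Hp1 Hn Hrho0 Htau HG psi0 psi1 Hexp (rho0 / 2) ltac:(lra)) as (K & HK & EK).
  destruct (Dx_expansion p n G rho0 tau Hp1 Hn Hrho0 Htau HG psi0 psi1 Hexp (rho0 / 2) ltac:(lra)) as (L & HL & EL).
  assert (R1 : Rabs eta <= eta) by (rewrite Rabs_right; lra).
  assert (R2 : Rabs (- eta) <= eta) by (rewrite Rabs_Ropp; lra).
  pose proof (proj2 (H0' eta R1) ltac:(lra)) as D1.
  pose proof (proj2 (H0' (- eta) R2) ltac:(lra)) as D2.
  (* The angular estimate is needed only at |s| = eta, that is, at two points; [dl] is the smaller
     of the two values. *)
  set (dl := Rmin (A * (eta * psi0 (phi0 + eta))) (A * (- eta * psi0 (phi0 + - eta)))).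
  assert (Hdl : 0 < dl) by (now apply Rmin_pos).
  assert (HA : 0 <= Rabs A) by apply Rabs_pos.
  assert (HAK : 0 <= Rabs A * K) by now apply Rmult_le_pos.
  assert (HAL : 0 <= Rabs A * eta * L) by (apply Rmult_le_pos; auto; apply Rmult_le_pos; lra).
  (* The second bound makes the radial remainder at most B / 4, half of the lower bound B / 2 on A
     psi1', leaving c = B / 4; the third limits the angular remainder to half of [dl]. Adding 1
     keeps the denominators positive. *)
  set (x0 := Rmin (rho0 / 2) (Rmin (B / 4 / (Rabs A * K + 1)) (dl / 2 / (Rabs A * eta * L + 1)))).
  assert (Hx0 : 0 < x0).
  { unfold x0. apply Rmin_pos; [lra|]. apply Rmin_pos; apply Rdiv_lt_0_compat; lra. }
  assert (x01 : x0 <= rho0 / 2) by apply Rmin_l.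
  assert (x02 : x0 * (Rabs A * K + 1) <= B / 4).
  { apply Rle_trans with (B / 4 / (Rabs A * K + 1) * (Rabs A * K + 1)); [|right; field; lra].
    apply Rmult_le_compat_r; [lra|]. eapply Rle_trans; [apply Rmin_r|apply Rmin_l]. }
  assert (x03 : x0 * (Rabs A * eta * L + 1) <= dl / 2).
  { apply Rle_trans with (dl / 2 / (Rabs A * eta * L + 1) * (Rabs A * eta * L + 1)); [|right; field; lra].
    apply Rmult_le_compat_r; [lra|]. eapply Rle_trans; [apply Rmin_r|apply Rmin_r]. }
  clearbody x0.
  exists eta, x0, (B / 4). repeat split; auto; try lra.
  { specialize (EK x (phi0 + s) t ltac:(lra)). destruct (H0' s) as [P0 _]; auto.
    specialize (H1' s ltac:(auto)). pose proof (pow_lt x p ltac:(lra)). pose proof (pow_lt x (p + n) ltac:(lra)) as Hpn.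
    set (E := Dy G x (phi0 + s) t - x ^ p * Derive psi0 (phi0 + s) - x ^ (p + n) * Derive psi1 (phi0 + s)) in EK.
    replace (Dy G x (phi0 + s) t) with (x ^ p * Derive psi0 (phi0 + s) + x ^ (p + n) * Derive psi1 (phi0 + s) + E)
      by (unfold E; ring).
    assert (HE : Rabs (A * E) <= x ^ (p + n) * (B / 4)).
    { rewrite Rabs_mult. apply Rle_trans with (Rabs A * (K * x ^ S (p + n))).
      - apply Rmult_le_compat_l; auto.
      - replace (Rabs A * (K * x ^ S (p + n))) with (x ^ (p + n) * (x * (Rabs A * K))) by (simpl; ring).
        apply Rmult_le_compat_l; [lra|]. nra. }
    apply Rabs_le_between in HE.
    assert (0 <= x ^ p * (A * Derive psi0 (phi0 + s))) by (apply Rmult_le_pos; lra).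
    assert (x ^ (p + n) * (B / 2) <= x ^ (p + n) * (A * Derive psi1 (phi0 + s))) by (apply Rmult_le_compat_l; lra).
    lra. }
  intros Hse. specialize (EL x (phi0 + s) t ltac:(lra)).
  assert (Ds : dl <= A * (s * psi0 (phi0 + s))).
  { unfold dl. unfold Rabs in Hse. destruct Rcase_abs.
    - replace s with (- eta) by lra. apply Rmin_r.
    - subst s. apply Rmin_l. }
  set (E := Dx G x (phi0 + s) t - INR p * x ^ (p - 1) * psi0 (phi0 + s)) in EL.
  replace (Dx G x (phi0 + s) t) with (INR p * x ^ (p - 1) * psi0 (phi0 + s) + E) by (unfold E; ring).
  pose proof (pow_lt x (p - 1) ltac:(lra)) as Hpx.
  assert (Hx : x ^ p = x * x ^ (p - 1)) by (replace p with (S (p - 1)) at 1 by lia; reflexivity).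
  assert (HE : Rabs (A * (s * E)) <= x ^ (p - 1) * (dl / 2)).
  { rewrite !Rabs_mult, Hse. apply Rle_trans with (Rabs A * (eta * (L * x ^ p))).
    - apply Rmult_le_compat_l; auto. apply Rmult_le_compat_l; lra.
    - rewrite Hx. replace (Rabs A * (eta * (L * (x * x ^ (p - 1))))) with (x ^ (p - 1) * (x * (Rabs A * eta * L))) by ring.
      apply Rmult_le_compat_l; [lra|]. nra. }
  apply Rabs_le_between in HE.
  assert (1 <= INR p) by (change 1 with (INR 1); apply le_INR; lia).
  assert (x ^ (p - 1) * dl <= INR p * x ^ (p - 1) * (A * (s * psi0 (phi0 + s)))).
  { apply Rle_trans with (1 * x ^ (p - 1) * dl); [lra|]. apply Rmult_le_compat; try lra.
    apply Rmult_le_compat_r; lra. }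
  assert (0 < x ^ (p - 1) * dl) by now apply Rmult_lt_0_compat.
  lra.
Qed.

End FunnelEstimates.

(** * Instability *)

Lemma is_derive_minus_const (f : R -> R) k x l :
  is_derive f x l -> is_derive (fun t => f t - k) x l.
Proof.
  intros D. auto_derive; [now exists l|]. change (fun x0 : R => f x0) with f.
  rewrite (is_derive_unique _ _ _ D). ring.
Qed.

Lemma solution_derivatives G rho0 tau T r phi t : cyl_analytic rho0 tau G ->
  is_solution G T r phi -> 0 <= t -> Rbar_lt t T -> sqrt (r t) < rho0 ->
  is_derive r t (- Dy G (sqrt (r t)) (phi t) t) /\
  is_derive phi t (Dx G (sqrt (r t)) (phi t) t / (2 * sqrt (r t))).
Proof.
  intros HG Hs Ht HT Hr. destruct (Hs t Ht HT) as (Hp & D1 & D2). split; [exact D2|].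
  pose proof (sqrt_lt_R0 (r t) Hp).
  replace (Dx G (sqrt (r t)) (phi t) t / (2 * sqrt (r t))) with (Derive (fun x => Ham G x (phi t) t) (r t));
    [exact D1|].
  apply is_derive_unique. unfold Ham. evar_last.
  - apply (is_derive_comp (fun x => G x (phi t) t) sqrt).
    + apply (is_derive_Dx rho0 tau); auto. lra.
    + apply is_derive_sqrt; [apply is_derive_id|lra].
  - unfold scal; simpl; unfold mult, one; simpl. field. lra.
Qed.

(** [sgn] is the sign of A and [th] the physical time: sgn = -1 with th t = t covers forward time,
    sgn = 1 with th t = t1 - t the reversed orbit. As r never falls below r1, the climbing rate at
    height r1 holds throughout. *)
Lemma funnel_climb G A sgn eta x0 c q phi0 (r s th : R -> R) T r1 :
  sgn * A = Rabs A -> A <> 0 -> 0 < c -> 0 < x0 ->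
  (forall x s t, 0 < x <= x0 -> Rabs s <= eta ->
    c * x ^ q <= A * Dy G x (phi0 + s) t /\
    (Rabs s = eta -> 0 < A * (s * Dx G x (phi0 + s) t))) ->
  0 <= T -> 0 < r1 -> r1 <= r 0 -> Rabs (s 0) < eta ->
  (forall t, 0 <= t <= T -> 0 < r t <= x0 ^ 2 /\
     is_derive r t (sgn * Dy G (sqrt (r t)) (phi0 + s t) (th t)) /\
     is_derive s t (- sgn * (Dx G (sqrt (r t)) (phi0 + s t) (th t) / (2 * sqrt (r t))))) ->
  r1 + c / Rabs A * sqrt r1 ^ q * T <= r T.
Proof.
  intros Hsg HA Hc Hx0 Hest HT Hr1 Hr0 Hs0 Hd.
  pose proof (Rabs_pos_lt A HA) as HA'.
  assert (Hx : forall t, 0 <= t <= T -> 0 < sqrt (r t) <= x0).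
  { intros t Ht. destruct (Hd t Ht) as [[H1 H2] _]. split; [now apply sqrt_lt_R0|].
    rewrite <- (sqrt_pow2 x0) by lra. now apply sqrt_le_1_alt. }
  apply (funnel r s (fun t => sgn * Dy G (sqrt (r t)) (phi0 + s t) (th t))
    (fun t => - sgn * (Dx G (sqrt (r t)) (phi0 + s t) (th t) / (2 * sqrt (r t)))) T eta); auto.
  - intros t Ht. split; apply Hd; auto.
  - intros t Ht Hs. specialize (Hx t Ht). destruct (Hest (sqrt (r t)) (s t) (th t) Hx ltac:(lra)) as [_ H].
    specialize (H Hs). set (X := Dx G _ _ _) in *.
    apply Rmult_lt_reg_l with (Rabs A); auto. rewrite Rmult_0_r.
    assert (HsA : sgn * Rabs A = A).
    { assert (Hsq : Rabs A * Rabs A = A * A) by (rewrite <- Rabs_mult; apply Rabs_right; nra).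
      apply Rmult_eq_reg_l with A; auto. rewrite <- Hsq.
      rewrite <- Hsg at 2. ring. }
    replace (Rabs A * (s t * (- sgn * (X / (2 * sqrt (r t)))))) with
      (- ((sgn * Rabs A) * (s t * X) / (2 * sqrt (r t)))) by (field; lra).
    rewrite HsA. assert (0 < A * (s t * X) / (2 * sqrt (r t))) by (apply Rdiv_lt_0_compat; lra). lra.
  - intros t Ht Hs. specialize (Hx t Ht). destruct (Hest (sqrt (r t)) (s t) (th t) Hx Hs) as [H _].
    set (Y := Dy G _ _ _) in *.
    assert (HsA : sgn * Rabs A = A).
    { assert (Hsq : Rabs A * Rabs A = A * A) by (rewrite <- Rabs_mult; apply Rabs_right; nra).
      apply Rmult_eq_reg_l with A; auto. rewrite <- Hsq.
      rewrite <- Hsg at 2. ring. }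
    assert (Hlow : c / Rabs A * sqrt (r t) ^ q <= sgn * Y).
    { apply Rmult_le_reg_l with (Rabs A); auto.
      replace (Rabs A * (c / Rabs A * sqrt (r t) ^ q)) with (c * sqrt (r t) ^ q) by (field; lra).
      replace (Rabs A * (sgn * Y)) with ((sgn * Rabs A) * Y) by ring. rewrite HsA. exact H. }
    assert (0 < c / Rabs A) by (apply Rdiv_lt_0_compat; lra).
    pose proof (pow_lt (sqrt (r t)) q ltac:(lra)). split.
    + eapply Rle_trans; [|exact Hlow]. apply Rmult_le_pos; lra.
    + intros Hr. eapply Rle_trans; [|exact Hlow]. apply Rmult_le_compat_l; [lra|].
      apply pow_incr. split; [apply sqrt_pos|now apply sqrt_le_1_alt].
Qed.

Lemma exponential_lower_bound (r dr : R -> R) C T : 0 <= C -> 0 <= T ->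
  (forall t, 0 <= t <= T -> is_derive r t (dr t) /\ - C * r t <= dr t) ->
  0 <= r 0 -> r 0 * exp (- C * T) <= r T.
Proof.
  intros HC HT H Hr0.
  pose proof (increment_ge (fun t => r t * exp (C * t)) (fun t => (dr t + C * r t) * exp (C * t)) 0 T 0 HT) as HI.
  cbv beta in HI. rewrite Rmult_0_r, exp_0, Rmult_1_r, Rmult_0_l in HI.
  assert (Hg : 0 <= r T * exp (C * T) - r 0).
  { apply HI.
    - intros t Ht. destruct (H t Ht) as [D _]. auto_derive; [repeat split; now exists (dr t)|].
      change (fun x : R => r x) with r. rewrite (is_derive_unique _ _ _ D). ring.
    - intros t Ht. destruct (H t Ht) as [_ D]. apply Rmult_le_pos; [lra|apply Rlt_le, exp_pos]. }
  replace (- C * T) with (- (C * T)) by ring. rewrite exp_Ropp.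
  pose proof (exp_pos (C * T)). apply Rmult_le_reg_r with (exp (C * T)); auto.
  rewrite Rmult_assoc, Rinv_l by lra. lra.
Qed.

Section Instability.
Variables (G : R -> R -> R -> R) (rho0 tau A eta x0 c phi0 C : R) (q : nat).
Hypothesis Htau : 0 < tau.
Hypothesis HG : cyl_analytic rho0 tau G.
Hypotheses (HA : A <> 0) (Heta : 0 < eta < PI) (Hx0 : 0 < x0 < rho0) (Hc : 0 < c) (HC : 0 <= C).
Hypothesis Hest : forall x s t, 0 < x <= x0 -> Rabs s <= eta ->
    c * x ^ q <= A * Dy G x (phi0 + s) t /\
    (Rabs s = eta -> 0 < A * (s * Dx G x (phi0 + s) t)).
Hypothesis HDy : forall x y z, 0 < x <= x0 -> Rabs (Dy G x y z) <= C * x ^ 2.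
Hypothesis Hstab : lyapunov_stable G.

Lemma stable_solutions eps : 0 < eps <= x0 ^ 2 -> exists delta, 0 < delta /\
  forall r0 y0, 0 < r0 -> r0 < delta -> exists r phi, r 0 = r0 /\ phi 0 = y0 /\
    forall t, 0 <= t -> 0 < r t < eps /\ 0 < sqrt (r t) <= x0 /\
      is_derive r t (- Dy G (sqrt (r t)) (phi t) t) /\
      is_derive phi t (Dx G (sqrt (r t)) (phi t) t / (2 * sqrt (r t))).
Proof.
  intros He. destruct (Hstab eps) as (delta & Hd & H); [lra|].
  exists delta. split; auto. intros r0 y0 H0 H1.
  destruct (H r0 y0 H0 H1) as [(r & phi & E1 & E2 & Hsol) Hb]. exists r, phi. split; auto. split; auto.
  intros t Ht. destruct (Hsol t Ht I) as (Hp & _).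
  pose proof (Hb p_infty r phi E1 E2 Hsol t Ht I) as Hlt.
  assert (Hsq : 0 < sqrt (r t) <= x0).
  { split; [now apply sqrt_lt_R0|]. rewrite <- (sqrt_pow2 x0) by lra. apply sqrt_le_1_alt; lra. }
  split; [lra|]. split; [lra|]. apply (solution_derivatives G rho0 tau p_infty); auto; [exact I|lra].
Qed.

(** After k periods the guaranteed climb from height r1 exceeds x0^2, the top of the region where
    the estimates hold. A whole number of periods suits the scheme. *)
Lemma exists_climb_time r1 : 0 < r1 -> exists k, (1 <= k)%nat /\
  x0 ^ 2 < c / Rabs A * sqrt r1 ^ q * (INR k * tau).
Proof.
  intros Hr1. pose proof (Rabs_pos_lt A HA).
  assert (Hp : 0 < c / Rabs A * sqrt r1 ^ q * tau).
  { repeat apply Rmult_lt_0_compat; auto; [now apply Rinv_0_lt_compat|]. now apply pow_lt, sqrt_lt_R0. }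
  destruct (INR_archimed _ (x0 ^ 2) Hp) as [k Hk]. exists k. split.
  - destruct k; [simpl INR in Hk; pose proof (pow2_ge_0 x0); lra|lia].
  - lra.
Qed.

Lemma forward_instability : A < 0 -> False.
Proof.
  intros HAneg. pose proof (pow_lt x0 2 ltac:(lra)) as Hx2.
  destruct (stable_solutions (x0 ^ 2)) as (delta & Hd & H); [lra|].
  destruct (H (delta / 2) phi0 ltac:(lra) ltac:(lra)) as (r & phi & E1 & E2 & Hs).
  destruct (exists_climb_time (delta / 2) ltac:(lra)) as (k & _ & Hk).
  assert (HT : 0 <= INR k * tau) by (apply Rmult_le_pos; [apply pos_INR|lra]).
  pose proof (funnel_climb G A (-1) eta x0 c q phi0 r (fun t => phi t - phi0) (fun t => t) (INR k * tau) (delta / 2)) as F.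
  destruct (Hs _ HT) as (Hr & _).
  assert (delta / 2 + c / Rabs A * sqrt (delta / 2) ^ q * (INR k * tau) <= r (INR k * tau)); [|lra].
  apply F; auto; try lra.
  - rewrite Rabs_left; lra.
  - rewrite E2, Rminus_diag, Rabs_R0. lra.
  - intros t Ht. destruct (Hs t ltac:(lra)) as (Hr' & _ & D1 & D2). split; [lra|].
    replace (phi0 + (phi t - phi0)) with (phi t) by ring. split.
    + replace (-1 * _) with (- Dy G (sqrt (r t)) (phi t) t) by ring. exact D1.
    + apply is_derive_minus_const.
      replace (- -1 * _) with (Dx G (sqrt (r t)) (phi t) t / (2 * sqrt (r t))) by ring. exact D2.
Qed.

Lemma backward_instability : 0 < A -> False.
Proof.
  intros HApos. pose proof (pow_lt x0 2 ltac:(lra)) as Hx2.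
  (* This leaves room above the orbits for b = 2 eps and b0 = 4 eps, with sqrt b0 still at most
     x0. *)
  set (eps := x0 ^ 2 / 8).
  destruct (stable_solutions eps) as (delta0 & Hd0 & H0); [unfold eps; lra|].
  set (delta := Rmin delta0 eps).
  assert (Hd : 0 < delta) by (apply Rmin_pos; unfold eps; lra).
  assert (Hdd : delta <= delta0) by apply Rmin_l. assert (Hde : delta <= eps) by apply Rmin_r.
  clearbody delta.
  (* The tent occupies delta / 4 < r < 3 delta / 4. An orbit within [sg] <= delta / 16 of it is
     still above delta / 8, the height for which the climbing time k is chosen. *)
  set (rs := delta / 2). set (bt := delta / 4). set (nu := eta / 2).
  destruct (exists_climb_time (delta / 8) ltac:(lra)) as (k & Hk1 & Hk).
  assert (Hnu : 0 < nu < PI) by (unfold nu; lra).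
  assert (Hbt : 0 < bt) by (unfold bt; lra).
  set (I0 := RInt (tent rs bt) (rs - bt) (rs + bt) * RInt (arc phi0 nu) 0 (2 * PI)).
  assert (HI0 : 0 < I0) by (apply Rmult_lt_0_compat; [now apply RInt_tent_pos|now apply RInt_arc_pos]).
  (* The width b - a is bounded by 2 eps, independently of a: the inner radius a is fixed later and
     depends on T, hence on J. *)
  destruct (INR_archimed (I0 / 2) (2 * PI * (2 * eps * (bt * 2))) ltac:(lra)) as [J HJ].
  set (T := INR J * (INR k * tau)).
  assert (Hkt : 0 <= INR k * tau) by (apply Rmult_le_pos; [apply pos_INR|lra]).
  assert (HT : 0 <= T) by (apply Rmult_le_pos; [apply pos_INR|lra]).
  (* Up to time T no orbit starting above delta / 4 gets below this height, by |r'| <= C r. *)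
  set (a1 := delta / 4 * exp (- C * T)).
  assert (Ha1 : 0 < a1) by (apply Rmult_lt_0_compat; [lra|apply exp_pos]).
  assert (Ha1d : a1 <= delta / 4).
  { unfold a1. rewrite <- (Rmult_1_r (delta / 4)) at 2. apply Rmult_le_compat_l; [lra|].
    rewrite <- exp_0. assert (0 <= C * T) by now apply Rmult_le_pos.
    destruct (Req_dec (C * T) 0) as [E|E].
    - replace (- C * T) with 0 by lra. lra.
    - left. apply exp_increasing. lra. }
  assert (Hepsd : eps = x0 ^ 2 / 8) by reflexivity.
  (* With a0 < a < b < b0, the derivative in r, required on the closed interval [a, b], is taken
     where the clamp is the identity. *)
  set (a := a1 / 2). set (b := 2 * eps). set (a0 := a / 2). set (b0 := 4 * eps).
  assert (Hb0 : sqrt b0 < rho0).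
  { apply Rle_lt_trans with x0; [|lra]. rewrite <- (sqrt_pow2 x0) by lra.
    apply sqrt_le_1_alt. unfold b0; lra. }
  assert (Ha : a = a1 / 2) by reflexivity. assert (Hb : b = 2 * eps) by reflexivity.
  assert (Ha0 : 0 < a0 < a) by (unfold a0; lra). assert (Hbb : b < b0) by (unfold b0; lra).
  clearbody a b a0 b0. destruct Ha0 as [Ha0 Haa].
  assert (Ha0b0 : a0 <= b0) by lra.
  destruct (radial_field_regular rho0 tau a0 b0 Htau Ha0 Ha0b0 Hb0 (Dy G)) as (K1 & HK1 & LU & BU);
    [now apply cyl_analytic_Dy|].
  destruct (radial_quotient_regular rho0 tau a0 b0 Htau Ha0 Ha0b0 Hb0 (Dx G)) as (K2 & HK2 & LV & BV);
    [now apply cyl_analytic_Dx|].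
  destruct (radial_quotient_regular rho0 tau a0 b0 Htau Ha0 Ha0b0 Hb0 (Dx (Dy G))) as (K3 & HK3 & LW & BW);
    [now apply cyl_analytic_Dx, cyl_analytic_Dy|].
  set (U := fun r y z => Dy G (rad a0 b0 r) y z) in *.
  set (V := fun r y z => Dx G (rad a0 b0 r) y z / (2 * rad a0 b0 r)) in *.
  set (W := fun r y z => Dx (Dy G) (rad a0 b0 r) y z / (2 * rad a0 b0 r)) in *.
  (* Then a + 2 sg <= a1 lies below all orbits, and nu + sg < eta keeps points near the support
     inside the funnel. *)
  set (sg := Rmin (a1 / 4) (eta / 4)).
  assert (Hsg : 0 < sg) by (apply Rmin_pos; lra).
  assert (Hsg1 : sg <= a1 / 4) by apply Rmin_l. assert (Hsg2 : sg <= eta / 4) by apply Rmin_r.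
  clearbody sg.
  assert (Hrad : forall r, a + 2 * sg <= r <= b - 2 * sg -> rad a0 b0 r = sqrt r).
  { intros r Hr. unfold rad. rewrite clamp_id; [reflexivity|]. lra. }
  pose proof (cyl_analytic_Dx _ _ _ HG) as HGx. pose proof (cyl_analytic_Dy _ _ _ HG) as HGy.
  destruct HGx as (_ & Px & Tx). destruct HGy as (_ & Py & Ty).
  assert (HII : RInt2 (bump rs bt phi0 nu) a b 0 (2 * PI) = I0).
  { apply RInt2_bump; unfold rs, bt; lra. }
  apply (wandering_contradiction U V W (K1 + K2 + K3) a b (2 * PI) tau) with
    (f := bump rs bt phi0 nu) (M := bt * 2) (sg := sg) (T := T) (J := J) (k := k); auto.
  - lra.
  - lra.
  - pose proof PI_RGT_0; lra.
  - apply Lip3_mono with K1; [lra|exact LU].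
  - apply Lip3_mono with K2; [lra|exact LV].
  - apply Lip3_mono with K3; [lra|exact LW].
  - intros x y z. specialize (BU x y z). unfold U. lra.
  - intros x y z. specialize (BV x y z). unfold V. lra.
  - intros x y z. specialize (BW x y z). unfold W. lra.
  - intros x y z Hx. apply (is_derive_radial rho0 tau a0 b0 Ha0 Hb0 (Dy G)).
    + now apply cyl_analytic_Dy.
    + lra.
  - intros x y z. now apply (is_derive_angular rho0 tau a0 b0 Ha0 Ha0b0 Hb0).
  - intros; unfold U; apply Py.
  - intros; unfold V; now rewrite Px.
  - intros; unfold U; apply Ty.
  - intros; unfold V; now rewrite Tx.
  - lra.
  - now apply Lip2_bump.
  - intros; now apply bump_between.
  - intros; apply bump_periodic.
  - rewrite HII; exact HI0.
  - rewrite HII. rewrite S_INR.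
    assert (2 * PI * ((b - a) * (bt * 2)) <= 2 * PI * (2 * eps * (bt * 2))).
    { apply Rmult_le_compat_l; [pose proof PI_RGT_0; lra|]. apply Rmult_le_compat_r; [lra|].
      lra. }
    lra.
  - intros x y Hf. destruct (bump_support _ _ _ _ _ _ Hf) as [Hx _].
    apply Rabs_lt_between in Hx. unfold rs, bt in Hx.
    destruct (H0 x y ltac:(lra) ltac:(lra)) as (r & phi & E1 & E2 & Hs).
    exists r, phi. split; auto. split; auto. intros t Ht.
    destruct (Hs t ltac:(lra)) as (Hr & Hsq & D1 & D2).
    assert (Hlow : a1 <= r t).
    { pose proof (exponential_lower_bound r (fun t => - Dy G (sqrt (r t)) (phi t) t) C t HC ltac:(lra)) as HL.
      apply Rle_trans with (r 0 * exp (- C * t)); [|apply HL; [|lra]].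
      - unfold a1. apply Rmult_le_compat; [lra|apply Rlt_le, exp_pos|lra|].
        assert (Hct : - C * T <= - C * t) by nra.
        destruct Hct as [Hct|Hct]; [left; now apply exp_increasing|right; now rewrite Hct].
      - intros u Hu. destruct (Hs u ltac:(lra)) as (Hr' & Hsq' & D1' & _). split; [exact D1'|].
        specialize (HDy (sqrt (r u)) (phi u) u Hsq'). rewrite pow2_sqrt in HDy by lra.
        apply Rabs_le_between in HDy. lra. }
    assert (Hin : a + 2 * sg <= r t <= b - 2 * sg) by (lra).
    split; [exact Hin|]. unfold U, V. rewrite (Hrad _ Hin). split; [exact D1|exact D2].
  - intros xr xy l x y Ho Hf Hl Hfx.
    (* An orbit that came back near the support at t1 would, followed backward, climb the funnel for
       at least k periods. At time 0 it would be above x0^2, whereas every orbit stays below b =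
       x0^2 / 4. *)
    destruct (Rlt_le_dec sg (dist1 xr xy (x, y) (INR l * (INR k * tau)))) as [|Hle]; auto. exfalso.
    set (t1 := INR l * (INR k * tau)) in *.
    assert (Ht1 : INR k * tau <= t1 <= T).
    { assert (1 <= INR l) by (change 1 with (INR 1); apply le_INR; lia).
      assert (INR l <= INR J) by (apply le_INR; lia). unfold t1, T. split.
      - rewrite <- (Rmult_1_l (INR k * tau)) at 1. apply Rmult_le_compat_r; lra.
      - apply Rmult_le_compat_r; lra. }
    unfold dist1 in Hle. cbn [fst snd] in Hle.
    pose proof (Rabs_pos (x - xr t1)). pose proof (Rabs_pos (y - xy t1)).
    destruct (bump_support _ _ _ _ _ _ Hfx) as [Hx Hy].
    (* Angles along orbits are real numbers and the support is periodic, so the orbit may have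
       arrived at the copy of the funnel around phi0 + 2 pi j. *)
    destruct (cos_gt_near _ _ Hnu Hy) as [j Hj].
    assert (Dx1 : Rabs (x - xr t1) <= sg) by lra. assert (Dy1 : Rabs (y - xy t1) <= sg) by lra.
    apply Rabs_lt_between in Hx. apply Rabs_lt_between in Hj.
    apply Rabs_le_between in Dx1. apply Rabs_le_between in Dy1.
    assert (F : delta / 8 + c / Rabs A * sqrt (delta / 8) ^ q * t1 <= xr (t1 - t1)).
    { apply (funnel_climb G A 1 eta x0 c q phi0 (fun t => xr (t1 - t))
        (fun t => xy (t1 - t) - phi0 - IZR j * (2 * PI)) (fun t => t1 - t)); auto; try lra.
      - rewrite Rabs_right; lra.
      - rewrite Rminus_0_r. unfold rs, bt in *. lra.
      - rewrite Rminus_0_r. apply Rabs_lt_between. unfold nu in *. lra.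
      - intros t Ht. destruct (Ho (t1 - t) ltac:(lra)) as (Hin & D1 & D2).
        unfold U, V in D1, D2. rewrite (Hrad _ Hin) in D1, D2.
        replace (phi0 + (xy (t1 - t) - phi0 - IZR j * (2 * PI))) with (xy (t1 - t) + IZR (- j) * (2 * PI))
          by (rewrite opp_IZR; ring).
        rewrite (periodic_Z (fun y => Dy G _ y _) _ (fun y => Py _ y _)).
        rewrite (periodic_Z (fun y => Dx G _ y _) _ (fun y => Px _ y _)).
        split; [lra|].
        assert (Dt : is_derive (fun t => t1 - t) t (-1)) by (auto_derive; [auto|ring]).
        split.
        + replace (1 * Dy G _ _ _) with (scal (-1) (- Dy G (sqrt (xr (t1 - t))) (xy (t1 - t)) (t1 - t)))
            by (unfold scal; simpl; unfold mult; simpl; ring).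
          apply (is_derive_comp xr (fun t => t1 - t)); auto.
        + set (X := Dx G _ _ _ / _) in *.
          replace (- (1) * X) with (scal (-1) X) by (unfold scal; simpl; unfold mult; simpl; ring).
          do 2 apply is_derive_minus_const.
          apply (is_derive_comp xy (fun t => t1 - t)); auto. }
    rewrite Rminus_diag in F.
    destruct (Ho 0 ltac:(lra)) as [Hin _].
    assert (c / Rabs A * sqrt (delta / 8) ^ q * (INR k * tau) <= c / Rabs A * sqrt (delta / 8) ^ q * t1).
    { apply Rmult_le_compat_l; [|lra]. apply Rmult_le_pos; [|apply pow_le, sqrt_pos].
      apply Rlt_le, Rdiv_lt_0_compat; [lra|]. now apply Rabs_pos_lt. }
    lra.
Qed.

End Instability.

Theorem theorem3p2
  (p n : nat) (Hp : (3 <= p)%nat) (Hn : (1 <= n)%nat)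
  (G : R -> R -> R -> R) (rho0 tau : R) (Hrho0 : 0 < rho0) (Htau : 0 < tau)
  (HGan : analytic3 (fun rho _ _ => -rho0 < rho < rho0) G)
  (HGphi : forall rho phi t, G rho (phi + 2 * PI) t = G rho phi t)
  (HGt : forall rho phi t, G rho phi (t + tau) = G rho phi t)
  (psi0 psi1 : R -> R)
  (Hpsi0an : analytic1 psi0) (Hpsi1an : analytic1 psi1)
  (Hpsi0per : forall phi, psi0 (phi + 2 * PI) = psi0 phi)
  (Hpsi1per : forall phi, psi1 (phi + 2 * PI) = psi1 phi)
  (Hexp : exists C r1, 0 < r1 /\ forall r phi t, 0 < r -> r < r1 ->
     Rabs (Ham G r phi t
           - Rpower r (INR p / 2) * psi0 phi
           - Rpower r (INR p / 2 + INR n / 2) * psi1 phi)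
       <= C * Rpower r (INR p / 2 + INR n / 2 + 1 / 2))
  (phi0 : R) (m : nat) (Hm1 : (1 < m)%nat) (Hmodd : Nat.Odd m)
  (Hvan : forall k, (k < m)%nat -> Derive_n psi0 k phi0 = 0)
  (Hnz : Derive_n psi0 m phi0 <> 0)
  (Hsign : Derive_n psi0 m phi0 * Derive psi1 phi0 > 0) :
  ~ lyapunov_stable G.
Proof.
  intros Hstab.
  pose proof (cyl_analytic_of_analytic3 rho0 tau G HGan HGphi HGt) as HG.
  destruct (funnel_estimates p n G rho0 tau Hp Hn Hrho0 Htau HG psi0 psi1 Hpsi0an Hpsi1an Hexp
    phi0 m Hmodd Hvan Hnz Hsign) as (eta & x0 & c & Heta & Hx0 & Hc & Hest).
  destruct (Dy_quadratic_bound p n G rho0 tau Hp Hn Hrho0 Htau HG psi0 psi1 Hexp x0 ltac:(lra))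
    as (C & HC & HDy).
  destruct (Rdichotomy _ _ Hnz) as [HA|HA].
  - exact (forward_instability G rho0 tau _ eta x0 c phi0 (p + n) Htau HG Hnz Heta Hx0 Hc Hest Hstab HA).
  - exact (backward_instability G rho0 tau _ eta x0 c phi0 C (p + n) Htau HG Hnz Heta Hx0 Hc HC Hest HDy Hstab HA).
Qed.
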